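(* Let $0<\alpha<1/2$ and $k\in\mathbb{N}$. Let $f$ be a weakly biased random multiplicative function with $\mathbb{E}f(p)=-\frac{\delta_p}{p^\alpha}$ and $\delta_p\le k$ for every prime $p$, and let $f_{\alpha,k}$ be a random multiplicative function, uniformly coupled with $f$, such that $\mathbb{E}f_{\alpha,k}(p)=-1$ if $k/p^\alpha\ge1$ and $\mathbb{E}f_{\alpha,k}(p)=-k/p^\alpha$ otherwise. Let $F(z)=\sum_{n=1}^\infty f(n)/n^z$ and assume that almost surely $z=1-\alpha$ is a zero of multiplicity $k$ of (the analytic continuation of) $F$. Let $0<\epsilon<1/2-\alpha$. If $M_f(x)=o(x^{1-\alpha-\epsilon})$ almost surely, then almost surely $\mathbb{D}_\sigma(f,f_{\alpha,k})<\infty$ for all $\sigma>1-\alpha-\epsilon$, and the Riemann zeta function $\zeta$ has no zeros in $\{z:\mathrm{Re}(z)>1-\epsilon\}$.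
   Context: $\mathcal{P}$ is the set of primes, $\mu$ the Möbius function. A random multiplicative function is a random function $f:\mathbb{N}\times\Omega\to\{-1,0,1\}$ with $f(1)=1$, $f(n)=|\mu(n)|\prod_{p\mid n}f(p)$ for $n\ge2$, where $\{f(p)\}_{p\in\mathcal{P}}$ are independent $\pm1$-valued random variables. $f$ is biased if $\mathbb{E}f(p)<0$ for all $p$, weakly biased if moreover $\sum_p f(p)/p$ converges almost surely. $M_f(x)=\sum_{n\le x}f(n)$. Two random multiplicative functions $f,g$ are uniformly coupled if they are defined on $\Omega=[0,1]^{\mathcal{P}}$ with the product Lebesgue measure, and for each $p$, $f(p)(\omega)=\mathbf{1}_{(a_p,1]}(\omega_p)-\mathbf{1}_{[0,a_p]}(\omega_p)$ with $a_p=\mathbb{P}(f(p)=-1)$, and likewise for $g$ with $b_p=\mathbb{P}(g(p)=-1)$; in particular $\mathbb{P}(f(p)\ne g(p))=|\mathbb{P}(f(p)=-1)-\mathbb{P}(g(p)=-1)|$. For such $f,g$ and $1/2<\sigma\le1$, $\mathbb{D}_\sigma(f,g)^2:=\sum_{p\in\mathcal{P}}\frac{1-f(p)g(p)}{p^\sigma}$ (possibly $\infty$). *)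

(* Defs.v *)
From HB Require Import structures.
From mathcomp Require Import all_boot all_order all_algebra.
From mathcomp Require Import complex.
From mathcomp Require Import all_classical all_reals all_analysis.

Set Implicit Arguments.
Unset Strict Implicit.
Unset Printing Implicit Defensive.

Import Order.TTheory GRing.Theory Num.Theory.
Import numFieldNormedType.Exports.

Local Open Scope classical_set_scope.
Local Open Scope ring_scope.
Local Open Scope complex_scope.

Definition primeT : Type := {p : nat | prime p}.

Definition moebius (n : nat) : int :=
  if (0 < n)%N && all (fun p => logn p n == 1%N) (primes n)
  then (-1) ^+ size (primes n) else 0.

(* The library's [=o_F] asks for a canonical [filter_on] structure, which +oo
   lacks; this is its definition at +oo. *)
Definition littleo_pinfty {R : realType} (g h : R -> R) : Prop :=
  forall e, 0 < e -> \forall x \near +oo, `|g x| <= e * `|h x|.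

Section random_multiplicative.
Context {d : measure_display} {T : measurableType d} {R : realType}.
Variable P : probability T R.

Definition mutually_independent (I : choiceType) (X : I -> {RV P >-> R}) : Prop :=
  forall s : seq I, uniq s ->
  forall B : I -> set R, (forall i, measurable (B i)) ->
  P (\big[setI/setT]_(i <- s) (X i @^-1` B i)) =
  (\prod_(i <- s) P (X i @^-1` B i))%E.

(* The value [f 0] is junk: it is constrained nowhere and never used. *)
Definition random_multiplicative (f : nat -> {RV P >-> R}) : Prop :=
  [/\ forall w, f 1%N w = 1,
      forall n w, (2 <= n)%N ->
        f n w = `|moebius n|%:~R * \prod_(p <- primes n) f p w,
      forall p w, prime p -> f p w = 1 \/ f p w = -1 &
      mutually_independent (fun p : primeT => f (val p))].

Definition biased (f : nat -> {RV P >-> R}) : Prop :=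
  forall p, prime p -> ('E_P[f p] < 0)%E.

Definition weakly_biased (f : nat -> {RV P >-> R}) : Prop :=
  biased f /\
  {ae P, forall w,
    cvgn (fun N => \sum_(0 <= p < N | prime p) f p w / p%:R)}.

Definition summatory (f : nat -> {RV P >-> R}) (w : T) (x : R) : R :=
  \sum_(1 <= n < (Num.truncn x).+1) f n w.

Definition distD (s : R) (f g : nat -> {RV P >-> R}) (w : T) : \bar R :=
  sqrte (\sum_(0 <= p <oo | prime p) ((1 - f p w * g p w) / p%:R `^ s)%:E)%E.

End random_multiplicative.

Section product_space.
Variable R : realType.

Definition unit_interval : Type := {x : R | 0 <= x <= 1}.

Lemma zero_in_unit_interval : 0 <= (0 : R) <= 1.
Proof. by rewrite lexx ler01. Qed.

HB.instance Definition _ := Choice.on unit_interval.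
HB.instance Definition _ :=
  isPointed.Build unit_interval (exist _ 0 zero_in_unit_interval).

Definition coordinate_sets : set (set (primeT -> unit_interval)) :=
  [set A | exists p : primeT, exists2 B : set R,
     measurable B & A = [set w | B (val (w p))]].

(* [0,1]^primes with its product sigma-algebra. *)
Definition Omega : measurableType coordinate_sets.-sigma :=
  g_sigma_algebraType coordinate_sets.

(* The infinite product of Lebesgue measures is not in the library; it is the
   unique probability with the finite-dimensional product rule below. *)
Definition is_product_lebesgue (P : probability Omega R) : Prop :=
  forall s : seq primeT, uniq s ->
  forall B : primeT -> set R, (forall p, measurable (B p)) ->
  P [set w : Omega | forall p, p \in s -> B p (val (w p))] =
  (\prod_(p <- s) lebesgue_measure (B p `&` `[0%R, 1%R]))%E.

Definition uniform_representation (P : probability Omega R)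
    (f : nat -> {RV P >-> R}) : Prop :=
  forall (p : primeT) (w : Omega),
    let a := fine (P [set v | f (val p) v = -1]) in
    f (val p) w = \1_(`]a, 1]) (val (w p)) - \1_(`[0, a]) (val (w p)).

Definition uniformly_coupled (P : probability Omega R)
    (f g : nat -> {RV P >-> R}) : Prop :=
  [/\ is_product_lebesgue P, uniform_representation f &
      uniform_representation g].

End product_space.

Section dirichlet_series.
Variable R : realType.
Local Notation C := (R[i]^o).

(* n^(-z) for n >= 1, i.e. exp(- z * ln n) written out. *)
Definition npow_opp (n : nat) (z : C) : C :=
  (n%:R `^ (- complex.Re z))%:C *
  (cos (complex.Im z * ln n%:R) -i* sin (complex.Im z * ln n%:R)).

Definition dirichlet_series (a : nat -> R) (z : C) : C :=
  limn (fun N => \sum_(1 <= n < N.+1) (a n)%:C * npow_opp n z : C).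

Definition holomorphic_on (U : set C) (G : C -> C) : Prop :=
  forall z, U z -> derivable G z 1.

(* G continues the Dirichlet series, absolutely convergent for Re z > 1 when
   the coefficients a are bounded, holomorphically to U. *)
Definition analytic_continuation (a : nat -> R) (U : set C) (G : C -> C) : Prop :=
  [/\ open U, [set z : C | 1 < complex.Re z] `<=` U, holomorphic_on U G &
      forall z, 1 < complex.Re z -> G z = dirichlet_series a z].

Definition zero_of_multiplicity (G : C -> C) (z0 : C) (k : nat) : Prop :=
  exists H : C -> C,
    [/\ \forall z \near z0, derivable H z 1,
        H z0 <> 0 &
        \forall z \near z0, G z = (z - z0) ^+ k * H z].

(* The Riemann zeta function on the half-plane Re z > 0, as the holomorphic
   continuation of \sum_n n^(-z) to this half-plane without the pole 1; its
   values elsewhere are unspecified. *)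
Definition riemann_zeta : C -> C :=
  xget (fun=> 0) [set Z | analytic_continuation (fun=> 1)
    [set z : C | 0 < complex.Re z /\ z <> 1] Z].

End dirichlet_series.

(* Main.v *)
Require Import Defs.
From HB Require Import structures.
From mathcomp Require Import all_boot all_order all_algebra.
From mathcomp Require Import complex.
From mathcomp Require Import all_classical all_reals all_analysis.
From mathcomp Require Import measurable_realfun.
From mathcomp Require Import ring lra.
Import Order.TTheory GRing.Theory Num.Theory.
Import numFieldNormedType.Exports.
Local Open Scope classical_set_scope.
Local Open Scope ring_scope.
Local Open Scope complex_scope.

(** Write [f p = X p + E f(p)]. Almost surely the centred series
    [sum_p X p / p^z] converges and is holomorphic for [Re z > 1/2], since its
    partial sums have variance at most [n]. Fix one outcome for which this
    and the two almost sure hypotheses hold. Partial summation continues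
    [F] to [Re z > s0 := 1 - alpha - eps], and multiplying
    [zeta(z + alpha)^k F(z)] by a convergent Euler product and by
    [exp (- sum_p X p / p^z)] gives a function [G] with
    [G(z) = exp (sum_p (k - delta_p) / p^(z + alpha))] for large [Re z].
    The zero of order [k] of [F] at [1 - alpha] cancels the pole of
    [zeta(z + alpha)^k], so [G] is holomorphic on [Re z > s0]. The exponent
    has nonnegative coefficients, hence by Landau's argument (Taylor
    expansion at a real point) it converges for all [Re z > s0]. This bounds
    the expectation of the distance between [f] and [f_(alpha,k)], and shows
    that [G], being an exponential, has no zeros, so neither does
    [zeta(z + alpha)]. *)

Set Implicit Arguments.
Unset Strict Implicit.
Unset Printing Implicit Defensive.

(** * Integrals of continuous functions over segments *)

(** A logarithm of [G] would be the natural object, but it is holomorphic only where [G] has no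
    zeros, which is part of the claim. Landau's argument is therefore run on [G] itself: beyond the
    constant term, the Taylor coefficients of the exponential of a series with nonnegative
    coefficients dominate those of the series, so a large disc of convergence for [G] is inherited
    by the exponent. For the same reason no Euler factor is expanded logarithmically: its
    first-order part is compensated by an exponential, which leaves [1 + O(p^(-2 Re z))]. This and
    the variance bound are where [1/2] comes from, and [eps < 1/2 - alpha] keeps [s0] above it. The
    exponent has deterministic coefficients, so one good outcome settles its convergence. Randomness
    returns only through the coupling, where the expectation of [1 - f(p) f_(alpha,k)(p)] is the
    difference of the two means, at most [(k - delta_p) / p^alpha]. *)

Section segment_integral.
Variable R : realType.
Implicit Types (g G : R -> R) (a b c : R).

(* Only increments of primitives are used, so that measure theory enters
   solely through [continuous_primitive]. *)
Definition is_int g a b (v : R) :=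
  exists2 G, (forall x, a <= x <= b -> is_derive x 1 G (g x)) & v = G b - G a.

Definition Int g a b : R := xget 0 [set v | is_int g a b v].

Lemma MVT_closed G g a b : a <= b ->
  (forall x, a <= x <= b -> is_derive x 1 G (g x)) ->
  exists2 c, a <= c <= b & G b - G a = g c * (b - a).
Proof.
move=> ab dG; have [||c cab E] := @MVT_segment R G g a b ab.
- by move=> x; rewrite in_itv /= => /andP[h1 h2]; apply: dG; rewrite !ltW.
- apply: derivable_within_continuous => x; rewrite in_itv /= => h.
  by have [] := dG _ h.
- by exists c => //; move: cab; rewrite in_itv.
Qed.

Lemma is_int_uniq g a b v w : a <= b ->
  is_int g a b v -> is_int g a b w -> v = w.
Proof.
move=> ab [G dG ->] [H dH ->].
have [|c _ E] := @MVT_closed (G - H) (g - g) a b ab.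
  by move=> x xab; have ? := dG _ xab; have ? := dH _ xab; apply: is_deriveB.
move: E; rewrite !fctE subrr mul0r => E.
by apply/eqP; rewrite -subr_eq0 -E; apply/eqP; ring.
Qed.

Lemma IntE g G a b : a <= b ->
  (forall x, a <= x <= b -> is_derive x 1 G (g x)) -> Int g a b = G b - G a.
Proof.
move=> ab dG; apply: (@is_int_uniq g a b _ _ ab); last by exists G.
by rewrite /Int; apply: (@xgetPex _ 0 [set v | is_int g a b v]); exists (G b - G a); exists G.
Qed.

Lemma continuous_primitive g a b : continuous g -> a <= b ->
  exists G, forall x, a <= x <= b -> is_derive x 1 G (g x).
Proof.
(* Integrating from [a - 1] puts [a] in the interior, so the derivative there is two-sided. *)
move=> cg ab; exists (fun x => (\int[lebesgue_measure]_(t in `[a - 1, x]) g t)%R) => x /andP[ax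
  xb].
have [||||dF E] := @continuous_FTC1_closed R g (a - 1) x (b + 1).
- by rewrite (le_lt_trans xb) // ltrDl.
- apply: continuous_compact_integrable; first exact: segment_compact.
  by apply: continuous_subspaceT => y; exact: cg.
- by rewrite (lt_le_trans _ ax) // ltrBlDr ltrDl.
- exact: cg.
- by apply: DeriveDef; [exact: dF|rewrite -derive1E].
Qed.

Lemma Int_MVT g a b : continuous g -> a <= b ->
  exists2 c, a <= c <= b & Int g a b = g c * (b - a).
Proof.
move=> cg ab; have [G dG] := continuous_primitive cg ab.
by have [c cab E] := MVT_closed ab dG; exists c => //; rewrite (IntE ab dG).
Qed.

Lemma Int_bound g a b M : continuous g -> a <= b ->
  (forall x, a <= x <= b -> `|g x| <= M) -> `|Int g a b| <= M * (b - a).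
Proof.
move=> cg ab gM; have [c cab ->] := Int_MVT cg ab.
by rewrite normrM (ger0_norm (_ : 0 <= b - a)) ?subr_ge0// ler_wpM2r ?subr_ge0// gM.
Qed.

Lemma Int_split g a c b : continuous g -> a <= c -> c <= b ->
  Int g a b = Int g a c + Int g c b.
Proof.
move=> cg ac cb; have [G dG] := continuous_primitive cg (le_trans ac cb).
have d1 x : a <= x <= c -> is_derive x 1 G (g x).
  by move=> /andP[h1 h2]; apply: dG; rewrite h1 (le_trans h2).
have d2 x : c <= x <= b -> is_derive x 1 G (g x).
  by move=> /andP[h1 h2]; apply: dG; rewrite h2 (le_trans ac).
by rewrite (IntE (le_trans ac cb) dG) (IntE ac d1) (IntE cb d2); ring.
Qed.

Lemma IntD g h a b : continuous g -> continuous h -> a <= b ->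
  Int (fun x => g x + h x) a b = Int g a b + Int h a b.
Proof.
move=> cg ch ab; have [G dG] := continuous_primitive cg ab.
have [H dH] := continuous_primitive ch ab.
have d x : a <= x <= b -> is_derive x 1 (G + H) (g x + h x).
  by move=> xab; have ? := dG _ xab; have ? := dH _ xab; apply: is_deriveD.
by rewrite (IntE ab dG) (IntE ab dH) (IntE ab d) ?fctE; ring.
Qed.

Lemma IntZ g (k : R) a b : continuous g -> a <= b ->
  Int (fun x => k * g x) a b = k * Int g a b.
Proof.
move=> cg ab; have [G dG] := continuous_primitive cg ab.
have d x : a <= x <= b -> is_derive x 1 (k \*: G) (k * g x).
  by move=> xab; have ? := dG _ xab; apply: is_deriveZ.
by rewrite (IntE ab dG) (IntE ab d) /= /GRing.scale /=; ring.
Qed.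

End segment_integral.

(** * Complex differentiability *)

Section complex_basics.
Variable R : realType.
Local Notation C := R[i].
Local Notation Re := complex.Re.
Local Notation Im := complex.Im.
Implicit Types z w : C.
(** The norm of [R[i]] is itself an element of [R[i]]; a real-valued modulus lets [lra] and the real
    order lemmas act on the estimates. *)
Definition cmod z : R := Normc.normc z.

Lemma normCE z : `|z| = (cmod z)%:C. Proof. by []. Qed.
Lemma cmod_ge0 z : 0 <= cmod z. Proof. by case: z => a b; exact: sqrtr_ge0. Qed.
Lemma cmod0 : cmod 0 = 0. Proof. exact: Normc.normc0. Qed.
Lemma cmod1 : cmod 1 = 1. Proof. exact: Normc.normc1. Qed.
Lemma cmod0_eq z : cmod z = 0 -> z = 0. Proof. exact: Normc.eq0_normc. Qed.
Lemma cmod_eq0 z : (cmod z == 0) = (z == 0).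
Proof. by apply/eqP/eqP => [/cmod0_eq//|->]; rewrite cmod0. Qed.
Lemma cmod_gt0 z : (0 < cmod z) = (z != 0).
Proof. by rewrite lt_def cmod_ge0 andbT cmod_eq0. Qed.
Lemma cmodM z w : cmod (z * w) = cmod z * cmod w. Proof. exact: Normc.normcM. Qed.
Lemma cmodV z : cmod z^-1 = (cmod z)^-1. Proof. exact: Normc.normcV. Qed.
Lemma cmodN z : cmod (- z) = cmod z. Proof. exact: normcN. Qed.
Lemma cmodD z w : cmod (z + w) <= cmod z + cmod w. Proof. exact: le_normcD. Qed.
Lemma cmodB z w : cmod (z - w) <= cmod z + cmod w. Proof. by rewrite -(cmodN w) cmodD. Qed.
Lemma cmodBC z w : cmod (z - w) = cmod (w - z). Proof. by rewrite -cmodN opprB. Qed.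
Lemma cmodX z n : cmod (z ^+ n) = cmod z ^+ n.
Proof. by elim: n => [|n IH]; rewrite ?expr0 ?cmod1// !exprS cmodM IH. Qed.
Lemma cmodR (x : R) : cmod x%:C = `|x|.
Proof. by rewrite /cmod /= expr0n /= addr0 sqrtr_sqr. Qed.
Lemma cmod_Re z : `|Re z| <= cmod z.
Proof. by case: z => a b; rewrite /cmod /= -sqrtr_sqr ler_sqrt ?lerDl ?addr_ge0 ?sqr_ge0. Qed.
Lemma cmod_Im z : `|Im z| <= cmod z.
Proof. by case: z => a b; rewrite /cmod /= -sqrtr_sqr ler_sqrt ?lerDr ?addr_ge0 ?sqr_ge0. Qed.
Lemma ReD z w : Re (z + w) = Re z + Re w. Proof. by case: z w => ? ? []. Qed.
Lemma ImD z w : Im (z + w) = Im z + Im w. Proof. by case: z w => ? ? []. Qed.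
Lemma ReN z : Re (- z) = - Re z. Proof. by case: z. Qed.
Lemma ImN z : Im (- z) = - Im z. Proof. by case: z. Qed.
Lemma ReB z w : Re (z - w) = Re z - Re w. Proof. by case: z w => ? ? []. Qed.
Lemma ImB z w : Im (z - w) = Im z - Im w. Proof. by case: z w => ? ? []. Qed.
Lemma ReM z w : Re (z * w) = Re z * Re w - Im z * Im w. Proof. by case: z w => ? ? []. Qed.
Lemma ImM z w : Im (z * w) = Re z * Im w + Im z * Re w. Proof. by case: z w => ? ? []. Qed.
Lemma eqC z w : Re z = Re w -> Im z = Im w -> z = w.
Proof. by case: z w => ? ? [? ?] /= -> ->. Qed.
Lemma CRI z : z = Re z +i* Im z. Proof. by case: z. Qed.
Lemma cmod_le_ReIm z : cmod z <= `|Re z| + `|Im z|.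
Proof.
rewrite {1}(complexE z) (le_trans (cmodD _ _)) // cmodM !cmodR.
by rewrite /cmod /= expr0n expr1n add0r sqrtr1 mul1r.
Qed.
Lemma cmod_sum I (r : seq I) (F : I -> C) (P : pred I) :
  cmod (\sum_(i <- r | P i) F i) <= \sum_(i <- r | P i) cmod (F i).
Proof.
elim/big_ind2 : _ => [|x1 x2 y1 y2 h1 h2|//]; first by rewrite cmod0.
by rewrite (le_trans (cmodD _ _)) // lerD.
Qed.
Lemma cmod_prod I (r : seq I) (F : I -> C) (P : pred I) :
  cmod (\prod_(i <- r | P i) F i) = \prod_(i <- r | P i) cmod (F i).
Proof. by elim/big_rec2 : _ => [|i x y _ <-]; rewrite ?cmod1 ?cmodM. Qed.

(** Stated as a first-order expansion with error [o(h)]: without a quotient, [h = 0] is no exception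
    and the product and chain rules are plain estimates. *)
Definition cderiv (u : C -> C) z (d : C) := forall e : R, 0 < e ->
  exists2 r : R, 0 < r & forall h, cmod h < r ->
    cmod (u (z + h) - u z - d * h) <= e * cmod h.

Definition hol (u : C -> C) z := exists d, cderiv u z d.

Lemma cderiv_derivable (u : C^o -> C^o) z d : cderiv u z d -> derivable u z 1.
Proof.
move=> du; rewrite /derivable; apply/cvg_ex; exists d.
apply/cvgrPdist_le => /= e e0.
have e0R : 0 < Re e by move: e0; rewrite ltcE => /andP[].
have [r r0 hr] := du _ e0R.
exists (r%:C); first by rewrite /= ltcR.
move=> h /=; rewrite sub0r normrN normCE ltcR => hlt h0.
have -> : d - h^-1 *: (u (h *: 1 + z) - u z) = - (h^-1 * (u (z + h) - u z - d * h)).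
  rewrite /GRing.scale /= mulr1 (addrC h); have := mulVf h0 => E.
  by rewrite !mulrBr mulrCA E; ring.
rewrite normrN normCE.
have -> : e = (Re e)%:C by move: e0; rewrite ltcE => /andP[/eqP E _];
  case: e E {e0R hr} => a b /= ->.
rewrite lecR cmodM cmodV mulrC ler_pdivrMr ?cmod_gt0//; exact: hr.
Qed.

Lemma derivable_cderiv (u : C^o -> C^o) z : derivable u z 1 -> hol u z.
Proof.
rewrite /derivable => /cvg_ex [d /cvgrPdist_le /= du]; exists d => e e0.
have /du[] : 0 < e%:C :> C by rewrite ltcR.
move=> r /= r0 hr; exists (Re r); first by move: r0; rewrite ltcE => /andP[].
move=> h hh; have [->|h0] := eqVneq h 0.
  by rewrite addr0 subrr mulr0 subr0 cmod0 mulr0.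
have /= := hr h _ h0.
rewrite sub0r normrN normCE.
have rE : r = (Re r)%:C by move: r0; rewrite ltcE => /andP[/eqP E _];
  case: r E {hr hh} => a b /= ->.
rewrite rE ltcR => /(_ hh).
have -> : d - h^-1 *: (u (h *: 1 + z) - u z) = - (h^-1 * (u (z + h) - u z - d * h)).
  rewrite /GRing.scale /= mulr1 (addrC h); have := mulVf h0 => E.
  by rewrite !mulrBr mulrCA E; ring.
by rewrite normrN normCE lecR cmodM cmodV mulrC ler_pdivrMr ?cmod_gt0.
Qed.
End complex_basics.

Section holomorphy.
Variable R : realType.
Local Notation C := R[i].
Local Notation Re := complex.Re.
Local Notation Im := complex.Im.
Implicit Types (z w h : C) (u v phi psi : C -> C).

Definition near0 (Q : C -> Prop) := exists2 r : R, 0 < r & forall h, cmod h < r -> Q h.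

Lemma near0_and (Q1 Q2 : C -> Prop) : near0 Q1 -> near0 Q2 -> near0 (fun h => Q1 h /\ Q2 h).
Proof.
move=> [r r0 h1] [s s0 h2]; exists (Num.min r s); first by rewrite lt_min r0.
by move=> h; rewrite lt_min => /andP[? ?]; split; [exact: h1|exact: h2].
Qed.

Lemma near0_imp (Q1 Q2 : C -> Prop) : (forall h, Q1 h -> Q2 h) -> near0 Q1 -> near0 Q2.
Proof. by move=> hQ [r r0 h1]; exists r => // h /h1 /hQ. Qed.

(** These are [o(1)] and [o(h)] as [h] tends to 0; the rules of differentiation become algebra with
    the two classes. *)
Definition vanish phi := forall e : R, 0 < e -> near0 (fun h => cmod (phi h) <= e).
Definition small phi := forall e : R, 0 < e -> near0 (fun h => cmod (phi h) <= e * cmod h).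

Lemma vanishD phi psi : vanish phi -> vanish psi -> vanish (fun h => phi h + psi h).
Proof.
move=> h1 h2 e e0; have e20 : 0 < e / 2 by rewrite divr_gt0.
apply: near0_imp (near0_and (h1 _ e20) (h2 _ e20)) => h [k1 k2].
by apply: (le_trans (cmodD _ _)); lra.
Qed.

Lemma vanishM phi psi M : vanish phi -> near0 (fun h => cmod (psi h) <= M) ->
  vanish (fun h => phi h * psi h).
Proof.
move=> h1 h2 e e0; have M1 : 0 < `|M| + 1 by rewrite ltr_wpDl.
have e20 : 0 < e / (`|M| + 1) by rewrite divr_gt0.
apply: near0_imp (near0_and (h1 _ e20) h2) => h [k1 k2]; rewrite cmodM.
have -> : e = e / (`|M| + 1) * (`|M| + 1) by rewrite divfK ?gt_eqF.
by rewrite ler_pM ?cmod_ge0 // (le_trans k2) // (le_trans (ler_norm _)) // lerDl.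
Qed.

Lemma smallD phi psi : small phi -> small psi -> small (fun h => phi h + psi h).
Proof.
move=> h1 h2 e e0; have e20 : 0 < e / 2 by rewrite divr_gt0.
apply: near0_imp (near0_and (h1 _ e20) (h2 _ e20)) => h [k1 k2].
by apply: (le_trans (cmodD _ _)); lra.
Qed.

Lemma smallM phi psi M : small phi -> near0 (fun h => cmod (psi h) <= M) ->
  small (fun h => phi h * psi h).
Proof.
move=> h1 h2 e e0; have M1 : 0 < `|M| + 1 by rewrite ltr_wpDl.
have e20 : 0 < e / (`|M| + 1) by rewrite divr_gt0.
apply: near0_imp (near0_and (h1 _ e20) h2) => h [k1 k2]; rewrite cmodM.
have -> : e * cmod h = e / (`|M| + 1) * cmod h * (`|M| + 1) by rewrite mulrAC divfK ?gt_eqF.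
by rewrite ler_pM ?cmod_ge0 // (le_trans k2) // (le_trans (ler_norm _)) // lerDl.
Qed.

Lemma vanish_small phi : vanish phi -> small (fun h => phi h * h).
Proof.
move=> hp e e0; apply: near0_imp (hp _ e0) => h k; rewrite cmodM.
by rewrite ler_wpM2r ?cmod_ge0.
Qed.

Lemma near0_cst (z : C) : near0 (fun=> cmod z <= cmod z).
Proof. by exists 1. Qed.

Lemma near0_eq_small phi psi : phi =1 psi -> small phi -> small psi.
Proof. by move=> E hp e /hp; apply: near0_imp => h; rewrite E. Qed.

Lemma near0_eq_vanish phi psi : phi =1 psi -> vanish phi -> vanish psi.
Proof. by move=> E hp e /hp; apply: near0_imp => h; rewrite E. Qed.

Lemma cderivP u z d : cderiv u z d <-> small (fun h => u (z + h) - u z - d * h).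
Proof. by []. Qed.

Definition ccont u z := vanish (fun h => u (z + h) - u z).

Lemma vanish_lin d : vanish (fun h => d * h).
Proof.
move=> e e0; have M1 : 0 < cmod d + 1 by rewrite ltr_wpDl ?cmod_ge0.
exists (e / (cmod d + 1)); first by rewrite divr_gt0.
move=> h; rewrite ltr_pdivlMr // cmodM => k; rewrite (le_trans _ (ltW k)) // mulrC.
by rewrite ler_wpM2l ?cmod_ge0 // lerDl.
Qed.

Lemma small_vanish phi : small phi -> vanish phi.
Proof.
move=> h1 e e0; have [r r0 k] := h1 _ e0; exists (Num.min r 1); first by rewrite lt_min r0 ltr01.
move=> h; rewrite lt_min => /andP[k1 k2]; apply: (le_trans (k _ k1)).
by rewrite ler_piMr // ltW.
Qed.

Lemma hol_ccont u z : hol u z -> ccont u z.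
Proof.
move=> [d /cderivP du]; apply: near0_eq_vanish (vanishD (small_vanish du) (vanish_lin d)) => h.
by rewrite subrK.
Qed.

Lemma ccont_bounded u z : ccont u z -> near0 (fun h => cmod (u (z + h)) <= cmod (u z) + 1).
Proof.
move=> cu; apply: near0_imp (cu 1 ltr01) => h k.
have -> : u (z + h) = u z + (u (z + h) - u z) by ring.
by apply: (le_trans (cmodD _ _)); rewrite lerD2l.
Qed.

Lemma cderiv_cst (k : C) z : cderiv (fun=> k) z 0.
Proof. by move=> e e0; exists 1 => // h _;
  rewrite subrr mul0r subrr cmod0 mulr_ge0 ?cmod_ge0 ?ltW. Qed.

Lemma cderiv_id z : cderiv id z 1.
Proof.
move=> e e0; exists 1 => // h _ /=.
by rewrite mul1r [z + h]addrC addrK subrr cmod0 mulr_ge0 ?cmod_ge0 ?ltW.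
Qed.

Lemma cderivD u v z d d' : cderiv u z d -> cderiv v z d' ->
  cderiv (fun w => u w + v w) z (d + d').
Proof.
move=> /cderivP du /cderivP dv; apply/cderivP; apply: near0_eq_small (smallD du dv) => h.
by ring.
Qed.

Lemma cderivM u v z d d' : cderiv u z d -> cderiv v z d' ->
  cderiv (fun w => u w * v w) z (d * v z + u z * d').
Proof.
move=> du dv; apply/cderivP.
have hv := ccont_bounded (hol_ccont (ex_intro _ d' dv)).
have cv := hol_ccont (ex_intro _ d' dv).
have := smallD (smallD (smallM du hv) (smallM dv (near0_cst (u z))))
  (vanish_small (vanishM cv (near0_cst d))).
by apply: near0_eq_small => h; ring.
Qed.

Lemma cderivN u z d : cderiv u z d -> cderiv (fun w => - u w) z (- d).
Proof.
move=> du e /du; apply: near0_imp => h.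
by rewrite -(cmodN (u (z + h) - u z - d * h)); congr (cmod _ <= _); ring.
Qed.

Lemma cderiv_comp u v z d d' : cderiv v z d' -> cderiv u (v z) d ->
  cderiv (fun w => u (v w)) z (d * d').
Proof.
move=> dv du; apply/cderivP.
have cv := hol_ccont (ex_intro _ d' dv).
have s1 : small (fun h => u (v (z + h)) - u (v z) - d * (v (z + h) - v z)).
  move=> e e0; have M1 : 0 < cmod d' + 1 by rewrite ltr_wpDl ?cmod_ge0.
  have e10 : 0 < e / (cmod d' + 1) by rewrite divr_gt0.
  have [r r0 hr] := du _ e10; have r20 : 0 < r / 2 by rewrite divr_gt0.
  apply: near0_imp (near0_and (cv _ r20) (dv _ ltr01)) => h [k1 k2].
  have := hr (v (z + h) - v z); rewrite [v z + _]addrC subrK => H.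
  apply: (le_trans (H _)); first by lra.
  have -> : e * cmod h = e / (cmod d' + 1) * ((cmod d' + 1) * cmod h).
    by rewrite mulrA divfK ?gt_eqF.
  rewrite ler_wpM2l  ?(ltW e10) //.
  have -> : v (z + h) - v z = (v (z + h) - v z - d' * h) + d' * h by ring.
  by apply: (le_trans (cmodD _ _)); rewrite cmodM; lra.
have := smallD s1 (smallM dv (near0_cst d)).
by apply: near0_eq_small => h; ring.
Qed.

Lemma ccont_nz u z : ccont u z -> u z != 0 -> near0 (fun h => cmod (u z) / 2 <= cmod (u (z + h))).
Proof.
move=> cu nz; have p : 0 < cmod (u z) / 2 by rewrite divr_gt0 ?cmod_gt0.
apply: near0_imp (cu _ p) => h k; have := cmodB (u (z + h)) (u (z + h) - u z).
by rewrite subKr => H; lra.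
Qed.

Lemma cderivV z : z != 0 -> cderiv (fun w => w^-1) z (- z ^- 2).
Proof.
move=> nz; apply/cderivP.
have cz : ccont id z by apply: hol_ccont; exists 1; exact: cderiv_id.
have nn := ccont_nz cz nz.
have p : 0 < cmod z / 2 by rewrite divr_gt0 ?cmod_gt0.
have s1 : small (fun h => h * h).
  by apply: vanish_small; apply: near0_eq_vanish (vanish_lin 1) => h; rewrite mul1r.
have bd : near0 (fun h => cmod (z ^- 2 * (z + h)^-1) <= cmod (z ^- 2) * (cmod z / 2)^-1).
  apply: near0_imp nn => h k; rewrite cmodM ler_wpM2l ?cmod_ge0 // cmodV lef_pV2 //.
  by rewrite posrE (lt_le_trans p k).
move=> e e0; apply: near0_imp (near0_and nn (smallM s1 bd e0)) => h [k1 k2].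
have nzh : z + h != 0 by rewrite -cmod_gt0 (lt_le_trans p k1).
suff -> : (z + h)^-1 - z^-1 - - z ^- 2 * h = h * h * (z ^- 2 / (z + h)) by [].
by field; rewrite ?nz ?nzh ?(mulf_neq0 nz nz).
Qed.

Lemma cderiv_eqd u z d d' : d = d' -> cderiv u z d -> cderiv u z d'.
Proof. by move=> ->. Qed.

Lemma cderivX n z : cderiv (fun w => w ^+ n.+1) z (n.+1%:R * z ^+ n).
Proof.
elim: n => [|n IH].
  apply: cderiv_eqd (_ : cderiv (fun w => w ^+ 1) z 1); last exact: cderiv_id.
  by rewrite expr0 mulr1.
have := cderivM (cderiv_id z) IH.
by apply: cderiv_eqd; rewrite -(natr1 n.+1) !exprS; ring.
Qed.

Lemma cderiv_ext u v z d : near0 (fun h => u (z + h) = v (z + h)) ->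
  cderiv u z d -> cderiv v z d.
Proof.
move=> E du e e0; have [s s0 hs] := E.
have E0 : u z = v z by have := hs 0; rewrite cmod0 addr0; apply.
by apply: near0_imp (near0_and E (du e e0)) => h [<-]; rewrite E0.
Qed.

Lemma hol_ext u v z : near0 (fun h => u (z + h) = v (z + h)) -> hol u z -> hol v z.
Proof. by move=> E [d du]; exists d; exact: cderiv_ext E du. Qed.
Lemma hol_cst k z : hol (fun=> k) z. Proof. by exists 0; exact: cderiv_cst. Qed.
Lemma hol_id z : hol id z. Proof. by exists 1; exact: cderiv_id. Qed.
Lemma holD u v z : hol u z -> hol v z -> hol (fun w => u w + v w) z.
Proof. by move=> [d du] [d' dv]; eexists; exact: cderivD du dv. Qed.
Lemma holN u z : hol u z -> hol (fun w => - u w) z.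
Proof. by move=> [d du]; eexists; exact: cderivN du. Qed.
Lemma holB u v z : hol u z -> hol v z -> hol (fun w => u w - v w) z.
Proof. by move=> hu hv; apply: holD => //; exact: holN. Qed.
Lemma holM u v z : hol u z -> hol v z -> hol (fun w => u w * v w) z.
Proof. by move=> [d du] [d' dv]; eexists; exact: cderivM du dv. Qed.
Lemma hol_comp u v z : hol v z -> hol u (v z) -> hol (fun w => u (v w)) z.
Proof. by move=> [d du] [d' dv]; eexists; exact: cderiv_comp du dv. Qed.
Lemma holV u z : hol u z -> u z != 0 -> hol (fun w => (u w)^-1) z.
Proof. by move=> hu nz; apply: (@hol_comp (fun w => w^-1)) => //; eexists; exact: cderivV. Qed.
Lemma holX u z n : hol u z -> hol (fun w => u w ^+ n) z.
Proof.
move=> hu; elim: n => [|n IH]; first exact: hol_cst.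
apply: hol_ext (holM hu IH); exists 1 => // h _; by rewrite exprS.
Qed.
Lemma hol_prod I (r : seq I) (P : pred I) (F : I -> C -> C) z :
  (forall i, P i -> hol (F i) z) -> hol (fun w => \prod_(i <- r | P i) F i w) z.
Proof.
move=> hF; elim: r => [|i r IH].
  by apply: hol_ext (hol_cst 1 z); exists 1 => // h _; rewrite big_nil.
case: (boolP (P i)) => Pi.
  apply: hol_ext (holM (hF i Pi) IH); exists 1 => // h _; by rewrite big_cons Pi.
by apply: hol_ext IH; exists 1 => // h _; rewrite big_cons (negbTE Pi).
Qed.

Lemma is_derive_real (g : R -> R) (x d : R) :
  (forall e : R, 0 < e -> exists2 r : R, 0 < r & forall h : R, `|h| < r ->
    `|g (x + h) - g x - d * h| <= e * `|h|) -> is_derive x 1 g d.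
Proof.
move=> du.
have H : (fun h : R => h^-1 *: (g (h *: (1 : R) + x) - g x)) @ (0 : R)^' --> d.
  apply/cvgrPdist_le => /= e e0; have [r r0 hr] := du _ e0.
  exists r => // h /=; rewrite sub0r normrN => hlt h0.
  have -> : d - h^-1 *: (g (h *: (1:R) + x) - g x) = - (h^-1 * (g (x + h) - g x - d * h)).
    rewrite /GRing.scale /= mulr1 (addrC h); have := mulVf h0 => E.
    by rewrite !mulrBr mulrCA E; ring.
  by rewrite normrN normrM normfV mulrC ler_pdivrMr ?normr_gt0//; exact: hr.
apply: DeriveDef; first by apply/cvg_ex; exists d.
exact/cvg_lim.
Qed.

(** Restriction to a line turns a complex primitive into two real ones, so integrals along edges are
    computed by real primitives. *)
Lemma cderiv_line u z d (v : C) (t : R) : cderiv u (z + t%:C * v) d ->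
  is_derive t 1 (fun s : R => Re (u (z + s%:C * v))) (Re (d * v)) /\
  is_derive t 1 (fun s : R => Im (u (z + s%:C * v))) (Im (d * v)).
Proof.
move=> du; have H e : 0 < e -> exists2 r, 0 < r & forall h : R, `|h| < r ->
    cmod (u (z + (t + h)%:C * v) - u (z + t%:C * v) - h%:C * (d * v)) <= e * `|h|.
  move=> e0; have M1 : 0 < cmod v + 1 by rewrite ltr_wpDl ?cmod_ge0.
  have [r r0 hr] := du _ (divr_gt0 e0 M1).
  exists (r / (cmod v + 1)); first by rewrite divr_gt0.
  move=> h; rewrite ltr_pdivlMr // => k.
  have hv : cmod (h%:C * v) <= `|h| * (cmod v + 1).
    by rewrite cmodM cmodR ler_wpM2l // lerDl.
  have := hr (h%:C * v) (le_lt_trans hv k).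
  have -> : z + t%:C * v + h%:C * v = z + (t + h)%:C * v by rewrite rmorphD /=; ring.
  rewrite (mulrCA d); move/le_trans; apply.
  have -> : e * `|h| = e / (cmod v + 1) * (`|h| * (cmod v + 1)).
    by field; rewrite gt_eqF.
  by rewrite ler_wpM2l // ltW // divr_gt0.
split; apply: is_derive_real => e /H [r r0 hr]; exists r => // h /hr.
- apply: le_trans; rewrite (le_trans _ (cmod_Re _)) // !ReB [Re (h%:C * _)]ReM /= mul0r subr0.
  by rewrite (mulrC h).
- apply: le_trans; rewrite (le_trans _ (cmod_Im _)) // !ImB [Im (h%:C * _)]ImM /= mul0r addr0.
  by rewrite (mulrC h).
Qed.

Definition lcont (g : R -> C) := continuous (fun x => Re (g x)) /\ continuous (fun x => Im (g x)).

Lemma ccont_line u z (v : C) : (forall t : R, ccont u (z + t%:C * v)) -> lcont (fun t => u (z +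
  t%:C * v)).
Proof.
move=> cu; have H t e : 0 < e -> exists2 r, 0 < r & forall h : R, `|h| < r ->
    cmod (u (z + t%:C * v) - u (z + (t + h)%:C * v)) <= e.
  move=> e0; have M1 : 0 < cmod v + 1 by rewrite ltr_wpDl ?cmod_ge0.
  have [r r0 hr] := cu t _ e0.
  exists (r / (cmod v + 1)); first by rewrite divr_gt0.
  move=> h; rewrite ltr_pdivlMr // => k.
  have hv : cmod (h%:C * v) <= `|h| * (cmod v + 1).
    by rewrite cmodM cmodR ler_wpM2l // lerDl.
  have := hr (h%:C * v) (le_lt_trans hv k).
  have -> : z + t%:C * v + h%:C * v = z + (t + h)%:C * v by rewrite rmorphD /=; ring.
  by rewrite cmodBC.
split=> t; apply/cvgrPdist_le => e e0; have [r r0 hr] := H t e e0;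
  exists r => // s /= hs; have := hr (s - t); rewrite distrC in hs.
- move=> /(_ hs); apply: le_trans; rewrite -ReB [t + _]addrC subrK; exact: cmod_Re.
- move=> /(_ hs); apply: le_trans; rewrite -ImB [t + _]addrC subrK; exact: cmod_Im.
Qed.

Definition CInt (g : R -> C) a b : C :=
  Int (fun x => Re (g x)) a b +i* Int (fun x => Im (g x)) a b.

Lemma CIntD (g h : R -> C) a b : lcont g -> lcont h -> a <= b ->
  CInt (fun x => g x + h x) a b = CInt g a b + CInt h a b.
Proof.
move=> [c1 c2] [d1 d2] ab; rewrite /CInt; apply: eqC => /=.
- by under eq_fun do rewrite ReD; rewrite IntD.
- by under eq_fun do rewrite ImD; rewrite IntD.
Qed.

Lemma CIntZ k g a b : lcont g -> a <= b -> CInt (fun x => k * g x) a b = k * CInt g a b.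
Proof.
move=> [c1 c2] ab; have cZ (r : R) (p : R -> R) : continuous p -> continuous (fun x => r * p x).
  by move=> cp x; apply: continuousM; [exact: cst_continuous|exact: cp].
apply: eqC; rewrite ?ReM ?ImM /=.
- under eq_fun do rewrite ReM -mulNr.
  by rewrite IntD ?IntZ// ?mulNr//; exact: cZ.
- under eq_fun do rewrite ImM.
  by rewrite IntD ?IntZ//; exact: cZ.
Qed.

Lemma CInt_split g a c b : lcont g -> a <= c -> c <= b -> CInt g a b = CInt g a c + CInt g c b.
Proof.
by move=> [c1 c2] ac cb; apply: eqC => /=; rewrite (@Int_split _ _ a c b).
Qed.

(** The factor 2 is the price of bounding real and imaginary parts separately. *)
Lemma CInt_bound g a b M : lcont g -> a <= b ->
  (forall x, a <= x <= b -> cmod (g x) <= M) -> cmod (CInt g a b) <= 2 * M * (b - a).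
Proof.
move=> [c1 c2] ab gM; rewrite (le_trans (cmod_le_ReIm _)) //=.
have -> : 2 * M * (b - a) = M * (b - a) + M * (b - a) by ring.
apply: lerD; apply: Int_bound => // x /gM.
- by apply: le_trans; exact: cmod_Re.
- by apply: le_trans; exact: cmod_Im.
Qed.

Lemma CIntE (u U : C -> C) z (v : C) a b : a <= b ->
  (forall t : R, a <= t <= b -> cderiv U (z + t%:C * v) (u (z + t%:C * v))) ->
  CInt (fun t => u (z + t%:C * v) * v) a b = U (z + b%:C * v) - U (z + a%:C * v).
Proof.
move=> ab dU.
have dR t : a <= t <= b -> is_derive t 1 (fun s : R => Re (U (z + s%:C * v))) (Re (u (z + t%:C
  * v) * v)).
  by move=> /dU dt; have [] := cderiv_line dt.
have dI t : a <= t <= b -> is_derive t 1 (fun s : R => Im (U (z + s%:C * v))) (Im (u (z + t%:C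
  * v) * v)).
  by move=> /dU dt; have [] := cderiv_line dt.
by apply: eqC; rewrite ?ReB ?ImB /=; [rewrite (IntE ab dR)|rewrite (IntE ab dI)].
Qed.

Lemma eq_CInt (g h : R -> C) a b : g =1 h -> CInt g a b = CInt h a b.
Proof. by move=> /funext ->. Qed.
End holomorphy.

(** * Goursat's theorem *)

Section rectangle_integral.
Variable R : realType.
Local Notation C := R[i].
Local Notation Re := complex.Re.
Local Notation Im := complex.Im.
Local Notation ii := (0 +i* 1 : C).
Implicit Types (z w : C) (g u v : C -> C) (a b c d : R).

(** Points of a horizontal and of a vertical line, kept in the shape base plus [t] times direction
    so that [ccont_line] and [CIntE] apply directly. *)
Definition hpt (y t : R) : C := (0 +i* y) + t%:C * 1.
Definition vpt (x t : R) : C := x%:C + t%:C * ii.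
Lemma hptE y t : hpt y t = t +i* y. Proof. by apply: eqC; rewrite /= ?mulr1 ?mulr0 ?mul0r;
  ring. Qed.
Lemma vptE x t : vpt x t = x +i* t. Proof. by apply: eqC; rewrite /= ?mulr1 ?mulr0 ?mul0r;
  ring. Qed.

(** The whole lines through the edges, not only the edges: [continuous_primitive] wants integrands
    continuous on all of [R]. *)
Definition on_lines a b c d z := [\/ Im z = c, Im z = d, Re z = a | Re z = b].
Definition econt a b c d g := forall z, on_lines a b c d z -> ccont g z.
Definition in_rect a b c d z := a <= Re z <= b /\ c <= Im z <= d.
Definition on_edges a b c d z := in_rect a b c d z /\ on_lines a b c d z.

(** The contour integral along the boundary of the rectangle, counterclockwise; [dz] is [dt] on
    horizontal and [i dt] on vertical edges. *)
Definition J g a b c d : C :=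
  CInt (fun t => g (hpt c t)) a b + ii * CInt (fun t => g (vpt b t)) c d
  - CInt (fun t => g (hpt d t)) a b - ii * CInt (fun t => g (vpt a t)) c d.

Lemma econt_lcont a b c d g : econt a b c d g ->
  [/\ lcont (fun t => g (hpt c t)), lcont (fun t => g (vpt b t)),
      lcont (fun t => g (hpt d t)) & lcont (fun t => g (vpt a t))].
Proof.
move=> eg; split; apply: ccont_line => t; apply: eg;
  rewrite -1?[_ + _]/(hpt _ _) -1?[_ + _]/(vpt _ _) ?hptE ?vptE.
- exact: Or41.
- exact: Or44.
- exact: Or42.
- exact: Or43.
Qed.

Lemma JD g v a b c d : a <= b -> c <= d -> econt a b c d g -> econt a b c d v ->
  J (fun z => g z + v z) a b c d = J g a b c d + J v a b c d.
Proof.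
move=> ab cd /econt_lcont[? ? ? ?] /econt_lcont[? ? ? ?].
by rewrite /J !CIntD //; ring.
Qed.

Lemma JZ k g a b c d : a <= b -> c <= d -> econt a b c d g ->
  J (fun z => k * g z) a b c d = k * J g a b c d.
Proof.
by move=> ab cd /econt_lcont[? ? ? ?]; rewrite /J !CIntZ //; ring.
Qed.

Lemma eq_J g v a b c d : (forall z, on_lines a b c d z -> g z = v z) -> J g a b c d = J v a b c d.
Proof.
move=> E; rewrite /J; congr (_ + _ * _ - _ - _ * _); apply: eq_CInt => t; apply: E;
  rewrite ?hptE ?vptE.
- exact: Or41.
- exact: Or44.
- exact: Or42.
- exact: Or43.
Qed.

Lemma ccontD g v z : ccont g z -> ccont v z -> ccont (fun w => g w + v w) z.
Proof. by move=> h1 h2; apply: near0_eq_vanish (vanishD h1 h2) => h; ring. Qed.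

Lemma ccontM g v z : ccont g z -> ccont v z -> ccont (fun w => g w * v w) z.
Proof.
move=> h1 h2.
apply: near0_eq_vanish (vanishD (vanishM h1 (ccont_bounded h2)) (vanishM h2 (near0_cst (g z))))
  => h.
by ring.
Qed.

Lemma ccont_cst k z : ccont (fun=> k) z. Proof. exact/hol_ccont/hol_cst. Qed.

Lemma ccont_sum n (F : nat -> C -> C) z : (forall i, ccont (F i) z) ->
  ccont (fun w => \sum_(0 <= i < n) F i w) z.
Proof.
move=> cF; elim: n => [|n IH].
  by apply: near0_eq_vanish (ccont_cst 0 z) => h; rewrite !big_geq.
by apply: near0_eq_vanish (ccontD IH (cF n)) => h; rewrite !big_nat_recr //=.
Qed.

Lemma J_sum n (F : nat -> C -> C) a b c d : a <= b -> c <= d ->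
  (forall i, econt a b c d (F i)) ->
  J (fun z => \sum_(0 <= i < n) F i z) a b c d = \sum_(0 <= i < n) J (F i) a b c d.
Proof.
move=> ab cd cF; elim: n => [|n IH].
  rewrite big_geq //; under eq_J do rewrite big_geq //.
  rewrite (_ : (fun=> 0) = fun z => 0 * (fun=> 0) z); last by apply/funext => z; rewrite mul0r.
  by rewrite JZ ?mul0r // => z _; exact: ccont_cst.
rewrite big_nat_recr //= -IH -JD //; last by move=> z hz; apply: ccont_sum => i; exact: cF.
by apply: eq_J => z _; rewrite big_nat_recr.
Qed.

Lemma J_bound g a b c d M : a <= b -> c <= d -> econt a b c d g ->
  (forall z, on_edges a b c d z -> cmod (g z) <= M) ->
  cmod (J g a b c d) <= 4 * M * ((b - a) + (d - c)).
Proof.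
move=> ab cd /econt_lcont[c1 c2 c3 c4] gM.
have i1 : cmod ii = 1 by rewrite /cmod /= expr0n expr1n add0r sqrtr1.
have b1 : cmod (CInt (fun t => g (hpt c t)) a b) <= 2 * M * (b - a).
  apply: CInt_bound => // t ht; apply: gM; rewrite hptE; split; first by split=> //=;
    rewrite lexx.
  exact: Or41.
have b2 : cmod (CInt (fun t => g (vpt b t)) c d) <= 2 * M * (d - c).
  apply: CInt_bound => // t ht; apply: gM; rewrite vptE; split; first by split=> //=;
    rewrite lexx ab.
  exact: Or44.
have b3 : cmod (CInt (fun t => g (hpt d t)) a b) <= 2 * M * (b - a).
  apply: CInt_bound => // t ht; apply: gM; rewrite hptE; split; first by split=> //=;
    rewrite lexx cd.
  exact: Or42.
have b4 : cmod (CInt (fun t => g (vpt a t)) c d) <= 2 * M * (d - c).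
  apply: CInt_bound => // t ht; apply: gM; rewrite vptE; split; first by split=> //=;
    rewrite lexx ab.
  exact: Or43.
rewrite /J (le_trans (cmodB _ _)) // cmodM i1 mul1r.
have := cmodB (CInt (fun t => g (hpt c t)) a b + ii * CInt (fun t => g (vpt b t)) c d) (CInt
  (fun t => g (hpt d t)) a b).
have := cmodD (CInt (fun t => g (hpt c t)) a b) (ii * CInt (fun t => g (vpt b t)) c d).
rewrite cmodM i1 mul1r; lra.
Qed.

Lemma J_primitive (U g : C -> C) a b c d : a <= b -> c <= d -> econt a b c d g ->
  (forall z, on_edges a b c d z -> cderiv U z (g z)) -> J g a b c d = 0.
Proof.
move=> ab cd /econt_lcont[c1 c2 c3 c4] dU.
have h1 : CInt (fun t => g (hpt c t)) a b = U (hpt c b) - U (hpt c a).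
  rewrite -(@CIntE _ g U (0 +i* c) 1) //; first by apply: eq_CInt => t; rewrite mulr1.
  move=> t ht; apply: dU; rewrite -[_ + _]/(hpt _ _) hptE; split; first by split=> //=;
    rewrite lexx.
  exact: Or41.
have h2 : ii * CInt (fun t => g (vpt b t)) c d = U (vpt b d) - U (vpt b c).
  rewrite -(@CIntE _ g U b%:C ii) //; first by rewrite -CIntZ //; apply: eq_CInt => t;
    rewrite mulrC.
  move=> t ht; apply: dU; rewrite -[_ + _]/(vpt _ _) vptE; split; first by split=> //=;
    rewrite lexx ab.
  exact: Or44.
have h3 : CInt (fun t => g (hpt d t)) a b = U (hpt d b) - U (hpt d a).
  rewrite -(@CIntE _ g U (0 +i* d) 1) //; first by apply: eq_CInt => t; rewrite mulr1.
  move=> t ht; apply: dU; rewrite -[_ + _]/(hpt _ _) hptE; split; first by split=> //=;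
    rewrite lexx cd.
  exact: Or42.
have h4 : ii * CInt (fun t => g (vpt a t)) c d = U (vpt a d) - U (vpt a c).
  rewrite -(@CIntE _ g U a%:C ii) //; first by rewrite -CIntZ //; apply: eq_CInt => t;
    rewrite mulrC.
  move=> t ht; apply: dU; rewrite -[_ + _]/(vpt _ _) vptE; split; first by split=> //=;
    rewrite lexx ab.
  exact: Or43.
by rewrite /J h1 h2 h3 h4 !hptE !vptE; ring.
Qed.

Lemma J_splitx g a m b c d : (forall z, ccont g z) -> a <= m -> m <= b -> c <= d ->
  J g a b c d = J g a m c d + J g m b c d.
Proof.
move=> cg am mb cd; have eg x x' y y' : econt x x' y y' g by move=> z _; exact: cg.
have [c1 _ c2 _] := econt_lcont (eg a b c d).
by rewrite /J (CInt_split c1 am mb) (CInt_split c2 am mb); ring.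
Qed.

Lemma J_splity g a b c m d : (forall z, ccont g z) -> a <= b -> c <= m -> m <= d ->
  J g a b c d = J g a b c m + J g a b m d.
Proof.
move=> cg ab cm md; have eg x x' y y' : econt x x' y y' g by move=> z _; exact: cg.
have [_ c1 _ c2] := econt_lcont (eg a b c d).
by rewrite /J (CInt_split c1 cm md) (CInt_split c2 cm md); ring.
Qed.

Lemma exists_half_pow (s r : R) : 0 < r -> exists n, s / 2 ^+ n < r.
Proof.
move=> r0; exists (Num.truncn `|s / r|).+1.
rewrite ltr_pdivrMr ?exprn_gt0 // -ltr_pdivrMl // mulrC.
apply: (le_lt_trans (ler_norm _)); apply: (lt_trans (truncnS_gt _)).
by rewrite -natrX ltr_nat ltn_expl.
Qed.

Lemma nested (x s : nat -> R) :
  (forall n, x n <= x n.+1) -> (forall n, x n.+1 + s n.+1 <= x n + s n) -> (forall n, 0 <= s n) ->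
  exists X, forall n, x n <= X <= x n + s n.
Proof.
move=> h1 h2 s0.
have m1 n k : x n <= x (n + k)%N by elim: k => [|k IH]; rewrite ?addn0// addnS (le_trans IH).
have m2 n k : x (n + k)%N + s (n + k)%N <= x n + s n.
  by elim: k => [|k IH]; rewrite ?addn0// addnS (le_trans (h2 _)).
have ub n m : x m <= x n + s n.
  have [nm|mn] := leqP n m.
    by rewrite -(subnKC nm) (le_trans _ (m2 n (m - n)%N)) // lerDl.
  by rewrite (le_trans (m1 m (n - m)%N)) // subnKC ?(ltnW mn) // lerDl.
exists (sup (range x)) => n; apply/andP; split.
- apply: ub_le_sup; last by exists n.
  by exists (x 0%N + s 0%N) => _ [m _ <-]; exact: ub.
- by apply: ge_sup; [exists (x 0%N); exists 0%N|move=> _ [m _ <-]; exact: ub].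
Qed.

(** Pigeonhole: inner edges cancel, so the four integrals add up to [J g a b c d] and cannot all be
    below [e / 4]. *)
Lemma quarter g a b c d (e : R) : (forall z, ccont g z) -> a <= b -> c <= d ->
  e <= cmod (J g a b c d) ->
  exists x y, [/\ a <= x, x + (b - a) / 2 <= b, c <= y, y + (d - c) / 2 <= d &
    e / 4 <= cmod (J g x (x + (b - a) / 2) y (y + (d - c) / 2))].
Proof.
move=> cg ab cd He; set p := (b - a) / 2; set q := (d - c) / 2.
have bE : a + p + p = b by rewrite /p; lra.
have dE : c + q + q = d by rewrite /q; lra.
have p0 : 0 <= p by rewrite /p; lra.
have q0 : 0 <= q by rewrite /q; lra.
apply: contrapT => H.
have k1 : cmod (J g a (a + p) c (c + q)) < e / 4.
  by rewrite ltNge; apply/negP => k; apply: H; exists a, c; split => //; lra.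
have k2 : cmod (J g (a + p) (a + p + p) c (c + q)) < e / 4.
  by rewrite ltNge; apply/negP => k; apply: H; exists (a + p), c; split => //; lra.
have k3 : cmod (J g a (a + p) (c + q) (c + q + q)) < e / 4.
  by rewrite ltNge; apply/negP => k; apply: H; exists a, (c + q); split => //; lra.
have k4 : cmod (J g (a + p) (a + p + p) (c + q) (c + q + q)) < e / 4.
  by rewrite ltNge; apply/negP => k; apply: H; exists (a + p), (c + q); split => //; lra.
rewrite bE dE in k2 k3 k4.
have JE : J g a b c d = J g a (a + p) c (c + q) + J g (a + p) b c (c + q)
  + (J g a (a + p) (c + q) d + J g (a + p) b (c + q) d).
  have l1 : c <= c + q by lra.
  have l2 : c + q <= d by lra.
  have l3 : a <= a + p by lra.
  have l4 : a + p <= b by lra.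
  by rewrite (J_splity cg ab l1 l2) (J_splitx cg l3 l4 l1) (J_splitx cg l3 l4 l2).
move: He; rewrite JE => He.
have := cmodD (J g a (a + p) c (c + q) + J g (a + p) b c (c + q)) (J g a (a + p) (c + q) d + J
  g (a + p) b (c + q) d).
have := cmodD (J g a (a + p) c (c + q)) (J g (a + p) b c (c + q)).
have := cmodD (J g a (a + p) (c + q) d) (J g (a + p) b (c + q) d).
lra.
Qed.

(** Bisection: if the integral had modulus [e > 0], nested rectangles would carry at least
    [e / 4 ^ n]; around their common point [g] is affine up to [o] of the diameter, which makes
    these integrals [o(4 ^ -n)]. *)
Lemma goursat g a b c d : a <= b -> c <= d -> (forall z, ccont g z) ->
  (forall z, in_rect a b c d z -> hol g z) -> J g a b c d = 0.
Proof.
move=> ab cd cg hg; apply: contrapT => /eqP; rewrite -cmod_gt0 => J0.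
set e := cmod (J g a b c d) in J0; set sx := b - a; set sy := d - c.
have sx0 : 0 <= sx by rewrite subr_ge0.
have sy0 : 0 <= sy by rewrite subr_ge0.
pose wx n := sx / 2 ^+ n; pose wy n := sy / 2 ^+ n.
have wxS n : wx n.+1 = wx n / 2 by rewrite /wx exprS invfM mulrA mulrAC.
have wyS n : wy n.+1 = wy n / 2 by rewrite /wy exprS invfM mulrA mulrAC.
have wx0 n : 0 <= wx n by rewrite /wx divr_ge0 // exprn_ge0.
have wy0 n : 0 <= wy n by rewrite /wy divr_ge0 // exprn_ge0.
pose Q n (p : R * R) := e / 4 ^+ n <= cmod (J g p.1 (p.1 + wx n) p.2 (p.2 + wy n)).
(* The implication under the quantifier gives [choice] a total relation: pairs that violate [Q] get
   an arbitrary successor. *)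
have step (np : nat * (R * R)) : exists p' : R * R, let: (n, p) := np in Q n p ->
  [/\ Q n.+1 p', p.1 <= p'.1, p'.1 + wx n.+1 <= p.1 + wx n, p.2 <= p'.2 &
      p'.2 + wy n.+1 <= p.2 + wy n].
  case: np => n p; have [HQ|nQ] := pselect (Q n p); last by exists p.
  have [||x [y [h1 h2 h3 h4 h5]]] := quarter cg _ _ HQ; rewrite ?lerDl //.
  have E1 : p.1 + wx n - p.1 = wx n by ring.
  have E2 : p.2 + wy n - p.2 = wy n by ring.
  rewrite ?E1 ?E2 in h2 h4 h5.
  exists (x, y) => _; rewrite /Q /= wxS wyS; split => //.
  by rewrite exprS invfM mulrA mulrAC.
have [F hF] := choice step.
pose s := fix s n := if n is m.+1 then F (m, s m) else (a, c).
have hs n : Q n (s n).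
  elim: n => [|n IH]; last by have [] := hF (n, s n) IH.
  by rewrite /Q /= /wx /wy expr0 !divr1 /sx /sy [a + _]addrC subrK [c + _]addrC subrK.
have [X hX] : exists X, forall n, (s n).1 <= X <= (s n).1 + wx n.
  by apply: nested => // n; have [] := hF (n, s n) (hs n).
have [Y hY] : exists Y, forall n, (s n).2 <= Y <= (s n).2 + wy n.
  by apply: nested => // n; have [] := hF (n, s n) (hs n).
have [dd hd] : hol g (X +i* Y).
  apply: hg; split => /=.
    by have := hX 0%N; rewrite /= /wx expr0 divr1 /sx [a + _]addrC subrK.
  by have := hY 0%N; rewrite /= /wy expr0 divr1 /sy [c + _]addrC subrK.
(* The [+ 1] covers a degenerate rectangle. With the tolerance [e / (8 S^2)] the bound from
   [J_bound] at stage [n] comes out as half of [e / 4 ^ n]. *)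
pose S := sx + sy + 1; have S0 : 0 < S by rewrite /S; lra.
have e10 : 0 < e / (8 * S ^+ 2) by rewrite divr_gt0 // mulr_gt0 // exprn_gt0.
have [r r0 hr] := hd _ e10.
have [n hn] := exists_half_pow S r0.
have pn0 : 0 < 2 ^+ n :> R by rewrite exprn_gt0.
set x1 := (s n).1; set y1 := (s n).2; set z0 := X +i* Y in hd hr.
(* The affine part of [g] at the common point: it has a quadratic primitive, so subtracting it
   leaves the integral unchanged. *)
pose L (z : C) := (g z0 - dd * z0) * 1 + dd * z.
have cL z : ccont L z.
  by apply: ccontD; apply: ccontM; try exact: ccont_cst; exact/hol_ccont/hol_id.
have JL : J L x1 (x1 + wx n) y1 (y1 + wy n) = 0.
  apply: (@J_primitive (fun z => (g z0 - dd * z0) * z + dd / 2 * z ^+ 2));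
    rewrite ?lerDl // => z _.
  have := cderivD (cderivM (cderiv_cst (g z0 - dd * z0) z) (cderiv_id z))
     (cderivM (cderiv_cst (dd / 2) z) (@cderivX _ 1 z)).
  apply: cderiv_eqd; rewrite /L expr1.
  by field.
have : cmod (J g x1 (x1 + wx n) y1 (y1 + wy n)) <= 4 * (e / (8 * S ^+ 2) * (S / 2 ^+ n)) * (S /
  2 ^+ n).
  have -> : J g x1 (x1 + wx n) y1 (y1 + wy n) =
    J (fun z => g z + (-1) * L z) x1 (x1 + wx n) y1 (y1 + wy n).
    rewrite JD ?lerDl // ?JZ ?lerDl // ?JL ?mulr0 ?addr0 //; try by move=> z _.
    by move=> z _; apply: ccontM => //; exact: ccont_cst.
  apply: (le_trans (@J_bound _ _ _ _ _ (e / (8 * S ^+ 2) * (S / 2 ^+ n)) _ _ _ _));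
    rewrite ?lerDl //.
  - move=> z _; apply: ccontD => //; apply: ccontM => //; exact: ccont_cst.
  - move=> z [[/= h1 h2] _].
    have hz : cmod (z - z0) <= S / 2 ^+ n.
      rewrite (le_trans (cmod_le_ReIm _)) // ReB ImB /=.
      have {hX}/andP[X1 X2] := hX n; have {hY}/andP[Y1 Y2] := hY n.
      rewrite -/x1 -/y1 in X1 X2 Y1 Y2.
      case/andP: h1 => h1 h1'; case/andP: h2 => h2 h2'.
      have : `|Re z - X| <= wx n by rewrite ler_norml; apply/andP; split; lra.
      have : `|Im z - Y| <= wy n by rewrite ler_norml; apply/andP; split; lra.
      have : wx n + wy n <= S / 2 ^+ n.
        by rewrite /wx /wy -mulrDl ler_pM2r ?invr_gt0 // /S; lra.
      lra.
    have := hr (z - z0) (le_lt_trans hz hn).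
    rewrite [z0 + _]addrC subrK.
    have -> : g z - g z0 - dd * (z - z0) = g z + -1 * L z by rewrite /L; ring.
    move/le_trans; apply; rewrite ler_wpM2l // ltW //.
  - rewrite ler_wpM2l //.
      by rewrite mulr_ge0 // mulr_ge0 ?(ltW e10) // divr_ge0 ?ltW.
    have -> : x1 + wx n - x1 + (y1 + wy n - y1) = wx n + wy n by ring.
    by rewrite /wx /wy -mulrDl ler_pM2r ?invr_gt0 // /S; lra.
have := hs n; rewrite /Q -/x1 -/y1.
have -> : 4 * (e / (8 * S ^+ 2) * (S / 2 ^+ n)) * (S / 2 ^+ n) = e / 4 ^+ n / 2.
  have -> : (4 : R) = 2 ^+ 2 by ring.
  rewrite -exprM mulnC exprM; field.
  by rewrite (gt_eqF S0) (gt_eqF pn0).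
have : 0 < e / 4 ^+ n by rewrite divr_gt0 // exprn_gt0.
lra.
Qed.
End rectangle_integral.

(** * Cauchy's formula on a square *)

Section cauchy.
Variable R : realType.
Local Notation C := R[i].
Local Notation Re := complex.Re.
Local Notation Im := complex.Im.
Local Notation ii := (0 +i* 1 : C).
Implicit Types (z w : C) (g u v : C -> C) (a b c d : R).

Definition clim (s : nat -> C) (l : C) :=
  forall e : R, 0 < e -> exists N, forall n, (N <= n)%N -> cmod (s n - l) <= e.
Definition csums (s : nat -> C) (l : C) := clim (fun n => \sum_(0 <= m < n) s m) l.
Definition insq (r : R) z := `|Re z| <= r /\ `|Im z| <= r.

Lemma insqP r z : insq r z <-> in_rect (- r) r (- r) r z.
Proof. by rewrite /insq /in_rect !ler_norml. Qed.

(** Serves difference quotients, which are only known to be continuous at the point in question.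
    Four rectangles avoiding [p] are removed, and the integral over the small square left around [p]
    is at most proportional to its side. *)
Lemma goursat_punctured g a p : 0 < a -> `|Re p| < a -> `|Im p| < a -> (forall z, ccont g z) ->
  (forall z, insq a z -> z != p -> hol g z) -> J g (- a) a (- a) a = 0.
Proof.
move=> a0; rewrite !ltr_norml => /andP[p1 p2] /andP[p3 p4] cg hg.
apply: contrapT => /eqP; rewrite -cmod_gt0 => J0.
have [r r0 hr] := ccont_bounded (cg p).
set M := cmod (g p) + 1 in hr; have M0 : 0 < M by rewrite ltr_wpDl ?cmod_ge0.
set x := Re p in p1 p2; set y := Im p in p3 p4.
(* A square of half-side [t] contributes at most [16 M t]; [bd] makes this half of the integral
   assumed nonzero. *)
pose bd := cmod (J g (- a) a (- a) a) / (32 * M).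
have bd0 : 0 < bd by rewrite divr_gt0 // mulr_gt0.
pose t := Num.min (Num.min (r / 4) (bd)) (Num.min (Num.min (x + a) (a - x)) (Num.min (y + a) (a
  - y))).
have t0 : 0 < t by rewrite !lt_min bd0 divr_gt0 //= -!andbA; apply/and4P; split; lra.
have tle : [/\ t <= r / 4, t <= bd, t <= x + a, t <= a - x & t <= y + a /\ t <= a - y].
  have tt : t <= t by [].
  by move: tt; rewrite {2}/t !le_min => /andP[/andP[-> ->] /andP[/andP[-> ->] /andP[-> ->]]].
case: tle => tr tb t1 t2 [t3 t4].
have l1 : - a <= x - t by lra.
have l2 : x - t <= x + t by lra.
have l3 : x + t <= a by lra.
have l4 : - a <= y - t by lra.
have l5 : y - t <= y + t by lra.
have l6 : y + t <= a by lra.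
have l7 : x - t <= a by lra.
have l8 : y - t <= a by lra.
have l9 : - a <= a by lra.
have Jz x1 x2 y1 y2 : - a <= x1 -> x1 <= x2 -> x2 <= a -> - a <= y1 -> y1 <= y2 -> y2 <= a ->
    [|| x2 < x, x < x1, y2 < y | y < y1] -> J g x1 x2 y1 y2 = 0.
  move=> k1 k2 k3 k4 k5 k6 k7; apply: goursat => // z [/andP[z1 z2] /andP[z3 z4]].
  apply: hg; first by apply/insqP; split; apply/andP; split; lra.
  by apply/eqP => E; move: k7; rewrite /x /y -E => /or4P[]; lra.
have J1 : J g (- a) (x - t) (- a) a = 0.
  by apply: Jz => //; apply/or4P/Or41; lra.
have l10 : - a <= x + t by lra.
have l11 : - a <= y + t by lra.
have J2 : J g (x + t) a (- a) a = 0.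
  by apply: Jz => //; apply/or4P/Or42; lra.
have J3 : J g (x - t) (x + t) (- a) (y - t) = 0.
  by apply: Jz => //; apply/or4P/Or43; lra.
have J4 : J g (x - t) (x + t) (y + t) a = 0.
  by apply: Jz => //; apply/or4P/Or44; lra.
have JE : J g (- a) a (- a) a = J g (x - t) (x + t) (y - t) (y + t).
  rewrite (J_splitx cg l1 l7 l9) J1 add0r (J_splitx cg l2 l3 l9) J2 addr0.
  by rewrite (J_splity cg l2 l4 l8) J3 add0r (J_splity cg l2 l5 l6) J4 addr0.
have : cmod (J g (x - t) (x + t) (y - t) (y + t)) <= 4 * M * (x + t - (x - t) + (y + t - (y -
  t))).
  apply: J_bound => //.
  move=> z [[/andP[z1 z2] /andP[z3 z4]] _].
  have := hr (z - p); rewrite [p + _]addrC subrK; apply.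
  rewrite (le_lt_trans (cmod_le_ReIm _)) // ReB ImB -/x -/y.
  have : `|Re z - x| <= t by rewrite ler_norml; apply/andP; split; lra.
  have : `|Im z - y| <= t by rewrite ler_norml; apply/andP; split; lra.
  lra.
have -> : 4 * M * (x + t - (x - t) + (y + t - (y - t))) = 16 * M * t by ring.
rewrite -JE => H.
have : 16 * M * t <= 16 * M * bd by rewrite ler_wpM2l // mulr_ge0 // ltW.
have -> : 16 * M * bd = cmod (J g (- a) a (- a) a) / 2 by rewrite /bd; field; rewrite gt_eqF.
lra.
Qed.

Lemma lines_far a z : on_lines (- a) a (- a) a z -> 0 < a -> a <= cmod z.
Proof.
move=> hz a0; case: hz => E.
- by rewrite (le_trans _ (cmod_Im _)) // E normrN ler_norm.
- by rewrite (le_trans _ (cmod_Im _)) // E ler_norm.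
- by rewrite (le_trans _ (cmod_Re _)) // E normrN ler_norm.
- by rewrite (le_trans _ (cmod_Re _)) // E ler_norm.
Qed.

Definition cauchy_cst a : C := J (fun z => z^-1) (- a) a (- a) a.

Lemma lines_neq0 a z : on_lines (- a) a (- a) a z -> 0 < a -> z != 0.
Proof. by move=> hz a0; rewrite -cmod_gt0 (lt_le_trans a0) // (lines_far hz). Qed.

Lemma Im_inv z : Im z^-1 = - Im z / (Re z ^+ 2 + Im z ^+ 2).
Proof. by case: z => x y /=; rewrite mulNr. Qed.
Lemma Re_inv z : Re z^-1 = Re z / (Re z ^+ 2 + Im z ^+ 2).
Proof. by case: z. Qed.

(** The constant is [2 pi i]. Only the sign of its imaginary part is computed: each edge contributes
    the integral of [a / (t^2 + a^2)], positive by the mean value theorem. *)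
Lemma cauchy_cst_neq0 a : 0 < a -> cauchy_cst a != 0.
Proof.
move=> a0; have aa : - a <= a by lra.
have ec : econt (- a) a (- a) a (fun z => z^-1).
  move=> z hz; apply: hol_ccont; apply: holV; [exact: hol_id|exact: lines_neq0 hz a0].
have [[c1 c1'] [c2 c2'] [c3 c3'] [c4 c4']] := econt_lcont ec.
apply/eqP => K0; suff : 0 < Im (cauchy_cst a) by rewrite K0 ltxx.
have ImJ (A B D E : C) : Im (A + ii * B - D - ii * E) = Im A + Re B - Im D - Re E.
  by rewrite !ImB ImD !ImM /=; ring.
rewrite /cauchy_cst /J ImJ.
have sq (x y : R) : 0 < y -> 0 < x ^+ 2 + y ^+ 2.
  by move=> y0; rewrite ltr_wpDl ?sqr_ge0 // exprn_gt0.
rewrite /CInt /=.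
have [t1 _ ->] := Int_MVT c1' aa.
have [t2 _ ->] := Int_MVT c2 aa.
have [t3 _ ->] := Int_MVT c3' aa.
have [t4 _ ->] := Int_MVT c4 aa.
rewrite !Im_inv !Re_inv !hptE !vptE /= !opprK !sqrrN.
have p t : 0 < a / (t ^+ 2 + a ^+ 2) * (a + a) by rewrite mulr_gt0 ?divr_gt0 ?sq ?addr_gt0.
have := p t1; have := p t2; have := p t3; have := p t4.
by rewrite [t2 ^+ 2 + _]addrC [t4 ^+ 2 + _]addrC !mulNr !opprK; lra.
Qed.

Lemma cderiv_expV n z : z != 0 -> cderiv (fun w => - (w ^- n.+1) / n.+1%:R) z (z ^- n.+2).
Proof.
move=> nz; have := cderivM (cderivN (cderiv_comp (@cderivX _ n z) (cderivV (expf_neq0 n.+1 nz))))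
  (cderiv_cst (n.+1%:R^-1) z).
apply: cderiv_eqd; rewrite !exprS mulr0 addr0.
have nzn : z ^+ n != 0 by rewrite expf_neq0.
have n0 : (1 + n%:R : C) != 0 by rewrite addrC natr1 pnatr_eq0.
have n0' : (n%:R + 1 : C) != 0 by rewrite natr1 pnatr_eq0.
by rewrite ?expr0 -natr1; field; rewrite ?nz ?nzn ?n0 ?n0'.
Qed.

Lemma J_expV n a : 0 < a -> J (fun z => z ^- n.+2) (- a) a (- a) a = 0.
Proof.
move=> a0; have aa : - a <= a by lra.
apply: (@J_primitive _ (fun w => - (w ^- n.+1) / n.+1%:R)) => //.
  move=> z hz; apply: hol_ccont; apply: holV; first by apply: holX; exact: hol_id.
  by rewrite expf_neq0 // (lines_neq0 hz a0).
by move=> z [_ hz]; apply: cderiv_expV; exact: lines_neq0 hz a0.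
Qed.

Lemma geometric_kernel z w n : w != 0 -> w - z != 0 ->
  (w - z)^-1 = \sum_(0 <= m < n) z ^+ m * w ^- m.+1 + z ^+ n * (w ^- n * (w - z)^-1).
Proof.
move=> w0 wz; elim: n => [|n IH]; first by rewrite big_geq // !expr0 invr1 add0r !mul1r.
rewrite big_nat_recr //= {1}IH -addrA; congr (_ + _).
rewrite !exprS; have := expf_neq0 n w0 => wn.
by field; rewrite w0 wn wz.
Qed.

End cauchy.

(** * Taylor expansion inside a square *)

Section square_expansion.
Variable R : realType.
Local Notation C := R[i].
Local Notation Re := complex.Re.
Local Notation Im := complex.Im.
Local Notation ii := (0 +i* 1 : C).
Implicit Types (z w : C) (g u v : C -> C) (a b c d : R).

(** On the boundary [|w| >= a > |z|], so the finite geometric expansion of [1 / (w - z)] has a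
    remainder decaying like [(|z| / a)^n]. Finite sums avoid exchanging an integral with a limit. *)
Lemma kernel_expansion v a M z n : 0 < a -> (forall w, ccont v w) ->
  (forall w, on_edges (- a) a (- a) a w -> cmod (v w) <= M) -> cmod z < a ->
  cmod (J (fun w => v w * (w - z)^-1) (- a) a (- a) a -
     \sum_(0 <= m < n) z ^+ m * J (fun w => v w * w ^- m.+1) (- a) a (- a) a)
  <= (cmod z / a) ^+ n * (16 * a * M / (a - cmod z)).
Proof.
move=> a0 cv vM za; have aa : - a <= a by lra.
have wz w : on_lines (- a) a (- a) a w -> a - cmod z <= cmod (w - z).
  by move=> hw; have := lines_far hw a0; have := cmodD (w - z) z; rewrite subrK; lra.
have wz0 w : on_lines (- a) a (- a) a w -> w - z != 0.
  by move=> hw; rewrite -cmod_gt0 (lt_le_trans _ (wz w hw)) // subr_gt0.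
have ce m : econt (- a) a (- a) a (fun w => v w * w ^- m).
  move=> w hw; apply: ccontM => //; apply: hol_ccont; apply: holV.
    by apply: holX; exact: hol_id.
  by rewrite expf_neq0 // (lines_neq0 hw a0).
have cez m : econt (- a) a (- a) a (fun w => v w * (w ^- m * (w - z)^-1)).
  move=> w hw; apply: ccontM => //; apply: hol_ccont; apply: holM; apply: holV.
  - by apply: holX; exact: hol_id.
  - by rewrite expf_neq0 // (lines_neq0 hw a0).
  - by apply: holB; [exact: hol_id|exact: hol_cst].
  - exact: wz0.
have -> : J (fun w => v w * (w - z)^-1) (- a) a (- a) a =
  \sum_(0 <= m < n) z ^+ m * J (fun w => v w * w ^- m.+1) (- a) a (- a) a +
  z ^+ n * J (fun w => v w * (w ^- n * (w - z)^-1)) (- a) a (- a) a.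
  under eq_bigr do rewrite -JZ //.
  rewrite -JZ // -J_sum //; last first.
    by move=> m w hw; apply: ccontM; [exact: ccont_cst|exact: ce].
  rewrite -JD //; last 2 first.
  - by move=> w hw; apply: ccont_sum => m; apply: ccontM; [exact: ccont_cst|exact: ce].
  - by move=> w hw; apply: ccontM; [exact: ccont_cst|exact: cez].
  apply: eq_J => w hw; rewrite {1}(geometric_kernel n (lines_neq0 hw a0) (wz0 _ hw)).
  rewrite mulrDr mulrCA; congr (_ + _).
  by rewrite mulr_sumr; apply: eq_bigr => m _; rewrite mulrCA.
rewrite addrAC subrr add0r cmodM cmodX expr_div_n -[leRHS]mulrA ler_wpM2l ?exprn_ge0 ?cmod_ge0 //.
have M0 : 0 <= M.
  apply: le_trans (cmod_ge0 (v (a +i* a))) (vM _ _).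
  by split; [split; rewrite /= aa lexx|exact: Or44].
apply: (le_trans (@J_bound _ _ _ _ _ _ (a ^- n * (M / (a - cmod z))) aa aa (cez n) _));
  last first.
  by rewrite -subr_ge0 le_eqVlt; apply/orP; left; apply/eqP; ring.
move=> w hw; have [hw1 hw2] := hw; rewrite !cmodM !cmodV cmodX mulrCA.
have wa := lines_far hw2 a0; have w0 := lt_le_trans a0 wa.
have d0 : 0 < a - cmod z by rewrite subr_gt0.
apply: ler_pM; rewrite ?mulr_ge0 ?invr_ge0 ?exprn_ge0 ?cmod_ge0 //.
  by rewrite lef_pV2 ?posrE ?exprn_gt0 // lerXn2r // nnegrE ltW.
apply: ler_pM; rewrite ?invr_ge0 ?cmod_ge0 //; first exact: vM.
by rewrite lef_pV2 ?posrE // ?wz // (lt_le_trans d0 (wz _ hw2)).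
Qed.

Lemma geometric_small (q A : R) : 0 <= q -> q < 1 -> forall e, 0 < e ->
  exists N, forall n, (N <= n)%N -> q ^+ n * A <= e.
Proof.
move=> q0 q1 e e0.
have : geometric A q x @[x --> \oo] --> 0 by apply: cvg_geometric; rewrite ger0_norm.
move/cvgrPdist_le => /(_ _ e0) [N _ hN]; exists N => n /hN /=.
by rewrite sub0r normrN => h; rewrite mulrC (le_trans (ler_norm _)).
Qed.

(** Expanding the kernel for the constant function 1, all terms but [1 / w] have primitives and drop
    out, so the integral does not depend on [z]. *)
Lemma kernel_one a z : 0 < a -> cmod z < a ->
  J (fun w => (w - z)^-1) (- a) a (- a) a = cauchy_cst a.
Proof.
move=> a0 za.
have H n : cmod (J (fun w => (w - z)^-1) (- a) a (- a) a - cauchy_cst a) <=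
   (cmod z / a) ^+ n.+1 * (16 * a * 1 / (a - cmod z)).
  have := @kernel_expansion (fun=> 1) a 1 z n.+1 a0 (fun w => ccont_cst 1 w).
  rewrite big_nat_recl // expr0 mul1r big1_seq ?addr0; last first.
    move=> m _; rewrite (_ : J _ _ _ _ _ = 0) ?mulr0 //.
    rewrite -(J_expV m a0); apply: eq_J => w _; by rewrite mul1r.
  rewrite (_ : (fun w => 1 * _) = fun w => (w - z)^-1); last by apply/funext => w; rewrite mul1r.
  rewrite (_ : (fun w => 1 * _) = fun w => w^-1); last by apply/funext => w; rewrite mul1r expr1.
  by apply => // w _; rewrite cmod1.
apply/eqP; rewrite -subr_eq0 -cmod_eq0 eq_le cmod_ge0 andbT.
apply/ler_addgt0Pr => e e0; rewrite add0r.
have [|| N hN] := @geometric_small (cmod z / a) (16 * a * 1 / (a - cmod z)) _ _ e e0.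
- by rewrite divr_ge0 ?cmod_ge0 // ltW.
- by rewrite ltr_pdivrMr // mul1r.
- exact: le_trans (H N) (hN _ (leqnSn _)).
Qed.

(* Retracting onto a square makes a function that is continuous on the square
   continuous on the whole plane, as the segment integrals require. *)
Definition clampR (r x : R) := Num.max (- r) (Num.min x r).
Definition clampC (r : R) z : C := clampR r (Re z) +i* clampR r (Im z).

Lemma clampR_id r x : `|x| <= r -> clampR r x = x.
Proof. by rewrite ler_norml /clampR => /andP[h1 h2]; rewrite (min_idPl h2) (max_idPr h1). Qed.
Lemma clampR_in r x : 0 <= r -> `|clampR r x| <= r.
Proof.
move=> r0; rewrite ler_norml /clampR le_max lexx /= ge_max; apply/andP; split; first by lra.
by rewrite ge_min lexx orbT.
Qed.
Lemma clampR_lip r x y : `|clampR r x - clampR r y| <= `|x - y|.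
Proof.
rewrite /clampR ler_norml; have := ler_norm (x - y); have := ler_norm (y - x).
rewrite (distrC y x) /Num.max /Num.min.
by do 4 case: ifPn; rewrite -?leNgt => *; apply/andP; split; lra.
Qed.

Lemma clampC_id r z : insq r z -> clampC r z = z.
Proof. by move=> [h1 h2]; rewrite /clampC !clampR_id // -CRI. Qed.
Lemma clampC_in r z : 0 <= r -> insq r (clampC r z).
Proof. by move=> r0; split; exact: clampR_in. Qed.

Lemma ccont_clamp u r z : 0 <= r -> (forall w, insq r w -> ccont u w) ->
  ccont (fun w => u (clampC r w)) z.
Proof.
move=> r0 cu e e0; have [s s0 hs] := cu _ (clampC_in z r0) e e0.
exists (s / 2); first by rewrite divr_gt0.
move=> h hh; have := hs (clampC r (z + h) - clampC r z); rewrite [clampC r z + _]addrC subrK;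
  apply.
rewrite (le_lt_trans (cmod_le_ReIm _)) // ReB ImB /=.
have := clampR_lip r (Re (z + h)) (Re z); have := clampR_lip r (Im (z + h)) (Im z).
rewrite -ReB -ImB [z + h - z]addrC addKr; have := cmod_Re h; have := cmod_Im h; lra.
Qed.

Lemma lcont_bounded (g : R -> C) a b : a <= b -> lcont g ->
  exists M, forall t, a <= t <= b -> cmod (g t) <= M.
Proof.
move=> ab [c1 c2].
have H (f : R -> R) : continuous f -> exists M, forall t, a <= t <= b -> f t <= M.
  move=> cf; have [|c _ hc] := @EVT_max R f a b ab; first exact: continuous_subspaceT.
  by exists (f c) => t ht; apply: hc; rewrite in_itv.
have [M1 h1] := H (fun t => `|Re (g t)|) (fun x => continuous_comp (c1 x) (@norm_continuous _
  R^o _)).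
have [M2 h2] := H (fun t => `|Im (g t)|) (fun x => continuous_comp (c2 x) (@norm_continuous _
  R^o _)).
exists (M1 + M2) => t ht; apply: le_trans (cmod_le_ReIm _) _; apply: lerD; [exact: h1|exact: h2].
Qed.

Lemma edges_bounded g a b c d : a <= b -> c <= d -> econt a b c d g ->
  exists M, forall z, on_edges a b c d z -> cmod (g z) <= M.
Proof.
move=> ab cd /econt_lcont[c1 c2 c3 c4].
have [M1 h1] := lcont_bounded ab c1; have [M2 h2] := lcont_bounded cd c2.
have [M3 h3] := lcont_bounded ab c3; have [M4 h4] := lcont_bounded cd c4.
exists (Num.max (Num.max M1 M2) (Num.max M3 M4)) => z [[zx zy] hz].
rewrite !le_max; apply/orP; case: hz => E.
- by left; apply/orP; left; have := h1 _ zx; rewrite hptE -E -CRI.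
- by right; apply/orP; left; have := h3 _ zx; rewrite hptE -E -CRI.
- by right; apply/orP; right; have := h4 _ zy; rewrite vptE -E -CRI.
- by left; apply/orP; right; have := h2 _ zy; rewrite vptE -E -CRI.
Qed.

(* Cauchy's formula on a square, with the constant and its nonvanishing in
   place of the winding number. *)
Theorem square_power_series a : 0 < a -> exists2 k : R, 0 <= k & forall u a', a < a' ->
  (forall z, insq a' z -> hol u z) -> exists b : nat -> C,
  [/\ (exists A, forall m, cmod (b m) <= A / a ^+ m),
    (forall M, (forall z, insq a z -> cmod (u z) <= M) -> forall m, cmod (b m) <= k * M / a ^+
      m) &
    (forall z, cmod z < a -> csums (fun m => b m * z ^+ m) (u z))].
Proof.
move=> a0; set K := cauchy_cst a; have K0 : K != 0 by exact: cauchy_cst_neq0.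
have aa : - a <= a by lra.
(* This constant depends on [a] alone; [weierstrass] uses one [k] for a whole sequence of
   functions. *)
exists (16 / cmod K); first by rewrite divr_ge0 ?cmod_ge0.
move=> u a' aa' hu; pose v z := u (clampC a' z).
have a'0 : 0 <= a' by lra.
have cv z : ccont v z by apply: ccont_clamp => // w /hu /hol_ccont.
have sub z : insq a z -> insq a' z by move=> [h1 h2]; split; lra.
have vE z : insq a z -> v z = u z by move=> /sub h; rewrite /v clampC_id.
have hv z : insq a z -> hol v z.
  move=> hz; apply: hol_ext (hu _ (sub _ hz)); exists (a' - a); first by rewrite subr_gt0.
  move=> h hh; rewrite /v clampC_id //; case: hz => h1 h2.
  have := cmod_Re h; have := cmod_Im h => k1 k2; split;
    rewrite ?ReD ?ImD (le_trans (ler_normD _ _)) //; lra.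
have ce m : econt (- a) a (- a) a (fun w => v w * w ^- m).
  move=> w hw; apply: ccontM => //; apply: hol_ccont; apply: holV.
    by apply: holX; exact: hol_id.
  by rewrite expf_neq0 // (lines_neq0 hw a0).
have bnd M : (forall z, on_edges (- a) a (- a) a z -> cmod (v z) <= M) -> forall m,
    cmod (K^-1 * J (fun w => v w * w ^- m.+1) (- a) a (- a) a) <= 16 / cmod K * M / a ^+ m.
  move=> hM m; rewrite cmodM cmodV.
  have := @J_bound _ _ _ _ _ _ (M / a ^+ m.+1) aa aa (ce m.+1).
  have -> : 4 * (M / a ^+ m.+1) * (a - - a + (a - - a)) = 16 * M / a ^+ m.
    by rewrite exprS; field; rewrite (gt_eqF a0) expf_neq0 // gt_eqF.
  move=> H; have -> : 16 / cmod K * M / a ^+ m = (cmod K)^-1 * (16 * M / a ^+ m).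
    by field; rewrite expf_neq0 ?(gt_eqF a0) // cmod_eq0.
  rewrite ler_wpM2l ?invr_ge0 ?cmod_ge0 //.
  apply: H => w hw; have [_ hw2] := hw; rewrite cmodM cmodV cmodX.
  apply: ler_pM; rewrite ?invr_ge0 ?exprn_ge0 ?cmod_ge0 //; first exact: hM.
  have wa := lines_far hw2 a0.
  by rewrite lef_pV2 ?posrE ?exprn_gt0 // ?(lt_le_trans a0 wa) // lerXn2r // nnegrE ?(ltW a0)
    ?cmod_ge0.
have [M hM] : exists M, forall w, on_edges (- a) a (- a) a w -> cmod (v w) <= M.
  by apply: edges_bounded => // w _; exact: cv.
exists (fun m => K^-1 * J (fun w => v w * w ^- m.+1) (- a) a (- a) a); split.
- by exists (16 / cmod K * M); exact: bnd.
- by move=> M' hM'; apply: bnd => w [/insqP hw _]; rewrite vE //; exact: hM'.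
move=> z za.
have za1 : `|Re z| < a by exact: le_lt_trans (cmod_Re _) za.
have za2 : `|Im z| < a by exact: le_lt_trans (cmod_Im _) za.
have hz : insq a z by split; exact: ltW.
have [d dz] := hv z hz.
(* The difference quotient completed at [z] by the derivative. It is continuous everywhere and
   holomorphic off [z] in the square, so its contour integral vanishes: this is Cauchy's formula. *)
pose g w := if w == z then d else (v w - v z) / (w - z).
have hg w : w != z -> hol v w -> hol g w.
  move=> wz hw; apply: (@hol_ext _ (fun w => (v w - v z) / (w - z))).
    exists (cmod (w - z)); first by rewrite cmod_gt0 subr_eq0.
    move=> h hh; rewrite /g; case: eqP => // E; exfalso.
    by move: hh; rewrite -E opprD addrA subrr sub0r cmodN ltxx.
  apply: holM; first by apply: holB => //; exact: hol_cst.
  by apply: holV; [apply: holB; [exact: hol_id|exact: hol_cst]|rewrite subr_eq0].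
have cg w : ccont g w.
  have [->|wz] := eqVneq w z.
    move=> e e0; have [r r0 hr] := dz e e0; exists r => // h hh.
    rewrite /g eqxx; case: eqP => [_|/eqP nz]; first by rewrite subrr cmod0 ltW.
    have h0 : h != 0 by apply: contraNN nz => /eqP ->; rewrite addr0.
    have E : z + h - z = h by ring.
    have := hr h hh; rewrite E.
    have -> : (v (z + h) - v z) / h - d = (v (z + h) - v z - d * h) / h by field; rewrite h0.
    by rewrite cmodM cmodV ler_pdivrMr ?cmod_gt0.
  have E : near0 (fun h => g (w + h) - g w = (v (w + h) - v z) * ((w + h) - z)^-1 - (v w - v z)
    * (w - z)^-1).
    exists (cmod (w - z)); first by rewrite cmod_gt0 subr_eq0.
    move=> h hh; rewrite /g (negbTE wz); case: eqP => // E; exfalso.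
    by move: hh; rewrite -E opprD addrA subrr sub0r cmodN ltxx.
  have c2 : ccont (fun w => (v w - v z) * (w - z)^-1) w.
    apply: ccontM; first by apply: ccontD => //; exact: ccont_cst.
    by apply: hol_ccont; apply: holV; [apply: holB;
      [exact: hol_id|exact: hol_cst]|rewrite subr_eq0].
  by move=> e e0; apply: near0_imp (near0_and E (c2 e e0)) => h [->].
have wz w : on_lines (- a) a (- a) a w -> w != z.
  move=> hw; apply/eqP => E; have := lines_far hw a0; rewrite E; lra.
have Jg : J g (- a) a (- a) a = 0.
  by apply: (@goursat_punctured _ _ _ z) => // w hw wz'; apply: hg => //; exact: hv.
have ck (f : C -> C) : (forall w, ccont f w) -> econt (- a) a (- a) a (fun w => f w * (w - z)^-1).
  move=> cf w /wz hw; apply: ccontM => //; apply: hol_ccont; apply: holV.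
    by apply: holB; [exact: hol_id|exact: hol_cst].
  by rewrite subr_eq0.
have cauchy : J (fun w => v w * (w - z)^-1) (- a) a (- a) a = v z * K.
  apply/eqP; rewrite -subr_eq0 -Jg /K -(kernel_one a0 za) -mulNr -JZ //; last first.
    by move=> w hw; have := ck (fun=> 1) (fun w => ccont_cst 1 w) w hw;
      apply: near0_eq_vanish => h; rewrite !mul1r.
  rewrite -JD //; [|exact: ck|]; last first.
    by move=> w hw; apply: (ck (fun=> - v z)) => // w'; exact: ccont_cst.
  apply/eqP/eq_J => w hw; rewrite /g (negbTE (wz _ hw)); ring.
move=> e e0.
have eK : 0 < e * cmod K by rewrite mulr_gt0 // cmod_gt0.
have [|| N hN] := @geometric_small (cmod z / a) (16 * a * M / (a - cmod z)) _ _ _ eK.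
- by rewrite divr_ge0 ?cmod_ge0 // ltW.
- by rewrite ltr_pdivrMr // mul1r.
exists N => n /hN; have := kernel_expansion n a0 cv hM za.
rewrite cauchy => h1 h2; have {h1 h2} := le_trans h1 h2.
rewrite -ler_pdivrMr ?cmod_gt0 // -cmodV -cmodM; apply: le_trans.
rewrite cmodBC le_eqVlt; apply/orP; left; apply/eqP; congr cmod.
rewrite mulrBl mulfK // (vE _ hz) mulr_suml; congr (_ - _).
by apply: eq_bigr => m _; ring.
Qed.
End square_expansion.

(** * Power series, identity theorem, locally uniform limits *)

Section power_series.
Variable R : realType.
Local Notation C := R[i].
Local Notation Re := complex.Re.
Local Notation Im := complex.Im.
Implicit Types (z w h : C) (s b : nat -> C) (l : C) (u v : C -> C).

Lemma clim_le s l (B : R) : clim s l -> (exists N, forall n, (N <= n)%N -> cmod (s n) <= B) ->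
  cmod l <= B.
Proof.
move=> hs [N hN]; apply/ler_addgt0Pr => e /hs [N' hN'].
have := hN' _ (leq_maxr N N'); have := hN _ (leq_maxl N N').
set x := s _; have := cmodB x (x - l); rewrite subKr; lra.
Qed.

Lemma climD s s' l l' : clim s l -> clim s' l' -> clim (fun n => s n + s' n) (l + l').
Proof.
move=> h1 h2 e e0; have e20 : 0 < e / 2 by rewrite divr_gt0.
have [N1 k1] := h1 _ e20; have [N2 k2] := h2 _ e20; exists (maxn N1 N2) => n.
rewrite geq_max => /andP[/k1 a1 /k2 a2].
have -> : s n + s' n - (l + l') = (s n - l) + (s' n - l') by ring.
by apply: le_trans (cmodD _ _) _; lra.
Qed.

Lemma climZ s l k : clim s l -> clim (fun n => k * s n) (k * l).
Proof.
move=> h1 e e0; have M1 : 0 < cmod k + 1 by rewrite ltr_wpDl ?cmod_ge0.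
have [N hN] := h1 _ (divr_gt0 e0 M1); exists N => n /hN; rewrite ler_pdivlMr // => hh.
rewrite -mulrBr cmodM mulrC (le_trans _ hh) // ler_wpM2l ?cmod_ge0 // lerDl //.
Qed.

Lemma clim_eq s s' l : s =1 s' -> clim s l -> clim s' l.
Proof. by move=> /funext ->. Qed.

Lemma clim_cst (k : C) : clim (fun=> k) k.
Proof. by move=> e e0; exists 0%N => n _; rewrite subrr cmod0 ltW. Qed.

Lemma climN s l : clim s l -> clim (fun n => - s n) (- l).
Proof. by move=> h; rewrite -mulN1r; apply: clim_eq (climZ (-1) h) => n; rewrite mulN1r. Qed.

Lemma climB s s' l l' : clim s l -> clim s' l' -> clim (fun n => s n - s' n) (l - l').
Proof. by move=> h1 h2; apply: climD => //; exact: climN. Qed.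

Lemma clim_uniq s l l' : clim s l -> clim s l' -> l = l'.
Proof.
move=> h1 h2; have h := climB h1 h2; apply/eqP; rewrite -subr_eq0 -cmod_eq0 eq_le cmod_ge0 andbT.
by apply: clim_le h _; exists 0%N => n _; rewrite subrr cmod0.
Qed.

Lemma climM s s' l l' : clim s l -> clim s' l' -> clim (fun n => s n * s' n) (l * l').
Proof.
move=> h1 h2.
have h3 : clim (fun n => (s n - l) * s' n) 0.
  move=> e e0; have M1 : 0 < cmod l' + 1 by rewrite ltr_wpDl ?cmod_ge0.
  have [N1 k1] := h1 _ (divr_gt0 e0 M1); have [N2 k2] := h2 _ ltr01.
  exists (maxn N1 N2) => n; rewrite geq_max => /andP[/k1 a1 /k2 a2].
  rewrite subr0 cmodM.
  have -> : e = e / (cmod l' + 1) * (cmod l' + 1) by rewrite divfK ?gt_eqF.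
  apply: ler_pM; rewrite ?cmod_ge0 //; have := cmodD l' (s' n - l');
    rewrite [l' + _]addrC subrK; lra.
rewrite -[X in clim _ X]add0r.
by apply: clim_eq (climD h3 (climZ l h2)) => n; ring.
Qed.

Lemma clim_subseq s l (phi : nat -> nat) : (forall N, exists n0, forall n, (n0 <= n)%N -> (N <=
  phi n)%N) ->
  clim s l -> clim (fun n => s (phi n)) l.
Proof.
move=> hp hs e /hs [N hN]; have [n0 h0] := hp N; exists n0 => n /h0; exact: hN.
Qed.

Lemma clim_tail s s' l N0 : (forall n, (N0 <= n)%N -> s n = s' n) -> clim s l -> clim s' l.
Proof.
move=> E hs e /hs [N hN]; exists (maxn N0 N) => n; rewrite geq_max => /andP[/E <-]; exact: hN.
Qed.

Lemma csumsZ s l k : csums s l -> csums (fun n => k * s n) (k * l).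
Proof. by move=> h1; apply: clim_eq (climZ k h1) => n; rewrite mulr_sumr. Qed.
Lemma csumsB s s' l l' : csums s l -> csums s' l' -> csums (fun n => s n - s' n) (l - l').
Proof. by move=> h1 h2; apply: clim_eq (climB h1 h2) => n; rewrite sumrB. Qed.
Lemma csums_eq s s' l : s =1 s' -> csums s l -> csums s' l.
Proof. by move=> /funext ->. Qed.

Lemma csums_le s l (M : nat -> R) (B : R) : (forall m, cmod (s m) <= M m) ->
  (forall n, \sum_(0 <= m < n) M m <= B) -> csums s l -> cmod l <= B.
Proof.
move=> sM hB hs; apply: clim_le hs _; exists 0%N => n _.
by apply: le_trans (cmod_sum _ _ _) _; apply: le_trans (hB n); apply: ler_sum.
Qed.

Lemma real_series_cvg (x M : nat -> R) (B : R) : (forall m, `|x m| <= M m) ->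
  (forall n, \sum_(0 <= m < n) M m <= B) ->
  exists l : R, forall e : R, 0 < e -> exists N, forall n, (N <= n)%N ->
    `|\sum_(0 <= m < n) x m - l| <= e.
Proof.
move=> xM hB.
have : cvgn [normed series x].
  have -> : [normed series x] = (fun n => \sum_(0 <= m < n) `|x m|).
    by apply/funext => n; rewrite /normed_series_of seriesEnat.
  apply: nondecreasing_is_cvgn.
    by apply/nondecreasing_seqP => n; rewrite big_nat_recr //= lerDl normr_ge0.
  exists B => _ [n _ <-]; apply: le_trans (hB n); exact: ler_sum.
move=> /normed_cvg /cvg_ex [l hl]; exists l => e e0.
move/cvgrPdist_le : hl => /(_ _ e0) [N _ hN]; exists N => n /hN.
by rewrite seriesEnat distrC.
Qed.

Lemma csums_dom s (M : nat -> R) (B : R) : (forall m, cmod (s m) <= M m) ->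
  (forall n, \sum_(0 <= m < n) M m <= B) -> exists l, csums s l.
Proof.
move=> sM hB.
have [|x hx] := @real_series_cvg (fun m => Re (s m)) M B _ hB.
  by move=> m; apply: le_trans (cmod_Re _) (sM m).
have [|y hy] := @real_series_cvg (fun m => Im (s m)) M B _ hB.
  by move=> m; apply: le_trans (cmod_Im _) (sM m).
exists (x +i* y) => e e0; have e20 : 0 < e / 2 by rewrite divr_gt0.
have [N1 k1] := hx _ e20; have [N2 k2] := hy _ e20.
exists (maxn N1 N2) => n; rewrite geq_max => /andP[/k1 a1 /k2 a2].
apply: le_trans (cmod_le_ReIm _) _; rewrite ReB ImB /=.
have -> : Re (\sum_(0 <= m < n) s m) = \sum_(0 <= m < n) Re (s m).
  by elim/big_ind2 : _ => // x1 x2 y1 y2 <- <-; rewrite ReD.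
have -> : Im (\sum_(0 <= m < n) s m) = \sum_(0 <= m < n) Im (s m).
  by elim/big_ind2 : _ => // x1 x2 y1 y2 <- <-; rewrite ImD.
lra.
Qed.

Lemma geometric_tail (q : R) j n : 0 <= q -> q <= 2^-1 ->
  \sum_(0 <= m < n) (if (m < j)%N then 0 else q ^+ m) <= 2 * q ^+ j.
Proof.
move=> q0 q1; have p m : 0 <= q ^+ m by rewrite exprn_ge0.
(* The term [- 2 * q ^+ n] lets the induction close: [q <= 1 / 2] gives
   [q ^+ n <= 2 * q ^+ n - 2 * q ^+ n.+1]. *)
suff H : \sum_(0 <= m < n) (if (m < j)%N then 0 else q ^+ m) <=
    if (n <= j)%N then 0 else 2 * q ^+ j - 2 * q ^+ n.
  by apply: le_trans H _; have := p n; have := p j; case: ifP => _; lra.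
elim: n => [|n IH]; first by rewrite big_geq // leq0n.
rewrite big_nat_recr //=.
have [nj|jn] := ltnP n j.
  by rewrite addr0 (le_trans IH) // (ltnW nj).
have qn : q * q ^+ n <= 2^-1 * q ^+ n by rewrite ler_wpM2r.
move: IH; rewrite exprS /=; have := p n.
have [nj|jn'] := leqP n j; last by lra.
have -> : j = n by apply/eqP; rewrite eqn_leq nj jn.
by lra.
Qed.

(** Within half the radius the majorant is geometric with ratio at most [1/2], so the tail is at
    most twice its first term. *)
Lemma ps_tail b l h (A r : R) j : 0 < r -> (forall m, cmod (b m) <= A / r ^+ m) ->
  cmod h <= r / 2 -> csums (fun m => b m * h ^+ m) l ->
  cmod (l - \sum_(0 <= m < j) b m * h ^+ m) <= 2 * A * (cmod h / r) ^+ j.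
Proof.
move=> r0 hb hh hl; set q := cmod h / r.
have q0 : 0 <= q by rewrite divr_ge0 ?cmod_ge0 // ltW.
have q1 : q <= 2^-1 by rewrite /q ler_pdivrMr // mulrC.
have A0 : 0 <= A by have := hb 0%N; rewrite expr0 divr1; apply: le_trans; exact: cmod_ge0.
have cs : csums (fun m => if (m < j)%N then 0 else b m * h ^+ m) (l - \sum_(0 <= m < j) b m * h
  ^+ m).
  apply: (@clim_tail (fun n => \sum_(0 <= m < n) b m * h ^+ m - \sum_(0 <= m < j) b m * h ^+ m)
    _ _ j).
    move=> n jn; rewrite (@big_cat_nat _ _ _ j 0 n) //= [RHS](@big_cat_nat _ _ _ j 0 n) //=.
    have -> : \sum_(0 <= i < j) (if (i < j)%N then 0 else b i * h ^+ i) = 0.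
      by rewrite big_nat; apply: big1 => i /andP[_ ->].
    rewrite addrAC subrr !add0r.
    by rewrite !big_nat; apply: eq_bigr => i /andP[ji _]; rewrite ltnNge ji.
  by apply: climB => //; exact: clim_cst.
apply: (csums_le (M := fun m => A * (if (m < j)%N then 0 else q ^+ m))) cs.
  move=> m; case: ifP => _; rewrite ?cmod0 ?mulr0 // cmodM cmodX /q expr_div_n.
  by rewrite [leRHS]mulrCA [leLHS]mulrC ler_wpM2l ?exprn_ge0 ?cmod_ge0.
by move=> n; rewrite -mulr_sumr (mulrC 2) -mulrA ler_wpM2l // geometric_tail.
Qed.

(** Only small positive real [t] are tested, since in [exp_coef_ge] the values of the function are
    available there only. The lowest nonzero coefficient would dominate as [t] tends to 0. *)
Lemma ps_coef_zero b (r A K tau : R) n : 0 < r -> 0 < tau -> (forall m, cmod (b m) <= A / r ^+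
  m) ->
  (forall (t : R) l, 0 < t -> t < tau -> csums (fun m => b m * t%:C ^+ m) l -> cmod l <= K * t
    ^+ n) ->
  forall j, (j < n)%N -> b j = 0.
Proof.
move=> r0 tau0 hb hK j; elim/ltn_ind : j => j IH jn.
have A0 : 0 <= A by have := hb 0%N; rewrite expr0 divr1; apply: le_trans; exact: cmod_ge0.
apply/eqP; rewrite -cmod_eq0 eq_le cmod_ge0 andbT.
pose B := `|K| + 2 * A / r ^+ j.+1 + 1.
have B0 : 0 < B by rewrite ltr_wpDl // addr_ge0 // divr_ge0 ?mulr_ge0 ?exprn_ge0 // ltW.
apply/ler_addgt0Pr => e e0; rewrite add0r.
(* Small enough for the hypothesis ([tau / 2]), for the tail bound ([r / 2]), and to make the error
   [B * t] at most [e]; [t <= 1] absorbs higher powers. *)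
pose t := Num.min (Num.min (tau / 2) (r / 2)) (Num.min 1 (e / B)).
have t0 : 0 < t by rewrite !lt_min !divr_gt0 // ltr01.
have : t <= t by []; rewrite {2}/t !le_min => /andP[/andP[t1 t2] /andP[t3 t4]].
have ct : cmod t%:C = t by rewrite cmodR gtr0_norm.
have [l hl] : exists l, csums (fun m => b m * t%:C ^+ m) l.
  apply: (csums_dom (M := fun m => A * (if (m < 0)%N then 0 else (t / r) ^+ m)) (B := A * (2 *
    (t / r) ^+ 0))).
    move=> m /=; rewrite cmodM cmodX ct expr_div_n.
    by rewrite [leRHS]mulrCA [leLHS]mulrC ler_wpM2l ?exprn_ge0 ?(ltW t0).
  move=> m; rewrite -mulr_sumr ler_wpM2l //; apply: (@geometric_tail _ 0).
    by rewrite divr_ge0 ?(ltW t0) ?(ltW r0).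
  by rewrite ler_pdivrMr // mulrC.
have h1 := hK t l t0 _ hl; have h2 := @ps_tail b l t%:C A r j.+1 r0 hb _ hl.
rewrite ct in h2; have {h1}h1 := h1 ltac:(lra); have {h2}h2 := h2 t2.
move: h2; rewrite big_nat_recr //= big_nat_cond big1 ?add0r; last first.
  by move=> i /andP[/andP[_ ij] _]; rewrite IH ?mul0r // (ltn_trans ij).
move=> h2; have : cmod (b j) * t ^+ j <= K * t ^+ n + 2 * A * (t / r) ^+ j.+1.
  have := cmodB l (l - b j * t%:C ^+ j); rewrite subKr cmodM cmodX ct; lra.
have tj : 0 < t ^+ j by rewrite exprn_gt0.
have : K * t ^+ n <= `|K| * t * t ^+ j.
  rewrite -mulrA -exprS (le_trans (_ : _ <= `|K| * t ^+ n)) //.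
    by rewrite ler_wpM2r ?exprn_ge0 ?ler_norm // ltW.
  by rewrite ler_wpM2l // ler_wiXn2l // ltW.
have -> : 2 * A * (t / r) ^+ j.+1 = (2 * A / r ^+ j.+1) * t * t ^+ j.
  by rewrite expr_div_n (exprS t); ring.
move=> k1 k2; have : cmod (b j) * t ^+ j <= (B * t) * t ^+ j.
  have : 0 < t * t ^+ j by rewrite mulr_gt0.
  rewrite /B !mulrDl mul1r; lra.
rewrite ler_pM2r // => /le_trans; apply.
by move: t4; rewrite ler_pdivlMr // mulrC.
Qed.

Lemma local_identity u q (a a' r : R) : 0 < a -> a < a' -> 0 < r ->
  (forall h, insq a' h -> hol u (q + h)) -> (forall h, cmod h < r -> u (q + h) = 0) ->
  forall h, cmod h < a -> u (q + h) = 0.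
Proof.
move=> a0 aa' r0 hu hz h ha.
have [k _ H] := square_power_series a0.
have [z hz'|b [[A hA] _ hs]] := H (fun z => u (q + z)) a' aa'.
  apply: (@hol_comp _ u (fun z => q + z)); last exact: hu.
  by apply: holD; [exact: hol_cst|exact: hol_id].
have b0 m : b m = 0.
  apply: (@ps_coef_zero b a A 0 (Num.min r a) m.+1) => //; first by rewrite lt_min r0.
  move=> t l t0; rewrite lt_min => /andP[tr ta] hl.
  have ct : cmod t%:C = t by rewrite cmodR gtr0_norm.
  have -> : l = 0; last by rewrite cmod0 mul0r.
  by have := hs t%:C; rewrite ct hz ?ct // => H'; exact: clim_uniq hl (H' ta).
apply: clim_uniq (hs h ha) _; apply: clim_eq (clim_cst 0) => n.
by rewrite big1 // => i _; rewrite b0 mul0r.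
Qed.

Lemma insq_cmod r h : cmod h <= r -> insq r h.
Proof. by move=> hr; split; apply: le_trans hr; [exact: cmod_Re|exact: cmod_Im]. Qed.

(** Convexity gives one size [s] of squares valid along the whole segment from [p] to [w]. The
    segment is cut into [2 ^ n] pieces shorter than [s / 4], so [local_identity] with radius [s / 2]
    carries the vanishing from each division point to the next. *)
Theorem identity_convex (D : C -> Prop) u p r :
  (forall z w (t : R), D z -> D w -> 0 <= t <= 1 -> D (z + t%:C * (w - z))) ->
  (forall z, D z -> exists2 s : R, 0 < s & forall h, insq s h -> D (z + h)) ->
  (forall z, D z -> hol u z) -> D p -> 0 < r -> (forall h, cmod h < r -> u (p + h) = 0) ->
  forall w, D w -> u w = 0.
Proof.
move=> cvx opn hu Dp r0 hz w Dw.
have [s1 s10 h1] := opn p Dp; have [s2 s20 h2] := opn w Dw.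
pose s := Num.min s1 s2; have s0 : 0 < s by rewrite lt_min s10.
have Ds (t : R) h : 0 <= t <= 1 -> insq s h -> D (p + t%:C * (w - p) + h).
  move=> ht [k1 k2].
  have -> : p + t%:C * (w - p) + h = (p + h) + t%:C * ((w + h) - (p + h)) by ring.
  have : s <= s by []; rewrite {2}/s le_min => /andP[ss1 ss2].
  by apply: cvx => //; [apply: h1|apply: h2]; split; lra.
have [n hn] := exists_half_pow (cmod (w - p)) (divr_gt0 s0 (ltr0n R 4 : 0 < 4)).
have n0 : 0 < 2 ^+ n :> R by rewrite exprn_gt0.
have step i : (i <= 2 ^ n)%N -> exists2 r', 0 < r' & forall h, cmod h < r' ->
    u (p + (i%:R / 2 ^+ n)%:C * (w - p) + h) = 0.
  elim: i => [_|i IH hi]; first by exists r => // h; rewrite mul0r mul0r addr0; exact: hz.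
  have [r' r'0 hr'] := IH (ltnW hi).
  have ti : 0 <= (i%:R / 2 ^+ n : R) <= 1.
    by rewrite divr_ge0 ?(ltW n0) //= ler_pdivrMr // mul1r -natrX ler_nat ltnW.
  exists (s / 4); first by rewrite divr_gt0.
  move=> h hh.
  have -> : p + (i.+1%:R / 2 ^+ n)%:C * (w - p) + h =
     p + (i%:R / 2 ^+ n)%:C * (w - p) + ((2 ^- n)%:C * (w - p) + h).
    by rewrite -natr1 mulrDl mul1r rmorphD /=; ring.
  apply: (@local_identity u _ (s / 2) s r') => //; try lra.
    by move=> h' hh'; apply: hu; exact: Ds.
  apply: le_lt_trans (cmodD _ _) _; rewrite cmodM cmodR gtr0_norm ?invr_gt0 // mulrC.
  lra.
have [r' r'0 /(_ 0)] := step _ (leqnn _).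
by rewrite cmod0 natrX divff ?gt_eqF // mul1r addr0 [p + _]addrC subrK; apply.
Qed.

(** The derivative is the sum of the first Taylor coefficients: Cauchy's estimates bound the
    second-order remainder of [f n] by [M n * cmod h ^+ 2] times a factor common to all [n], and
    these bounds add up. *)
Theorem weierstrass (f : nat -> C -> C) (U : C -> C) c (M : nat -> R) (B a : R) : 0 < a ->
  (forall n h, insq a h -> hol (f n) (c + h)) ->
  (forall n h, insq a h -> cmod (f n (c + h)) <= M n) ->
  (forall n, \sum_(0 <= m < n) M m <= B) ->
  (forall h, insq a h -> csums (fun n => f n (c + h)) (U (c + h))) -> hol U c.
Proof.
move=> a0 hf fM hB hU; pose r := a / 2; have r0 : 0 < r by rewrite divr_gt0.
have ra : r < a by rewrite /r; lra.
have [k k0 H] := square_power_series r0.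
have Hn n : exists b : nat -> C, (forall m, cmod (b m) <= k * M n / r ^+ m) /\
    (forall h, cmod h < r -> csums (fun m => b m * h ^+ m) (f n (c + h))).
  have [z hz'|b [_ hA hs]] := H (fun z => f n (c + z)) a ra.
    apply: (@hol_comp _ (f n) (fun z => c + z)); last exact: hf.
    by apply: holD; [exact: hol_cst|exact: hol_id].
  exists b; split => //; apply: hA => z [h1 h2]; apply: fM; split; lra.
have [b hb] := choice Hn.
have [d hd] : exists d, csums (fun n => b n 1%N) d.
  apply: (csums_dom (M := fun n => k / r * M n) (B := k / r * B)).
    by move=> n; have [/(_ 1%N)] := hb n; rewrite expr1 mulrAC.
  by move=> n; rewrite -mulr_sumr ler_wpM2l // divr_ge0 // ltW.
have B0 : 0 <= B by have := hB 0%N; rewrite big_geq.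
have M0 n : 0 <= M n.
  apply: le_trans (cmod_ge0 (f n (c + 0))) (fM n 0 _).
  by split; rewrite normr0 ltW.
exists d => e e0.
pose D := 2 * k * B / r ^+ 2 + 1.
have D0 : 0 < D by rewrite ltr_wpDl // divr_ge0 ?mulr_ge0 ?exprn_ge0 // ltW.
exists (Num.min (r / 2) (e / D)); first by rewrite lt_min !divr_gt0.
move=> h; rewrite lt_min => /andP[h1 h2].
have i0 : insq a 0 by split; rewrite normr0 ltW.
have ih : insq a h by apply: insq_cmod; rewrite ltW //; lra.
have := csumsB (csumsB (hU h ih) (hU 0 i0)) (csumsZ h hd).
rewrite addr0 mulrC => cs.
have : cmod (U (c + h) - U c - d * h) <= (2 * k * B / r ^+ 2) * cmod h ^+ 2.
  apply: (csums_le (M := fun n => 2 * k * (cmod h / r) ^+ 2 * M n)) cs.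
    move=> n; have [bn sn] := hb n.
    have := ps_tail 2 r0 bn (ltW h1) (sn h ltac:(lra)).
    have E0 : f n c = b n 0%N.
      have := sn 0; rewrite cmod0 addr0 => /(_ r0) s0; apply: clim_uniq s0 _.
      apply: (@clim_tail (fun=> b n 0%N) _ _ 1%N); last exact: clim_cst.
      case=> // m _; rewrite big_nat_recl // expr0 mulr1 big1 ?addr0 //.
      by move=> i _; rewrite expr0n mulr0.
    rewrite big_nat_recr //= big_nat1 expr0 mulr1 expr1 -E0 opprD addrA (mulrC h) => hh.
    by apply: le_trans hh _; rewrite le_eqVlt; apply/orP; left; apply/eqP; ring.
  move=> n; rewrite -mulr_sumr.
  have -> : 2 * k * B / r ^+ 2 * cmod h ^+ 2 = 2 * k * (cmod h / r) ^+ 2 * B.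
    by field; rewrite gt_eqF.
  by rewrite ler_wpM2l // mulr_ge0 ?exprn_ge0 ?mulr_ge0 ?invr_ge0 ?cmod_ge0 ?(ltW r0).
move/le_trans; apply; rewrite expr2 mulrA ler_wpM2r ?cmod_ge0 //.
rewrite (le_trans (_ : _ <= D * cmod h)) //; first by rewrite ler_wpM2r ?cmod_ge0 // /D lerDl.
by move: h2; rewrite ltr_pdivlMr // mulrC => /ltW.
Qed.
End power_series.

(** * The complex exponential and powers of integers *)

Section complex_exponential.
Variable R : realType.
Local Notation C := R[i].
Local Notation Re := complex.Re.
Local Notation Im := complex.Im.
Implicit Types (z w h : C) (x y : R).

Lemma MVT0 (f df : R -> R) x : (forall t : R, is_derive t 1 f (df t)) ->
  exists2 c, `|c| <= `|x| & f x - f 0 = df c * x.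
Proof.
move=> d; have [x0|x0] := leP 0 x.
  have [c /andP[c1 c2] E] := MVT_closed x0 (fun t _ => d t).
  by exists c; [rewrite !ger0_norm|rewrite E subr0].
have [c /andP[c1 c2] E] := MVT_closed (ltW x0) (fun t _ => d t).
exists c; first by rewrite !ler0_norm ?lerN2 // ltW.
by apply: oppr_inj; rewrite opprB E sub0r mulrN.
Qed.

Lemma expR_le_norm c x : `|c| <= `|x| -> expR c <= expR `|x|.
Proof. by move=> h; rewrite ler_expR (le_trans (ler_norm _)). Qed.

Lemma expR_B1_le x : `|expR x - 1| <= `|x| * expR `|x|.
Proof.
have [c hc] := MVT0 x (@is_derive_expR R); rewrite expR0 => ->.
rewrite normrM mulrC ler_wpM2l // ger0_norm ?expR_ge0 //; exact: expR_le_norm.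
Qed.

Lemma expR_B1x_le x : `|expR x - 1 - x| <= x ^+ 2 * expR `|x|.
Proof.
have d (t : R) : is_derive t 1 (expR - id) (expR t - 1 : R) by apply: is_deriveB.
have [c hc] := MVT0 x d; rewrite !fctE expR0 subr0 => E.
have -> : expR x - 1 - x = expR x - x - 1 by ring.
rewrite E normrM -(real_normK (num_real x)) expr2 mulrAC ler_wpM2r //.
apply: le_trans (expR_B1_le c) _; apply: ler_pM => //; rewrite ?expR_ge0 //.
by apply: expR_le_norm; rewrite normr_id.
Qed.

Lemma sin_norm_le x : `|sin x| <= `|x|.
Proof.
have [c hc] := MVT0 x (@is_derive_sin R); rewrite sin0 subr0 => ->.
by rewrite normrM ler_piMl // cos_max.
Qed.

Lemma cos_B1_sqr x : `|cos x - 1| <= x ^+ 2.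
Proof.
have [c hc] := MVT0 x (@is_derive_cos R); rewrite cos0 => ->.
rewrite normrM normrN -(real_normK (num_real x)) expr2 ler_wpM2r //.
exact: le_trans (sin_norm_le c) hc.
Qed.

Lemma cos_B1_norm x : `|cos x - 1| <= `|x|.
Proof.
have [c hc] := MVT0 x (@is_derive_cos R); rewrite cos0 => ->.
by rewrite normrM normrN ler_piMl // sin_max.
Qed.

Lemma sin_Bx_sqr x : `|sin x - x| <= x ^+ 2.
Proof.
have d (t : R) : is_derive t 1 (sin - id) (cos t - 1 : R) by apply: is_deriveB.
have [c hc] := MVT0 x d; rewrite !fctE sin0 subr0 subr0 => ->.
rewrite normrM -(real_normK (num_real x)) expr2 ler_wpM2r //.
exact: le_trans (cos_B1_norm c) hc.
Qed.

Definition cexp z : C := (expR (Re z))%:C * (cos (Im z) +i* sin (Im z)).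

Lemma Re_cexp z : Re (cexp z) = expR (Re z) * cos (Im z).
Proof. by rewrite /cexp ReM /= mul0r subr0. Qed.
Lemma Im_cexp z : Im (cexp z) = expR (Re z) * sin (Im z).
Proof. by rewrite /cexp ImM /= mul0r addr0. Qed.

Lemma cexpD z w : cexp (z + w) = cexp z * cexp w.
Proof.
apply: eqC.
- by rewrite (ReM (cexp z)) !Re_cexp !Im_cexp ReD ImD expRD cosD; ring.
- by rewrite (ImM (cexp z)) !Re_cexp !Im_cexp ReD ImD expRD sinD; ring.
Qed.

Lemma cexp0 : cexp 0 = 1.
Proof. by apply: eqC; rewrite ?Re_cexp ?Im_cexp /= ?cos0 ?sin0 ?expR0 ?mulr1 ?mulr0. Qed.

Lemma cexp_real x : cexp x%:C = (expR x)%:C.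
Proof. by apply: eqC; rewrite ?Re_cexp ?Im_cexp /= ?cos0 ?sin0 ?mulr1 ?mulr0. Qed.

Lemma cmod_cexp z : cmod (cexp z) = expR (Re z).
Proof. by rewrite /cexp cmodM cmodR ger0_norm ?expR_ge0 // /cmod /= cos2Dsin2 sqrtr1 mulr1. Qed.

Lemma cexp_neq0 z : cexp z != 0.
Proof. by rewrite -cmod_gt0 cmod_cexp expR_gt0. Qed.

Lemma cexpMn z n : cexp (n%:R * z) = cexp z ^+ n.
Proof.
elim: n => [|n IH]; first by rewrite mul0r cexp0 expr0.
by rewrite -natr1 mulrDl mul1r cexpD IH exprS mulrC.
Qed.

Lemma cexp_B1_le z : cmod (cexp z - 1) <= 3 * cmod z * expR (cmod z).
Proof.
apply: le_trans (cmod_le_ReIm _) _; rewrite ReB ImB Re_cexp Im_cexp /= subr0.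
set x := Re z; set y := Im z; set m := cmod z; set E := expR m.
have xm : `|x| <= m by exact: cmod_Re.
have ym : `|y| <= m by exact: cmod_Im.
have m0 : 0 <= m by exact: cmod_ge0.
have E0 : 0 <= E by exact: expR_ge0.
have Ex : expR x <= E by rewrite ler_expR (le_trans (ler_norm _)).
have Exn : expR `|x| <= E by rewrite ler_expR.
have h1 : `|expR x - 1| <= m * E.
  by apply: le_trans (expR_B1_le x) _; apply: ler_pM; rewrite ?expR_ge0.
have h2 : `|expR x * (cos y - 1)| <= m * E.
  rewrite normrM mulrC (ger0_norm (expR_ge0 x)); apply: ler_pM; rewrite ?expR_ge0 //.
  exact: le_trans (cos_B1_norm y) ym.
have h3 : `|expR x * sin y| <= m * E.
  rewrite normrM mulrC (ger0_norm (expR_ge0 x)); apply: ler_pM; rewrite ?expR_ge0 //.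
  exact: le_trans (sin_norm_le y) ym.
have -> : expR x * cos y - 1 = (expR x - 1) + expR x * (cos y - 1) by ring.
have := ler_normD (expR x - 1) (expR x * (cos y - 1)).
have -> : 3 * m * E = m * E + m * E + m * E by ring.
lra.
Qed.

Lemma cexp_taylor1 z : cmod (cexp z - 1 - z) <= 4 * cmod z ^+ 2 * expR (cmod z).
Proof.
apply: le_trans (cmod_le_ReIm _) _; rewrite !ReB !ImB Re_cexp Im_cexp /= subr0.
set x := Re z; set y := Im z; set m := cmod z; set E := expR m.
have xm : `|x| <= m by exact: cmod_Re.
have ym : `|y| <= m by exact: cmod_Im.
have m0 : 0 <= m by exact: cmod_ge0.
have E0 : 0 <= E by exact: expR_ge0.
have Ex : expR x <= E by rewrite ler_expR (le_trans (ler_norm _)).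
have Exn : expR `|x| <= E by rewrite ler_expR.
have x2 : x ^+ 2 <= m ^+ 2 by rewrite -(real_normK (num_real x)) lerXn2r ?nnegrE.
have y2 : y ^+ 2 <= m ^+ 2 by rewrite -(real_normK (num_real y)) lerXn2r ?nnegrE.
have h1 : `|expR x - 1 - x| <= m ^+ 2 * E.
  by apply: le_trans (expR_B1x_le x) _; apply: ler_pM; rewrite ?expR_ge0 ?sqr_ge0.
have h2 : `|expR x * (cos y - 1)| <= m ^+ 2 * E.
  rewrite normrM mulrC (ger0_norm (expR_ge0 x)); apply: ler_pM; rewrite ?expR_ge0 //.
  exact: le_trans (cos_B1_sqr y) y2.
have h3 : `|expR x * (sin y - y)| <= m ^+ 2 * E.
  rewrite normrM mulrC (ger0_norm (expR_ge0 x)); apply: ler_pM; rewrite ?expR_ge0 //.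
  exact: le_trans (sin_Bx_sqr y) y2.
have h4 : `|(expR x - 1) * y| <= m ^+ 2 * E.
  have -> : m ^+ 2 * E = (m * E) * m by ring.
  rewrite normrM; apply: ler_pM => //.
  by apply: le_trans (expR_B1_le x) _; apply: ler_pM; rewrite ?expR_ge0.
have -> : expR x * cos y - 1 - x = (expR x - 1 - x) + expR x * (cos y - 1) by ring.
have -> : expR x * sin y - y = expR x * (sin y - y) + (expR x - 1) * y by ring.
have := ler_normD (expR x - 1 - x) (expR x * (cos y - 1)).
have := ler_normD (expR x * (sin y - y)) ((expR x - 1) * y).
have -> : 4 * m ^+ 2 * E = m ^+ 2 * E + m ^+ 2 * E + m ^+ 2 * E + m ^+ 2 * E by ring.
lra.
Qed.

Lemma cderiv_cexp z : cderiv cexp z (cexp z).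
Proof.
move=> e e0; pose K := cmod (cexp z) * 4 * expR 1 + 1.
have K0 : 0 < K by rewrite ltr_wpDl // !mulr_ge0 ?cmod_ge0 ?expR_ge0.
exists (Num.min 1 (e / K)); first by rewrite lt_min ltr01 divr_gt0.
move=> h; rewrite lt_min => /andP[h1 h2].
have -> : cexp (z + h) - cexp z - cexp z * h = cexp z * (cexp h - 1 - h) by rewrite cexpD; ring.
rewrite cmodM.
have hE : expR (cmod h) <= expR 1 by rewrite ler_expR ltW.
have : cmod (cexp h - 1 - h) <= 4 * cmod h ^+ 2 * expR 1.
  apply: le_trans (cexp_taylor1 h) _; rewrite ler_wpM2l // mulr_ge0 // sqr_ge0 //.
move=> k; apply: le_trans (ler_wpM2l (cmod_ge0 _) k) _.
have -> : cmod (cexp z) * (4 * cmod h ^+ 2 * expR 1) = (cmod (cexp z) * 4 * expR 1 * cmod h) *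
  cmod h by ring.
rewrite ler_wpM2r ?cmod_ge0 // (le_trans (_ : _ <= K * cmod h)) //.
  by rewrite ler_wpM2r ?cmod_ge0 // /K lerDl.
by move: h2; rewrite ltr_pdivlMr // mulrC => /ltW.
Qed.

Lemma hol_cexp u z : hol u z -> hol (fun w => cexp (u w)) z.
Proof. by move=> hu; apply: (@hol_comp _ cexp) => //; eexists; exact: cderiv_cexp. Qed.

Lemma clim_cexp (s : nat -> C) l : clim s l -> clim (fun n => cexp (s n)) (cexp l).
Proof.
move=> hs e e0; have [r r0 hr] := hol_ccont (ex_intro _ _ (cderiv_cexp l)) e0.
have [N hN] := hs _ (divr_gt0 r0 (ltr0n R 2 : 0 < 2)); exists N => n /hN h.
by have := hr (s n - l); rewrite [l + _]addrC subrK; apply; lra.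
Qed.

(** The power [n^-z], agreeing with [npow_opp] for [n > 0]. As [ln 0 = 0], its value at [n = 0] is
    1, so coefficient sequences summed from 0 are made to vanish there. *)
Definition npow (n : nat) z : C := cexp (- z * (ln n%:R)%:C).

Lemma npow_oppE n z : (0 < n)%N -> npow_opp n z = npow n z.
Proof.
move=> n0; rewrite /npow_opp /npow /cexp ReM ImM !ReN !ImN /= !mulr0 subr0 add0r.
rewrite !mulNr cosN sinN; congr (_%:C * _).
by rewrite /powR pnatr_eq0 eqn0Ngt n0 /= mulNr.
Qed.

Lemma cmod_npow n z : (0 < n)%N -> cmod (npow n z) = n%:R `^ (- Re z).
Proof.
move=> n0; rewrite /npow cmod_cexp ReM /= mulr0 subr0 ReN.
by rewrite /powR pnatr_eq0 eqn0Ngt n0.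
Qed.

Lemma npowM m n z : (0 < m)%N -> (0 < n)%N -> npow (m * n) z = npow m z * npow n z.
Proof.
move=> m0 n0; rewrite /npow -cexpD natrM lnM ?posrE ?ltr0n //.
by rewrite rmorphD /=; congr cexp; ring.
Qed.

Lemma npow1 z : npow 1 z = 1.
Proof. by rewrite /npow ln1 mulr0 cexp0. Qed.

Lemma npow_real n x : (0 < n)%N -> npow n x%:C = (n%:R `^ (- x))%:C.
Proof.
move=> n0; rewrite /npow -rmorphN -rmorphM cexp_real /powR pnatr_eq0 eqn0Ngt n0 //.
Qed.

Lemma npow_add n z w : npow n (z + w) = npow n z * npow n w.
Proof. by rewrite /npow -cexpD; congr cexp; ring. Qed.

Lemma hol_npow n z : hol (npow n) z.
Proof.
apply: hol_cexp; apply: holM; last exact: hol_cst.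
by apply: holN; exact: hol_id.
Qed.

Lemma ln_ratio_le n : (0 < n)%N -> ln n.+1%:R - ln n%:R <= n%:R^-1 :> R.
Proof.
move=> n0; have p : 0 < n%:R :> R by rewrite ltr0n.
rewrite -ln_div ?posrE ?ltr0n // -natr1 mulrDl divff ?gt_eqF // mul1r.
by apply: le_ln1Dx; apply: (lt_trans (_ : -1 < 0)); rewrite ?invr_gt0 // oppr_lt0.
Qed.

Lemma ln_ratio_ge n : (0 < n)%N -> n.+1%:R^-1 <= ln n.+1%:R - ln n%:R :> R.
Proof.
move=> n0; have p : 0 < n%:R :> R by rewrite ltr0n.
have q : 0 < n.+1%:R :> R by rewrite ltr0n.
rewrite -lerN2 opprB -ln_div ?posrE //.
have -> : n%:R / n.+1%:R = 1 + - n.+1%:R^-1 :> R.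
  have q' : n%:R + 1 != 0 :> R by rewrite natr1 pnatr_eq0.
  by rewrite -natr1; field; rewrite q'.
apply: le_ln1Dx; rewrite ltrN2 invf_lt1 //.
by rewrite ltr1n ltnS.
Qed.

Lemma powRN1D x (s : R) : 0 < x -> x `^ (- (1 + s)) = x `^ (- s) / x.
Proof.
move=> x0; have -> : - (1 + s) = - s + -1 by ring.
have nz : x != 0 by rewrite gt_eqF.
by rewrite powRD ?nz ?implybT // (powR_inv1 (ltW x0)).
Qed.

(** A discrete integral test, from [1 + x <= expR x] and [1 / (n + 1) <= ln (n + 1) - ln n]; its sum
    telescopes to [zeta_tail]. *)
Lemma powR_telescope n (s : R) : (0 < n)%N -> 0 <= s ->
  s * n.+1%:R `^ (- (1 + s)) <= n%:R `^ (- s) - n.+1%:R `^ (- s).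
Proof.
move=> n0 s0; have p : 0 < n%:R :> R by rewrite ltr0n.
have q : 0 < n.+1%:R :> R by rewrite ltr0n.
have -> : n%:R `^ (- s) = n.+1%:R `^ (- s) * expR (s * (ln n.+1%:R - ln n%:R)) :> R.
  by rewrite /powR !gt_eqF // -expRD; congr expR; ring.
have -> : n.+1%:R `^ (- (1 + s)) = n.+1%:R `^ (- s) / n.+1%:R :> R.
  exact: powRN1D.
have P : 0 < n.+1%:R `^ (- s) :> R by rewrite powR_gt0.
have : 1 + s / n.+1%:R <= expR (s * (ln n.+1%:R - ln n%:R)).
  apply: le_trans (expR_ge1Dx _); rewrite lerD2l ler_wpM2l // ln_ratio_ge //.
move=> H; have := ler_wpM2l (ltW P) H; rewrite mulrDr mulr1.
have -> : s * (n.+1%:R `^ (- s) / n.+1%:R) = n.+1%:R `^ (- s) * (s / n.+1%:R) by ring.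
by rewrite lerBrDr addrC.
Qed.

Lemma zeta_tail (s : R) N n : 0 < s -> (0 < N)%N ->
  \sum_(N <= m < n) m.+1%:R `^ (- (1 + s)) <= N%:R `^ (- s) / s.
Proof.
move=> s0 N0; have P m : 0 <= m%:R `^ (- s) :> R by exact: powR_ge0.
have [nN|Nn] := leqP n N; first by rewrite big_geq // divr_ge0 // ltW.
rewrite ler_pdivlMr // mulrC mulr_sumr.
apply: le_trans (_ : \sum_(N <= m < n) (m%:R `^ (- s) - m.+1%:R `^ (- s)) <= _).
  rewrite !big_nat; apply: ler_sum => m /andP[Nm _].
  by apply: powR_telescope; rewrite ?(leq_trans N0) // ltW.
under eq_bigr do rewrite -opprB.
by rewrite sumrN telescope_sumr ?(ltnW Nn) // opprB gerBl.
Qed.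

Lemma zeta_bound (s : R) n : 0 < s -> \sum_(0 <= m < n) m.+1%:R `^ (- (1 + s)) <= 1 + s^-1.
Proof.
move=> s0; case: n => [|n]; first by rewrite big_geq // addr_ge0 // invr_ge0 ltW.
rewrite big_ltn // powR1 lerD2l; apply: le_trans (zeta_tail _ s0 _) _ => //.
by rewrite powR1 mul1r.
Qed.

(** Partial summation gains one power of [n] here, because [ln (n + 1) - ln n] is at most
    [1 / n]. *)
Lemma npow_diff n z : (0 < n)%N ->
  cmod (npow n z - npow n.+1 z) <= 3 * cmod z * expR (cmod z) * n%:R `^ (- (1 + Re z)).
Proof.
move=> n0; have p : 0 < n%:R :> R by rewrite ltr0n.
set L := ln n.+1%:R - ln n%:R : R.
have L0 : 0 <= L by apply: le_trans (ln_ratio_ge n0); rewrite invr_ge0.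
have L1 : L <= n%:R^-1 by exact: ln_ratio_le.
have -> : npow n z - npow n.+1 z = - (npow n z * (cexp (- z * L%:C) - 1)).
  rewrite mulrBr mulr1 /npow -cexpD /L rmorphB /=.
  by rewrite (_ : - z * _ + _ = - z * (ln n.+1%:R)%:C) ?opprB //; ring.
rewrite cmodN cmodM cmod_npow //.
have -> : n%:R `^ (- (1 + Re z)) = n%:R `^ (- Re z) / n%:R :> R.
  exact: powRN1D.
have -> : 3 * cmod z * expR (cmod z) * (n%:R `^ (- Re z) / n%:R) =
   n%:R `^ (- Re z) * (3 * (cmod z / n%:R) * expR (cmod z)) by ring.
rewrite ler_wpM2l ?powR_ge0 //.
have mz : cmod (- z * L%:C) <= cmod z / n%:R.
  by rewrite cmodM cmodN cmodR ger0_norm // ler_wpM2l ?cmod_ge0.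
have mz1 : cmod (- z * L%:C) <= cmod z.
  apply: le_trans mz _; rewrite ler_pdivrMr // ler_peMr ?cmod_ge0 // ler1n //.
apply: le_trans (cexp_B1_le _) _; apply: ler_pM; rewrite ?expR_ge0 ?mulr_ge0 ?cmod_ge0 //.
- by rewrite ler_wpM2l.
- by rewrite ler_expR.
Qed.
End complex_exponential.
Arguments cexp {R} z : simpl never.
Arguments npow {R} n z : simpl never.

(** * Functions given by Dirichlet series and products *)

Section dirichlet_functions.
Variable R : realType.
Local Notation C := R[i].
Local Notation Re := complex.Re.
Local Notation Im := complex.Im.
Implicit Types (z w h : C) (f : nat -> C -> C).

Definition csum (s : nat -> C) : C := xget 0 [set l | csums s l].

Lemma csumP s l : csums s l -> csum s = l.
Proof.
move=> hl; have h : csums s (csum s) by apply: (@xgetPex _ 0 [set l | csums s l]); exists l.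
exact: clim_uniq h hl.
Qed.

(** Domination is asked only where [rho <= Re z] and [cmod z <= V] together, because the terms
    produced by partial summation grow with [cmod z]. *)
Lemma half_plane_series f (sg : R) :
  (forall n z, sg < Re z -> hol (f n) z) ->
  (forall rho V : R, sg < rho -> exists (M : nat -> R) (B : R),
     (forall n z, rho <= Re z -> cmod z <= V -> cmod (f n z) <= M n) /\
     (forall n, \sum_(0 <= m < n) M m <= B)) ->
  forall z, sg < Re z ->
    csums (f ^~ z) (csum (f ^~ z)) /\ hol (fun w => csum (f ^~ w)) z.
Proof.
move=> hf hM; have cs z : sg < Re z -> csums (f ^~ z) (csum (f ^~ z)).
  move=> hz; have [M [B [h1 h2]]] := hM (Re z) (cmod z) hz.
  have [|l hl] := @csums_dom _ (f ^~ z) M B _ h2; first by move=> m; exact: h1.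
  by rewrite (csumP hl).
move=> c hc; split; first exact: cs.
pose a := (Re c - sg) / 2; have a0 : 0 < a by rewrite divr_gt0 // subr_gt0.
have [|M [B [h1 h2]]] := hM (sg + a) (cmod c + 2 * a); first by rewrite ltrDl.
have hR h : insq a h -> sg + a <= Re (c + h).
  by move=> [k _]; rewrite ReD; have := ler_norm (- Re h); rewrite normrN /a in k *; lra.
have hR' h : insq a h -> sg < Re (c + h).
  by move=> /hR; apply: lt_le_trans; rewrite ltrDl.
apply: (@weierstrass _ f _ c M B a a0) => //.
- by move=> n h hh; apply: hf; exact: hR'.
- move=> n h hh; apply: h1; first exact: hR.
  apply: le_trans (cmodD _ _) _; rewrite lerD2l (le_trans (cmod_le_ReIm _)) //.
  by case: hh => k1 k2; lra.
- by move=> h hh; apply: cs; exact: hR'.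
Qed.

Lemma powR_le_exp n (x y : R) : (0 < n)%N -> x <= y -> n%:R `^ (- y) <= n%:R `^ (- x).
Proof. by move=> n0 xy; apply: ler_powR; rewrite ?ler1n // lerN2. Qed.

Lemma powR_to0 (s e : R) : 0 < s -> 0 < e -> exists N, forall n, (N <= n)%N -> n.+1%:R `^ (- s)
  <= e.
Proof.
move=> s0 e0; exists (Num.truncn (expR (- ln e / s))).+1 => n hn.
have p : 0 < n.+1%:R :> R by rewrite ltr0n.
have : expR (- ln e / s) <= n.+1%:R.
  apply: ltW; apply: lt_le_trans (truncnS_gt _) _; rewrite ler_nat.
  by rewrite (leq_trans hn).
rewrite -[X in _ <= X]lnK ?posrE // ler_expR ler_pdivrMr // => h.
rewrite /powR gt_eqF // -[X in _ <= X](lnK (_ : e \in Num.pos)) ?posrE // ler_expR.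
by rewrite mulNr lerNl mulrC.
Qed.

Lemma npow_to0 z : 0 < Re z -> clim (fun n => npow n.+1 z) 0.
Proof.
move=> hz e e0; have [N hN] := powR_to0 hz e0; exists N => n /hN.
by rewrite subr0 cmod_npow.
Qed.

(** A term of the series obtained from [sum a n n^-z] by partial summation, [M] being the partial
    sums of [a]; the shift makes index 0 stand for [n = 1]. *)
Definition abel_term (M : nat -> R) n z : C :=
  (M n.+1)%:C * (npow n.+1 z - npow n.+2 z).

Definition abel_sum (M : nat -> R) z : C := csum (abel_term M ^~ z).

Lemma abel_sum_hol M (sg : R) : 0 <= sg ->
  (forall rho, sg < rho -> exists B, forall n,
     \sum_(0 <= m < n) `|M m.+1| * m.+1%:R `^ (- (1 + rho)) <= B) ->
  forall z, sg < Re z -> csums (abel_term M ^~ z) (abel_sum M z) /\ hol (abel_sum M) z.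
Proof.
move=> sg0 hM; apply: half_plane_series.
  move=> n z _; apply: holM; first exact: hol_cst.
  by apply: holB; exact: hol_npow.
move=> rho V hr; have [B hB] := hM rho hr.
exists (fun n => 3 * `|V| * expR `|V| * (`|M n.+1| * n.+1%:R `^ (- (1 + rho)))).
exists (3 * `|V| * expR `|V| * B); split; last first.
  by move=> n; rewrite -mulr_sumr ler_wpM2l // !mulr_ge0 ?expR_ge0.
move=> n z hz zV; rewrite cmodM cmodR [leRHS]mulrCA ler_wpM2l //.
apply: le_trans (npow_diff z (ltn0Sn n)) _.
have zV' : cmod z <= `|V| by apply: le_trans zV (ler_norm _).
apply: ler_pM; rewrite ?powR_ge0 ?mulr_ge0 ?cmod_ge0 ?expR_ge0 //.
  by apply: ler_pM; rewrite ?mulr_ge0 ?cmod_ge0 ?expR_ge0 ?ler_expR // ler_wpM2l.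
by apply: powR_le_exp => //; rewrite lerD2l.
Qed.

Lemma abel_summation (a : nat -> R) z N : let M n := \sum_(1 <= j < n.+1) a j in
  \sum_(1 <= n < N.+1) (a n)%:C * npow n z =
  (M N)%:C * npow N.+1 z + \sum_(0 <= n < N) abel_term M n z.
Proof.
move=> M; elim: N => [|N IH]; first by rewrite /M !big_geq // mul0r addr0.
rewrite big_nat_recr //= IH [in RHS]big_nat_recr //= /abel_term.
have -> : M N.+1 = M N + a N.+1 by rewrite /M big_nat_recr.
by rewrite rmorphD /=; ring.
Qed.

(** The boundary term [M N * (N + 1)^-z] tends to 0 because bounded coefficients give [M N = O(N)]
    and [Re z > 1]. *)
Lemma abel_sum_dirichlet (a : nat -> R) (K : R) z l :
  let M n := \sum_(1 <= j < n.+1) a j in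
  (forall n, `|a n.+1| <= K) -> 1 < Re z -> csums (abel_term M ^~ z) l ->
  clim (fun N => \sum_(1 <= n < N.+1) (a n)%:C * npow n z) l.
Proof.
move=> M hK hz hl; rewrite -[l]add0r.
apply: clim_eq (climD _ hl) => [N|]; first by rewrite abel_summation.
have K0 : 0 <= K by apply: le_trans (hK 0%N).
have MN N : `|M N| <= K * N%:R.
  elim: N => [|N IH]; first by rewrite /M big_geq // normr0 mulr0.
  rewrite /M big_nat_recr //= -natr1 mulrDr mulr1 (le_trans (ler_normD _ _)) //.
  by apply: lerD => //; exact: hK.
have K1 : 0 < K + 1 by lra.
move=> e e0; have [|N hN] := @powR_to0 (Re z - 1) (e / (K + 1)) _ (divr_gt0 e0 K1); first by lra.
exists N => n /hN h; rewrite subr0 cmodM cmodR cmod_npow //.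
have p : 0 < n.+1%:R :> R by rewrite ltr0n.
have E : n.+1%:R `^ (- Re z) * n.+1%:R = n.+1%:R `^ (- (Re z - 1)) :> R.
  by rewrite -[Re z in LHS](addrNK 1) [_ - 1 + 1]addrC powRN1D // divfK // gt_eqF.
rewrite ler_pdivlMr // in h; apply: le_trans h; rewrite -E -mulrA mulrC ler_wpM2l ?powR_ge0 //.
apply: le_trans (MN n) _; rewrite mulrC; apply: ler_pM => //; first by rewrite ler_nat.
by rewrite lerDl.
Qed.

(* [zeta1 z] continues (z - 1) zeta(z) to Re z > 0: the summands compare
   n^-z with the integral of x^-z over [n, n + 1], multiplied by z - 1. *)
Definition zeta_term n z : C := (z - 1) * npow n.+1 z + npow n.+2 (z - 1) - npow n.+1 (z - 1).
Definition zeta1 z : C := 1 + csum (zeta_term ^~ z).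

(** With [m = n + 1] and [m^(1 - z)] factored out, what remains is the second-order remainder of
    [cexp] plus [1 - z] times the difference of [ln (m + 1) - ln m] and [1 / m]; both are
    [O(m^-2)]. *)
Lemma zeta_term_bound n z : cmod (zeta_term n z) <=
  (4 * cmod (1 - z) ^+ 2 * expR (cmod (1 - z)) + cmod (1 - z)) * n.+1%:R `^ (- (1 + Re z)).
Proof.
set m := n.+1; have m0 : (0 < m)%N by [].
have p : 0 < m%:R :> R by rewrite ltr0n.
set L := ln m.+1%:R - ln m%:R : R.
have Lge : m.+1%:R^-1 <= L by exact: ln_ratio_ge.
have L0 : 0 <= L by apply: le_trans Lge; rewrite invr_ge0.
have L1 : L <= m%:R^-1 by exact: ln_ratio_le.
have q : 0 < m.+1%:R :> R by rewrite ltr0n.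
have L2 : `|L - m%:R^-1| <= m%:R^-1 ^+ 2.
  rewrite ler0_norm ?subr_le0 // opprB.
  apply: le_trans (_ : m%:R^-1 - m.+1%:R^-1 <= _); first by rewrite lerD2l lerN2.
  have -> : m%:R^-1 - m.+1%:R^-1 = m%:R^-1 * m.+1%:R^-1 :> R.
    have nz1 : m%:R != 0 :> R by rewrite gt_eqF.
    have nz2 : m%:R + 1 != 0 :> R by rewrite natr1 gt_eqF.
    by rewrite -[m.+1%:R]natr1; field; rewrite nz1 nz2.
  by rewrite expr2 ler_wpM2l ?invr_ge0 ?(ltW p) // lef_pV2 ?posrE // ler_nat.
set w := (1 - z) * L%:C.
have mi : npow m z = npow m (z - 1) * (m%:R^-1)%:C.
  have -> : npow m z = npow m (z - 1) * npow m 1 by rewrite -npow_add subrK.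
  congr (_ * _).
  exact: (etrans (npow_real (1 : R) m0) (congr1 (real_complex R) (powR_inv1 (ltW p)))).
have mS : npow m.+1 (z - 1) = npow m (z - 1) * cexp w.
  by rewrite /npow -cexpD /w /L rmorphB /=; congr cexp; ring.
have -> : zeta_term n z = npow m (z - 1) * ((cexp w - 1 - w) + (1 - z) * (L - m%:R^-1)%:C).
  by rewrite /zeta_term -/m mi mS [(L - _)%:C]rmorphB; move: (cexp w); rewrite /w => ?; ring.
rewrite cmodM cmod_npow // ReB.
have -> : m%:R `^ (- (Re z - Re 1)) = m%:R * m%:R `^ (- Re z) :> R.
  rewrite (_ : - (Re z - Re 1) = 1 + - Re z); last by rewrite /=; ring.
  have nz : m%:R != 0 :> R by rewrite gt_eqF.
  by rewrite powRD ?nz ?implybT // (powRr1 (ltW p)).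
have -> : m%:R `^ (- (1 + Re z)) = m%:R `^ (- Re z) / m%:R :> R by exact: powRN1D.
set V := cmod (1 - z); have V0 : 0 <= V by exact: cmod_ge0.
have wV : cmod w <= V * m%:R^-1 by rewrite /w cmodM cmodR ger0_norm // ler_wpM2l.
have wV1 : cmod w <= V.
  by apply: le_trans wV _; rewrite ler_piMr // invf_le1 // ler1n.
have b1 : cmod (cexp w - 1 - w) <= 4 * (V * m%:R^-1) ^+ 2 * expR V.
  apply: le_trans (cexp_taylor1 w) _.
  apply: ler_pM; rewrite ?expR_ge0 ?mulr_ge0 ?exprn_ge0 ?cmod_ge0 ?ler_expR //.
  by rewrite ler_wpM2l // lerXn2r // nnegrE ?cmod_ge0 // mulr_ge0 // invr_ge0 ltW.
have b2 : cmod ((1 - z) * (L - m%:R^-1)%:C) <= V * m%:R^-1 ^+ 2.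
  by rewrite cmodM cmodR ler_wpM2l.
have b3 := le_trans (cmodD _ _) (lerD b1 b2).
have P0 : 0 <= m%:R * m%:R `^ (- Re z) :> R by rewrite mulr_ge0 ?powR_ge0 // ltW.
apply: le_trans (ler_wpM2l P0 b3) _.
rewrite le_eqVlt; apply/orP; left; apply/eqP; field.
by rewrite gt_eqF.
Qed.

Lemma zeta1_hol z : 0 < Re z ->
  csums (zeta_term ^~ z) (csum (zeta_term ^~ z)) /\ hol zeta1 z.
Proof.
move=> hz; suff [h1 h2] : csums (zeta_term ^~ z) (csum (zeta_term ^~ z)) /\
    hol (fun w => csum (zeta_term ^~ w)) z.
  by split => //; apply: holD => //; exact: hol_cst.
apply: (@half_plane_series zeta_term 0) => // {z hz}.
  move=> n z _; apply: holB; last first.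
    apply: (@hol_comp _ (npow n.+1) (fun w => w - 1)); last exact: hol_npow.
    by apply: holB; [exact: hol_id|exact: hol_cst].
  apply: holD.
    by apply: holM; [apply: holB; [exact: hol_id|exact: hol_cst]|exact: hol_npow].
  apply: (@hol_comp _ (npow n.+2) (fun w => w - 1)); last exact: hol_npow.
  by apply: holB; [exact: hol_id|exact: hol_cst].
move=> rho V r0; set W := 1 + `|V|; pose K := 4 * W ^+ 2 * expR W + W.
have W0 : 0 <= W by rewrite /W addr_ge0.
exists (fun n => K * n.+1%:R `^ (- (1 + rho))), (K * (1 + rho^-1)); split; last first.
  move=> n; rewrite -mulr_sumr ler_wpM2l ?zeta_bound //.
  by rewrite /K addr_ge0 // !mulr_ge0 ?expR_ge0 // exprn_ge0.
move=> n z hz zV; apply: le_trans (zeta_term_bound n z) _.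
have hW : cmod (1 - z) <= W.
  by apply: le_trans (cmodB _ _) _; rewrite cmod1 lerD2l (le_trans zV) // ler_norm.
apply: ler_pM; rewrite ?powR_ge0 ?addr_ge0 ?mulr_ge0 ?exprn_ge0 ?cmod_ge0 ?expR_ge0 //.
  rewrite lerD //; apply: ler_pM; rewrite ?mulr_ge0 ?exprn_ge0 ?cmod_ge0 ?expR_ge0 ?ler_expR //.
  by rewrite ler_wpM2l // lerXn2r // nnegrE ?cmod_ge0.
by apply: powR_le_exp => //; rewrite lerD2l.
Qed.

Lemma zeta1_dirichlet z : 1 < Re z ->
  clim (fun N => \sum_(1 <= n < N.+1) npow n z) (zeta1 z / (z - 1)).
Proof.
move=> hz; have z1 : z - 1 != 0.
  by apply/eqP => E; move: hz; rewrite (_ : z = 1) ?ltxx //; apply/eqP; rewrite -subr_eq0 E.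
have [|hs _] := @zeta1_hol z; first by lra.
have h0 : clim (fun n => npow n.+1 (z - 1)) 0 by apply: npow_to0; rewrite ReB /=; lra.
have := climZ (z - 1)^-1 (climB (climD (clim_cst 1) hs) h0).
rewrite subr0 -/(zeta1 z) mulrC; apply: clim_eq => N.
elim: N => [|N IH].
  by rewrite !big_geq // npow1 addr0 subrr mulr0.
rewrite [RHS]big_nat_recr //= -IH [in LHS]big_nat_recr //= /zeta_term.
by field.
Qed.

(** The increments of the partial products: an infinite product becomes a telescoping series, to
    which [half_plane_series] applies without logarithms. *)
Definition prod_term f n z : C := (\prod_(0 <= i < n) f i z) * (f n z - 1).
Definition infprod f z : C := 1 + csum (prod_term f ^~ z).

Lemma prod_partial f z N : 1 + \sum_(0 <= n < N) prod_term f n z = \prod_(0 <= i < N) f i z.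
Proof.
elim: N => [|N IH]; first by rewrite !big_geq // addr0.
by rewrite !big_nat_recr //= addrA IH /prod_term; ring.
Qed.

Lemma infprod_hol f (sg : R) :
  (forall n z, sg < Re z -> hol (f n) z) ->
  (forall rho : R, sg < rho -> exists (M : nat -> R) (B : R),
     (forall n z, rho <= Re z -> cmod (f n z - 1) <= M n) /\
     (forall n, \sum_(0 <= m < n) M m <= B)) ->
  forall z, sg < Re z ->
    clim (fun N => \prod_(0 <= i < N) f i z) (infprod f z) /\ hol (infprod f) z.
Proof.
move=> hf hM z hz.
suff [h1 h2] : csums (prod_term f ^~ z) (csum (prod_term f ^~ z)) /\
    hol (fun w => csum (prod_term f ^~ w)) z.
  split; last by apply: holD => //; exact: hol_cst.
  by apply: clim_eq (climD (clim_cst 1) h1) => N; rewrite prod_partial.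
apply: (@half_plane_series (prod_term f) sg) => // {z hz}.
  move=> n z hz; apply: holM; first by apply: hol_prod => i _; exact: hf.
  by apply: holB; [exact: hf|exact: hol_cst].
move=> rho V hr; have [M [B [h1 h2]]] := hM rho hr.
exists (fun n => expR B * M n), (expR B * B); split; last first.
  by move=> n; rewrite -mulr_sumr ler_wpM2l // expR_ge0.
move=> n z hz _; rewrite cmodM; apply: ler_pM; rewrite ?cmod_ge0 //; last exact: h1.
rewrite cmod_prod; apply: le_trans (_ : \prod_(0 <= i < n) expR (M i) <= _); last first.
  by rewrite -expR_sum ler_expR.
apply: ler_prod => i _; rewrite cmod_ge0 /=.
apply: le_trans (expR_ge1Dx _); rewrite -[f i z](subrK 1) addrC.
by apply: le_trans (cmodD _ _) _; rewrite cmod1 lerD2l h1.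
Qed.

Lemma abs_dirichlet_hol (c : nat -> R) (sg : R) : c 0%N = 0 ->
  (forall n, 0 <= c n) -> (forall rho, sg < rho -> exists B, forall n,
     \sum_(0 <= m < n) c m * m%:R `^ (- rho) <= B) ->
  forall z, sg < Re z -> csums (fun n => (c n)%:C * npow n z) (csum (fun n => (c n)%:C * npow n
    z)) /\
     hol (fun z => csum (fun n => (c n)%:C * npow n z)) z.
Proof.
move=> c00 c0 hc; apply: (@half_plane_series (fun n z => (c n)%:C * npow n z)).
  by move=> n z _; apply: holM; [exact: hol_cst|exact: hol_npow].
move=> rho V hr; have [B hB] := hc rho hr.
exists (fun n => c n * n%:R `^ (- rho)), B; split => // n z hz _.
case: n => [|n]; first by rewrite c00 !mul0r cmod0.
by rewrite cmodM cmodR ger0_norm // cmod_npow // ler_wpM2l // powR_le_exp.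
Qed.
End dirichlet_functions.

(** * Euler products *)

Section euler_products.
Variable R : realType.
Local Notation C := R[i].
Local Notation Re := complex.Re.
Local Notation Im := complex.Im.
Implicit Types (z w h : C) (g : nat -> R).

(** With [w = g p p^-z] the local factor of the Dirichlet series of [g] is [1 + w], and
    [exp w / (1 + w)] is [1 + O(w^2)]; hence convergence for [Re z > 1/2]. In [euler_zeta] the local
    factor is [1 / (1 - w)]. *)
Definition euler_f g n z : C :=
  if prime n then cexp ((g n)%:C * npow n z) / (1 + (g n)%:C * npow n z) else 1.
Definition euler_zeta n z : C :=
  if prime n then (1 - npow n z) * cexp (npow n z) else 1.

(** The bound holds because [2^(-1/2) < 3/4]; it keeps [1 + w] at distance at least [1/4] from 0. *)
Lemma prime_npow_le n z : prime n -> 2^-1 < Re z -> cmod (npow n z) <= 3 / 4.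
Proof.
move=> pn hz; rewrite cmod_npow ?prime_gt0 //.
apply: le_trans (_ : n%:R `^ (- 2^-1) <= _).
  by apply: powR_le_exp; rewrite ?prime_gt0 // ltW.
rewrite powRN powR12_sqrt //.
have n2 : 2 <= n%:R :> R by rewrite (ler_nat _ 2); exact: prime_gt1.
have s : 4 / 3 <= Num.sqrt n%:R :> R.
  by rewrite -[4 / 3]ger0_norm ?divr_ge0 // -sqrtr_sqr ler_sqrt ?ler0n //; lra.
rewrite -[3 / 4]invrK lef_pV2 ?posrE ?invr_gt0 ?divr_gt0 //.
- by rewrite invf_div.
- by apply: lt_le_trans s; rewrite divr_gt0.
Qed.

Lemma euler_summable (rho : R) n (K : R) : 0 <= K -> 2^-1 < rho ->
  \sum_(0 <= m < n) K * m%:R `^ (- (rho + rho)) <= K * (1 + (rho + rho - 1)^-1).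
Proof.
move=> K0 hr; rewrite -mulr_sumr ler_wpM2l //; case: n => [|n].
  by rewrite big_geq // addr_ge0 // invr_ge0; lra.
have nz : - (rho + rho) != 0 by rewrite oppr_eq0 gt_eqF //; lra.
rewrite big_nat_recl // powR0 // add0r.
have -> : - (rho + rho) = - (1 + (rho + rho - 1)) by ring.
by apply: zeta_bound; lra.
Qed.

Lemma cmod_npow_sqr n z (rho : R) : (0 < n)%N -> rho <= Re z ->
  cmod (npow n z) ^+ 2 <= n%:R `^ (- (rho + rho)).
Proof.
move=> n0 hz; rewrite cmod_npow // opprD powRD; last first.
  by rewrite pnatr_eq0 eqn0Ngt n0 implybT.
by rewrite expr2; apply: ler_pM; rewrite ?powR_ge0 ?powR_le_exp.
Qed.

Lemma cexp_taylor1_small w : cmod w <= 1 -> cmod (cexp w - 1 - w) <= 4 * expR 1 * cmod w ^+ 2.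
Proof.
move=> hw; apply: le_trans (cexp_taylor1 w) _; rewrite mulrAC ler_wpM2r ?sqr_ge0 //.
by rewrite ler_wpM2l // ler_expR.
Qed.

Lemma euler_f_bound g n z (rho : R) : (prime n -> `|g n| <= 1) -> 2^-1 < rho -> rho <= Re z ->
  cmod (euler_f g n z - 1) <= 16 * expR 1 * n%:R `^ (- (rho + rho)).
Proof.
move=> hg hr hz; rewrite /euler_f; case: ifPn => pn; last first.
  by rewrite subrr cmod0 !mulr_ge0 ?expR_ge0 ?powR_ge0.
set w := (g n)%:C * npow n z.
have w1 : cmod w <= cmod (npow n z) by rewrite /w cmodM cmodR ler_piMl ?cmod_ge0 // hg.
have w2 : cmod w <= 3 / 4 by apply: le_trans w1 (prime_npow_le pn _); exact: lt_le_trans hz.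
have w3 : cmod w ^+ 2 <= n%:R `^ (- (rho + rho)).
  apply: le_trans (cmod_npow_sqr (prime_gt0 pn) hz).
  by rewrite lerXn2r // nnegrE cmod_ge0.
have w4 : 1 / 4 <= cmod (1 + w).
  by have := cmodB (1 + w) w; rewrite addrK cmod1; lra.
have nz : 1 + w != 0 by rewrite -cmod_gt0; lra.
have -> : cexp w / (1 + w) - 1 = (cexp w - 1 - w) / (1 + w) by field.
rewrite cmodM cmodV ler_pdivrMr; last by lra.
have e0 : 0 <= expR 1 :> R by exact: expR_ge0.
have h : cmod (cexp w - 1 - w) <= 4 * expR 1 * n%:R `^ (- (rho + rho)).
  apply: le_trans (cexp_taylor1_small _) _; first by lra.
  by rewrite ler_wpM2l // mulr_ge0.
apply: le_trans h _.
have -> : 4 * expR 1 * n%:R `^ (- (rho + rho)) = 16 * expR 1 * n%:R `^ (- (rho + rho)) * (1 /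
  4) :> R by field.
by rewrite ler_wpM2l // !mulr_ge0 ?powR_ge0.
Qed.

Lemma euler_zeta_bound n z (rho : R) : 2^-1 < rho -> rho <= Re z ->
  cmod (euler_zeta n z - 1) <= 16 * expR 1 * n%:R `^ (- (rho + rho)).
Proof.
move=> hr hz; rewrite /euler_zeta; case: ifPn => pn; last first.
  by rewrite subrr cmod0 !mulr_ge0 ?expR_ge0 ?powR_ge0.
set w := npow n z.
have w2 : cmod w <= 3 / 4 by apply: prime_npow_le pn _; exact: lt_le_trans hz.
have w3 : cmod w ^+ 2 <= n%:R `^ (- (rho + rho)) by exact: cmod_npow_sqr (prime_gt0 pn) hz.
have -> : (1 - w) * cexp w - 1 = (1 - w) * (cexp w - 1 - w) - w ^+ 2 by ring.
have e1 : 1 <= expR 1 :> R by rewrite (le_trans _ (expR_ge1Dx 1)) // lerDl.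
have h : cmod (cexp w - 1 - w) <= 4 * expR 1 * cmod w ^+ 2.
  by apply: cexp_taylor1_small; lra.
have h2 : cmod (1 - w) <= 2 by apply: le_trans (cmodB _ _) _; rewrite cmod1; lra.
apply: le_trans (cmodB _ _) _; rewrite cmodM cmodX.
apply: le_trans (_ : 16 * expR 1 * cmod w ^+ 2 <= _); last first.
  by rewrite ler_wpM2l // mulr_ge0 // expR_ge0.
have k : cmod (1 - w) * cmod (cexp w - 1 - w) <= 2 * (4 * expR 1 * cmod w ^+ 2).
  by apply: ler_pM; rewrite ?cmod_ge0.
have : cmod w ^+ 2 <= expR 1 * cmod w ^+ 2 by rewrite ler_peMl // sqr_ge0.
have : 0 <= expR 1 * cmod w ^+ 2 by rewrite mulr_ge0 ?sqr_ge0 ?expR_ge0.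
lra.
Qed.

Lemma infprod_f g : (forall n, prime n -> `|g n| <= 1) -> forall z, 2^-1 < Re z ->
  clim (fun N => \prod_(0 <= i < N) euler_f g i z) (infprod (euler_f g) z) /\
  hol (infprod (euler_f g)) z.
Proof.
move=> hg; apply: infprod_hol.
  move=> n z hz; case: (boolP (prime n)) => pn; last first.
    by apply: hol_ext (hol_cst 1 z); exists 1 => // h _; rewrite /euler_f (negbTE pn).
  apply: (@hol_ext _ (fun z => cexp ((g n)%:C * npow n z) / (1 + (g n)%:C * npow n z))).
    by exists 1 => // h _; rewrite /euler_f pn.
  have hw : hol (fun z => (g n)%:C * npow n z) z.
    by apply: holM; [exact: hol_cst|exact: hol_npow].
  apply: holM; first exact: hol_cexp.
  apply: holV; first by apply: holD => //; exact: hol_cst.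
  rewrite -cmod_gt0; have := cmodB (1 + (g n)%:C * npow n z) ((g n)%:C * npow n z).
  rewrite addrK cmod1 cmodM cmodR.
  have : `|g n| * cmod (npow n z) <= 3 / 4.
    apply: le_trans (prime_npow_le pn hz).
    by rewrite ler_piMl ?cmod_ge0 // hg.
  by rewrite -cmodR -cmodM; lra.
move=> rho hr; exists (fun n => 16 * expR 1 * n%:R `^ (- (rho + rho))).
exists (16 * expR 1 * (1 + (rho + rho - 1)^-1)); split.
  by move=> n z hz; apply: euler_f_bound => // pn; exact: hg.
by move=> n; apply: euler_summable => //; rewrite mulr_ge0 // expR_ge0.
Qed.

Lemma infprod_zeta z : 2^-1 < Re z ->
  clim (fun N => \prod_(0 <= i < N) euler_zeta i z) (infprod euler_zeta z) /\
  hol (infprod euler_zeta) z.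
Proof.
move: z; apply: infprod_hol.
  move=> n z hz; case: (boolP (prime n)) => pn; last first.
    by apply: hol_ext (hol_cst 1 z); exists 1 => // h _; rewrite /euler_zeta (negbTE pn).
  apply: (@hol_ext _ (fun z => (1 - npow n z) * cexp (npow n z))).
    by exists 1 => // h _; rewrite /euler_zeta pn.
  have hw := hol_npow n z.
  by apply: holM; [apply: holB => //; exact: hol_cst|exact: hol_cexp].
move=> rho hr; exists (fun n => 16 * expR 1 * n%:R `^ (- (rho + rho))).
exists (16 * expR 1 * (1 + (rho + rho - 1)^-1)); split.
  by move=> n z hz; exact: euler_zeta_bound.
by move=> n; apply: euler_summable => //; rewrite mulr_ge0 // expR_ge0.
Qed.

Definition rough (N n : nat) := all (fun p => N < p)%N (primes n).

Lemma rough0 n : rough 0 n.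
Proof. by apply/allP => p; rewrite mem_primes => /andP[/prime_gt0]. Qed.

Lemma roughS N n : (0 < n)%N -> rough N.+1 n = rough N n && ~~ (prime N.+1 && (N.+1 %| n)%N).
Proof.
move=> n0; apply/allP/andP => [h|[/allP h1 h2] p hp].
  split; first by apply/allP => p /h; exact: ltnW.
  by apply/negP => /andP[pN dN]; have := h N.+1; rewrite mem_primes pN n0 dN ltnn => /(_ isT).
rewrite ltn_neqAle h1 // andbT; apply/eqP => E; move: h2; rewrite E.
by move: hp; rewrite mem_primes n0 /= => ->.
Qed.

Lemma rough_mul N m : prime N.+1 -> (0 < m)%N -> rough N (N.+1 * m) = rough N m.
Proof.
move=> pN m0; apply/allP/allP => h p hp.
  by apply: h; rewrite primesM // hp orbT.
by move: hp; rewrite primesM // primes_prime // inE => /orP[/eqP ->//|]; exact: h.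
Qed.

Lemma rough_small N n : (1 < n)%N -> (n <= N)%N -> rough N n = false.
Proof.
move=> n1 nN; apply/negP => /allP /(_ (pdiv n)).
rewrite mem_primes pdiv_prime // pdiv_dvd (ltnW n1) => /(_ isT).
by rewrite ltnNge (leq_trans _ nN) // dvdn_leq ?pdiv_dvd // ltnW.
Qed.

Lemma sum_multiples p X (F : nat -> C) : (0 < p)%N ->
  \sum_(1 <= n < X.+1 | (p %| n)%N) F n = \sum_(1 <= m < (X %/ p).+1) F (p * m)%N.
Proof.
move=> p0; elim: X => [|X IH]; first by rewrite div0n !big_geq.
rewrite big_mkcond big_nat_recr //= -big_mkcond IH.
case: (boolP (p %| X.+1)%N) => d; last by rewrite addr0 divnS // (negbTE d).
by rewrite divnS // d /= add1n [RHS]big_nat_recr //= -[((X %/ p).+1)%N]/((true + X %/ p)%N) -d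
  -divnS // mulnC divnK.
Qed.

(** * Euler products by the sieve of Eratosthenes *)

Section sieve.
Variables (g : nat -> R) (z : C).
Hypothesis hz : 2 <= Re z.
Hypothesis g1 : g 1%N = 1.
Hypothesis gb : forall n, (0 < n)%N -> `|g n| <= 1.

(** Primes are removed one at a time, which replaces rearranging a multiple series over
    factorisations; [2 <= Re z] keeps everything dominated by [sum n^-2]. *)
Definition sieve_sum N X : C := \sum_(1 <= n < X.+1 | rough N n) (g n)%:C * npow n z.
Definition sieve_term N n : C := if rough N n.+1 then (g n.+1)%:C * npow n.+1 z else 0.
Definition sieve_lim N : C := csum (sieve_term N).

Lemma sieve_term_bound N n : cmod (sieve_term N n) <= n.+1%:R `^ (- (1 + 1)).
Proof.
rewrite /sieve_term; case: ifP => _; last by rewrite cmod0 powR_ge0.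
rewrite cmodM cmodR cmod_npow //; apply: le_trans (_ : n.+1%:R `^ (- Re z) <= _).
  by rewrite ler_piMl ?powR_ge0 // gb.
by apply: powR_le_exp.
Qed.

Lemma sieve_csums N : csums (sieve_term N) (sieve_lim N).
Proof.
have [|| l hl] := @csums_dom _ (sieve_term N) (fun n => n.+1%:R `^ (- (1 + 1))) (1 + 1^-1).
- exact: sieve_term_bound.
- by move=> n; apply: zeta_bound.
- by rewrite /sieve_lim (csumP hl).
Qed.

Lemma sieve_clim N : clim (sieve_sum N) (sieve_lim N).
Proof.
apply: clim_eq (@sieve_csums N) => X.
by rewrite /sieve_sum [RHS]big_mkcond /= [RHS]big_add1.
Qed.

(** Apart from 1, an integer without prime factors up to [N] exceeds [N], so what is left is bounded
    by a tail of [sum n^-2]. *)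
Lemma sieve_lim_near1 N : (0 < N)%N -> cmod (sieve_lim N - 1) <= N%:R^-1.
Proof.
move=> N0.
have h1 : csums (fun n => if n == 0%N then 1 : C else 0) 1.
  apply: (@clim_tail _ (fun=> 1) _ _ 1); last exact: clim_cst.
  by case=> // n _; rewrite big_nat_recl //= big1 ?addr0.
apply: (csums_le (M := fun m => if (m < N)%N then 0 else m.+1%:R `^ (- (1 + 1)))) (csumsB
  (@sieve_csums N) h1).
  move=> m; case: ltnP => mN; last first.
    by rewrite gtn_eqF ?(leq_trans N0) // subr0; exact: sieve_term_bound.
  case: m mN => [|m] mN.
    by rewrite eqxx /sieve_term (_ : rough N 1 = true) // g1 npow1 mulr1 subrr cmod0.
  by rewrite /sieve_term rough_small // subr0 cmod0.
move=> n; have [nN|Nn] := leqP n N.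
  by rewrite big_nat big1 ?invr_ge0 // => i /andP[_ iN]; rewrite (leq_trans iN).
rewrite (@big_cat_nat _ _ _ N) //= ?(ltnW Nn) // big_nat big1 ?add0r;
  last by move=> i /andP[_ ->].
rewrite big_nat (eq_bigr (fun m => m.+1%:R `^ (- (1 + 1)))); last first.
  by move=> i /andP[Ni _]; rewrite ltnNge Ni.
rewrite -big_nat; apply: le_trans (zeta_tail n ltr01 N0) _.
by rewrite divr1 powR_inv1.
Qed.

Lemma sieve_to1 : clim sieve_lim 1.
Proof.
move=> e e0; have [N hN] := powR_to0 ltr01 e0; exists N.+1 => -[//|n] hn.
by apply: le_trans (sieve_lim_near1 _) _ => //; rewrite -powR_inv1 // hN.
Qed.

Lemma sieve_skip N : ~~ prime N.+1 -> sieve_lim N.+1 = sieve_lim N.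
Proof.
move=> pN; rewrite /sieve_lim; congr csum; apply/funext => n.
by rewrite /sieve_term roughS // (negbTE pN) andbT.
Qed.

Lemma sieve_split N X : prime N.+1 -> sieve_sum N X = sieve_sum N.+1 X +
  \sum_(1 <= m < (X %/ N.+1).+1 | rough N m) (g (N.+1 * m))%:C * (npow N.+1 z * npow m z).
Proof.
move=> pN; rewrite /sieve_sum (bigID (fun n => N.+1 %| n)%N) /= addrC; congr (_ + _).
  rewrite big_mkcond [RHS]big_mkcond !big_nat; apply: eq_bigr => n /andP[n0 _].
  by rewrite roughS // pN.
rewrite big_mkcondl sum_multiples // [RHS]big_mkcond !big_nat; apply: eq_bigr => m /andP[m0 _].
by rewrite rough_mul // npowM.
Qed.

Lemma divn_unbounded p : (0 < p)%N -> forall N, exists n0, forall n, (n0 <= n)%N -> (N <= n %/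
  p)%N.
Proof. by move=> p0 N; exists (N * p)%N => n hn; rewrite leq_divRL. Qed.

(** Put [p = N + 1]. As [g] vanishes at multiples of [p^2], the rough multiples of [p] give
    [g p p^-z] times a sum over [m] prime to [p], cut at [X / p]: again a [sieve_sum N.+1]. For
    constant [g] all rough [m] occur, and [sieve_step_zeta] returns to level [N]. *)
Lemma sieve_step_f N : prime N.+1 ->
  (forall m, (0 < m)%N -> g (N.+1 * m)%N = if (N.+1 %| m)%N then 0 else g N.+1 * g m) ->
  sieve_lim N = (1 + (g N.+1)%:C * npow N.+1 z) * sieve_lim N.+1.
Proof.
move=> pN hg; apply: clim_uniq (@sieve_clim N) _.
have h1 := clim_subseq (divn_unbounded (ltn0Sn N)) (@sieve_clim N.+1).
rewrite mulrDl mul1r;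
  apply: clim_eq (climD (@sieve_clim N.+1) (climZ ((g N.+1)%:C * npow N.+1 z) h1)) => X.
rewrite (sieve_split X pN); congr (_ + _); rewrite /sieve_sum mulr_sumr.
rewrite big_mkcond [RHS]big_mkcond !big_nat; apply: eq_bigr => m /andP[m0 _].
rewrite roughS // pN hg //; case: (rough N m) => //=; case: (N.+1 %| m)%N => /=.
  by rewrite mul0r.
by rewrite rmorphM /=; ring.
Qed.

Lemma sieve_step_zeta N : prime N.+1 -> (forall n, g n = 1) ->
  sieve_lim N.+1 = (1 - npow N.+1 z) * sieve_lim N.
Proof.
move=> pN hg; apply/esym; apply/eqP; rewrite mulrBl mul1r subr_eq; apply/eqP.
apply: clim_uniq (@sieve_clim N) _.
have h1 := clim_subseq (divn_unbounded (ltn0Sn N)) (@sieve_clim N).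
apply: clim_eq (climD (@sieve_clim N.+1) (climZ (npow N.+1 z) h1)) => X.
rewrite (sieve_split X pN); congr (_ + _); rewrite /sieve_sum mulr_sumr.
by apply: eq_bigr => m _; rewrite !hg; ring.
Qed.

Lemma sieve_lim0 l : clim (fun N => \sum_(1 <= n < N.+1) (g n)%:C * npow n z) l -> sieve_lim 0
  = l.
Proof.
move=> hl; apply: clim_uniq (@sieve_clim 0) _; apply: clim_eq hl => X.
by apply: eq_bigl => n; rewrite rough0.
Qed.

Lemma euler_product_f N :
  (forall p m, prime p -> (0 < m)%N -> g (p * m)%N = if (p %| m)%N then 0 else g p * g m) ->
  sieve_lim 0 * \prod_(0 <= i < N.+1) euler_f g i z =
  cexp (\sum_(0 <= i < N.+1 | prime i) (g i)%:C * npow i z) * sieve_lim N.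
Proof.
move=> hg; elim: N => [|N IH].
  by rewrite big_nat1 [X in cexp X]big_mkcond [X in cexp X]big_nat1 /euler_f (_ : prime 0 =
    false) // cexp0 mulr1 mul1r.
rewrite big_nat_recr //= mulrA IH [in RHS]big_mkcond [in RHS]big_nat_recr //= -big_mkcond.
rewrite /euler_f; case: (boolP (prime N.+1)) => pN; last first.
  by rewrite mulr1 addr0 sieve_skip.
rewrite (sieve_step_f pN (fun m => hg _ m pN)) cexpD.
set w := (g N.+1)%:C * _; have nz : 1 + w != 0.
  have : cmod w <= 3 / 4.
    apply: le_trans (_ : cmod (npow N.+1 z) <= _); last first.
      by apply: prime_npow_le => //; apply: lt_le_trans hz; lra.
    by rewrite /w cmodM cmodR ler_piMl ?cmod_ge0 // gb.
  by move=> h; rewrite -cmod_gt0; have := cmodB (1 + w) w; rewrite addrK cmod1; lra.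
by field.
Qed.

Lemma euler_product_zeta N : (forall n, g n = 1) ->
  sieve_lim 0 * \prod_(0 <= i < N.+1) euler_zeta i z =
  cexp (\sum_(0 <= i < N.+1 | prime i) npow i z) * sieve_lim N.
Proof.
move=> hg; elim: N => [|N IH].
  by rewrite big_nat1 [X in cexp X]big_mkcond [X in cexp X]big_nat1 /euler_zeta (_ : prime 0 =
    false) // cexp0 mulr1 mul1r.
rewrite big_nat_recr //= mulrA IH [in RHS]big_mkcond [in RHS]big_nat_recr //= -big_mkcond.
rewrite /euler_zeta; case: (boolP (prime N.+1)) => pN; last first.
  by rewrite mulr1 addr0 sieve_skip.
by rewrite (sieve_step_zeta pN hg) cexpD; ring.
Qed.
End sieve.
End euler_products.

(** * Landau's theorem for exponentials *)

Section landau.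
Variable R : realType.
Local Notation C := R[i].
Local Notation Re := complex.Re.
Local Notation Im := complex.Im.
Implicit Types (x t : R).

Definition expS x m : R := \sum_(0 <= i < m) x ^+ i / i`!%:R.

Lemma expS_cvg x : expS x m @[m --> \oo] --> expR x.
Proof.
by have := is_cvg_series_exp_coeff x; rewrite /expR (_ : series (exp_coeff x) = expS x).
Qed.

Lemma fact_gt0R i : 0 < i`!%:R :> R.
Proof. by rewrite ltr0n fact_gt0. Qed.

Lemma expS_le x m : 0 <= x -> expS x m <= expR x.
Proof.
move=> x0; rewrite -(cvg_lim _ (@expS_cvg x)) //; apply: limr_ge; first exact: cvgP (@expS_cvg x).
exists m => // n /= mn; rewrite /expS (@big_cat_nat _ _ _ m 0 n) //= lerDl.
by apply: sumr_ge0 => i _; rewrite divr_ge0 ?exprn_ge0.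
Qed.

Lemma exp_taylor x m : 0 <= x -> expR x - expS x m <= x ^+ m * expR x.
Proof.
move=> x0; rewrite lerBlDl.
rewrite -{1}(cvg_lim _ (@expS_cvg x)) //; apply: limr_le; first exact: cvgP (@expS_cvg x).
exists m => // n /= mn; rewrite {1}/expS (@big_cat_nat _ _ _ m 0 n) //= lerD2l.
apply: le_trans (_ : x ^+ m * expS x (n - m) <= _); last by rewrite ler_wpM2l ?exprn_ge0 ?expS_le.
rewrite -{1}[m]add0n big_addn /expS mulr_sumr; apply: ler_sum => i _.
have -> : x ^+ m * (x ^+ i / i`!%:R) = x ^+ (i + m) / i`!%:R by rewrite exprD; ring.
rewrite ler_wpM2l ?exprn_ge0 // lef_pV2 ?posrE ?fact_gt0R //.
by rewrite ler_nat leq_fact // leq_addr.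
Qed.

Lemma pow_fact_le x m : 0 <= x -> x ^+ m <= m`!%:R * expR x.
Proof.
move=> x0; case: m => [|m]; first by rewrite expr0 fact0 mul1r -expR0 ler_expR.
rewrite mulrC -ler_pdivrMr ?fact_gt0R //.
by apply: le_trans (expR_ge1Dxn m x0); rewrite lerDr.
Qed.

Lemma real_limit_le (s : nat -> R) l B :
  (forall e : R, 0 < e -> exists N, forall n, (N <= n)%N -> `|s n - l| <= e) ->
  (forall n, s n <= B) -> l <= B.
Proof.
move=> h hB; apply/ler_addgt0Pr => e /h [N /(_ N (leqnn N))].
rewrite ler_norml => /andP[h1 _]; have := hB N; lra.
Qed.

Lemma real_limit_ge (s : nat -> R) l : (forall n, s n <= s n.+1) ->
  (forall e : R, 0 < e -> exists N, forall n, (N <= n)%N -> `|s n - l| <= e) ->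
  forall n, s n <= l.
Proof.
move=> hs h n; have mono k : s n <= s (n + k)%N.
  by elim: k => [|k IH]; rewrite ?addn0 // addnS (le_trans IH).
apply/ler_addgt0Pr => e /h [N hN]; have := hN (n + N)%N (leq_addl _ _).
rewrite ler_norml => /andP[_ h1]; have := mono N; lra.
Qed.

Variables (c : nat -> R) (K : R).
Hypothesis c0 : forall n, 0 <= c n.
Hypothesis cK : forall n, c n <= K.
Hypothesis c00 : c 0%N = 0.

Let L n : R := ln n%:R.
(** Coefficients for the expansion at the real point 3: if [A] is the Dirichlet series of [c], then
    [A (3 - t)] is the sum of [a n * expR (t * L n)], whose Taylor coefficients in [t] are
    nonnegative. *)
Let a n := c n * n%:R `^ (- 3).

Let a_ge0 n : 0 <= a n. Proof. by rewrite mulr_ge0 ?powR_ge0. Qed.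
Let L_ge0 n : 0 <= L n.
Proof. by case: n => [|n]; rewrite /L; [rewrite ln0|rewrite ln_ge0 // ler1n]. Qed.

Lemma a_exp n t : a n * expR (t * L n) = c n * n%:R `^ (- (3 - t)).
Proof.
case: n => [|n]; first by rewrite /a c00 !mul0r.
rewrite /a /L -mulrA; congr (_ * _).
have p : (n.+1%:R == 0 :> R) = false by rewrite pnatr_eq0.
by rewrite /powR p -expRD; congr expR; ring.
Qed.

Lemma a_exp_bound t n : 0 <= t -> t <= 2^-1 -> \sum_(0 <= m < n) a m * expR (t * L m) <= K * 3.
Proof.
move=> t0 t1; have K0 : 0 <= K by apply: le_trans (c0 0) (cK 0).
case: n => [|n]; first by rewrite big_geq // mulr_ge0.
rewrite big_nat_recl // a_exp c00 mul0r add0r.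
apply: le_trans (_ : \sum_(0 <= m < n) K * m.+1%:R `^ (- (1 + 1)) <= _).
  apply: ler_sum => m _; rewrite a_exp; apply: ler_pM; rewrite ?powR_ge0 //.
  by apply: powR_le_exp => //; lra.
rewrite -mulr_sumr ler_wpM2l //; apply: le_trans (zeta_bound _ ltr01) _.
by rewrite invr1; lra.
Qed.

(** Powers of [ln n] are absorbed by [n^(1/2)] through [x^j <= j! exp x] at [x = L m / 2]. *)
Lemma coef_cvg j : exists l : R, forall e : R, 0 < e -> exists N, forall n, (N <= n)%N ->
  `|\sum_(0 <= m < n) a m * (L m ^+ j / j`!%:R) - l| <= e.
Proof.
apply: (@real_series_cvg _ _ (fun m => 2 ^+ j * (a m * expR (2^-1 * L m))) (2 ^+ j * (K * 3))).
  move=> m; rewrite ger0_norm; last by rewrite mulr_ge0 // divr_ge0 ?exprn_ge0.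
  rewrite [leRHS]mulrCA ler_wpM2l // ler_pdivrMr ?fact_gt0R //.
  have h := @pow_fact_le (2^-1 * L m) j (mulr_ge0 _ (L_ge0 m)).
  have -> : L m ^+ j = 2 ^+ j * (2^-1 * L m) ^+ j.
    by rewrite -exprMn mulrA divff ?mul1r // pnatr_eq0.
  by rewrite -mulrA ler_wpM2l ?exprn_ge0 // [leRHS]mulrC h // invr_ge0.
by move=> n; rewrite -mulr_sumr ler_wpM2l ?exprn_ge0 // a_exp_bound //; lra.
Qed.

Definition lcoef j : R := projT1 (cid (coef_cvg j)).

Lemma lcoefP j e : 0 < e -> exists N, forall n, (N <= n)%N ->
  `|\sum_(0 <= m < n) a m * (L m ^+ j / j`!%:R) - lcoef j| <= e.
Proof. by move=> e0; rewrite /lcoef; case: cid => l /= h; exact: h. Qed.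

Lemma lcoef_ge j n : \sum_(0 <= m < n) a m * (L m ^+ j / j`!%:R) <= lcoef j.
Proof.
move: n; apply: real_limit_ge; last by move=> e; exact: lcoefP.
by move=> n; rewrite big_nat_recr //= lerDl mulr_ge0 // divr_ge0 ?exprn_ge0.
Qed.

Lemma lcoef_ge0 j : 0 <= lcoef j.
Proof. by have := lcoef_ge j 0; rewrite big_geq. Qed.

Lemma limit_sum (I : Type) (r : seq I) (s : I -> nat -> R) (l : I -> R) :
  (forall i (e : R), 0 < e -> exists N, forall n, (N <= n)%N -> `|s i n - l i| <= e) ->
  forall e : R, 0 < e -> exists N, forall n, (N <= n)%N ->
    `|\sum_(i <- r) s i n - \sum_(i <- r) l i| <= e.
Proof.
move=> h; elim: r => [|i r IH] e e0.
  by exists 0%N => n _; rewrite !big_nil subrr normr0 ltW.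
have e20 : 0 < e / 2 by rewrite divr_gt0.
have [N1 h1] := h i _ e20; have [N2 h2] := IH _ e20; exists (maxn N1 N2) => n.
rewrite geq_max => /andP[/h1 k1 /h2 k2]; rewrite !big_cons.
have -> : s i n + \sum_(j <- r) s j n - (l i + \sum_(j <- r) l j) =
  (s i n - l i) + (\sum_(j <- r) s j n - \sum_(j <- r) l j) by ring.
by apply: le_trans (ler_normD _ _) _; lra.
Qed.

(* Expansion of [A (3 - t)], where [A] is the Dirichlet series of [c]. *)
Lemma dirichlet_expansion m : exists2 B : R, 0 <= B & forall t Av, 0 <= t -> t <= 4^-1 ->
  (forall e : R, 0 < e -> exists N, forall n, (N <= n)%N ->
     `|\sum_(0 <= i < n) a i * expR (t * L i) - Av| <= e) ->
  0 <= Av - \sum_(0 <= j < m) lcoef j * t ^+ j <= B * t ^+ m.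
Proof.
have K0 : 0 <= K by apply: le_trans (c0 0) (cK 0).
exists (4 ^+ m * m`!%:R * (K * 3)); first by rewrite !mulr_ge0 ?exprn_ge0.
move=> t Av t0 t1 hA.
have hsum : forall e : R, 0 < e -> exists N, forall n, (N <= n)%N ->
   `|\sum_(0 <= j < m) t ^+ j * (\sum_(0 <= i < n) a i * (L i ^+ j / j`!%:R)) - \sum_(0 <= j <
     m) lcoef j * t ^+ j| <= e.
  apply: limit_sum => j e e0; have tj : 0 < t ^+ j + 1 by rewrite ltr_wpDl ?exprn_ge0.
  have [N hN] := @lcoefP j _ (divr_gt0 e0 tj); exists N => n /hN; rewrite ler_pdivlMr // => h.
  rewrite mulrC -mulrBl normrM (ger0_norm (exprn_ge0 _ t0)); apply: le_trans h.
  by rewrite ler_wpM2l // lerDl.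
have hdiff : forall e : R, 0 < e -> exists N, forall n, (N <= n)%N ->
   `|\sum_(0 <= i < n) a i * (expR (t * L i) - expS (t * L i) m) - (Av - \sum_(0 <= j < m)
     lcoef j * t ^+ j)| <= e.
  move=> e e0; have e20 : 0 < e / 2 by rewrite divr_gt0.
  have [N1 h1] := hA _ e20; have [N2 h2] := hsum _ e20; exists (maxn N1 N2) => n.
  rewrite geq_max => /andP[/h1 k1 /h2 k2].
  have -> : \sum_(0 <= i < n) a i * (expR (t * L i) - expS (t * L i) m) =
    \sum_(0 <= i < n) a i * expR (t * L i) -
    \sum_(0 <= j < m) t ^+ j * (\sum_(0 <= i < n) a i * (L i ^+ j / j`!%:R)).
    under eq_bigr do rewrite mulrBr; rewrite sumrB; congr (_ - _).
    under [RHS]eq_bigr do rewrite mulr_sumr.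
    rewrite exchange_big /=; apply: eq_bigr => i _; rewrite /expS mulr_sumr.
    by apply: eq_bigr => j _; rewrite exprMn; ring.
  set X := \sum_(0 <= i < n) _; set Y := \sum_(0 <= j < m) _ * _; set Z := \sum_(0 <= j < m) _.
  have -> : X - Y - (Av - Z) = (X - Av) - (Y - Z) by ring.
  apply: le_trans (ler_normB _ _) _; rewrite -/X -/Y -/Z in k1 k2; lra.
have tL i : 0 <= t * L i by rewrite mulr_ge0.
have nn i : 0 <= a i * (expR (t * L i) - expS (t * L i) m).
  by rewrite mulr_ge0 // subr_ge0 expS_le.
apply/andP; split.
  have := real_limit_ge _ hdiff 0; rewrite big_geq //; apply => n.
  by rewrite big_nat_recr //= lerDl.
apply: real_limit_le hdiff _ => n.
apply: le_trans (_ : \sum_(0 <= i < n) (4 ^+ m * m`!%:R * t ^+ m) * (a i * expR (2^-1 * L i))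
  <= _).
  apply: ler_sum => i _; rewrite [leRHS]mulrCA ler_wpM2l //.
  apply: le_trans (exp_taylor m (tL i)) _; rewrite exprMn.
  have h := @pow_fact_le (4^-1 * L i) m (mulr_ge0 _ (L_ge0 i)).
  have -> : L i ^+ m = 4 ^+ m * (4^-1 * L i) ^+ m.
    by rewrite -exprMn mulrA divff ?mul1r // pnatr_eq0.
  have e1 : expR (t * L i) <= expR (4^-1 * L i) by rewrite ler_expR ler_wpM2r.
  have -> : 2^-1 * L i = 4^-1 * L i + 4^-1 * L i by field.
  rewrite expRD -!mulrA [leLHS]mulrCA ler_wpM2l ?exprn_ge0 // [leRHS]mulrCA ler_wpM2l
    ?exprn_ge0 //.
  rewrite [leRHS]mulrA; apply: ler_pM; rewrite ?expR_ge0 ?exprn_ge0 ?mulr_ge0 ?invr_ge0 //.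
  by apply: h; rewrite invr_ge0.
have -> : 4 ^+ m * m`!%:R * (K * 3) * t ^+ m = 4 ^+ m * m`!%:R * t ^+ m * (K * 3) by ring.
by rewrite -mulr_sumr ler_wpM2l ?mulr_ge0 ?exprn_ge0 // a_exp_bound //; lra.
Qed.

Lemma coef_exp_ge0 (q : {poly R}) i j : (forall j, 0 <= q`_j) -> 0 <= (q ^+ i)`_j.
Proof.
move=> hq; elim: i j => [|i IH] j; first by rewrite expr0 coef1; case: eqP.
by rewrite exprS coefM; apply: sumr_ge0 => l _; rewrite mulr_ge0.
Qed.

Lemma dirichlet_cvg t : 0 <= t -> t <= 2^-1 -> exists Av : R,
  forall e : R, 0 < e -> exists N, forall n, (N <= n)%N ->
     `|\sum_(0 <= i < n) a i * expR (t * L i) - Av| <= e.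
Proof.
move=> t0 t1; apply: (@real_series_cvg _ _ (fun m => a m * expR (t * L m)) (K * 3)).
  by move=> m; rewrite ger0_norm // mulr_ge0 ?expR_ge0.
by move=> n; exact: a_exp_bound.
Qed.

(* The coefficients of the exponential of a power series with nonnegative
   coefficients dominate those of the series itself. *)
Lemma exp_coef_ge (b : nat -> C) (r A : R) : 0 < r ->
  (forall m, cmod (b m) <= A / r ^+ m) ->
  (forall t Av, 0 < t -> t < 4^-1 ->
     (forall e : R, 0 < e -> exists N, forall n, (N <= n)%N ->
       `|\sum_(0 <= i < n) a i * expR (t * L i) - Av| <= e) ->
     csums (fun m => b m * t%:C ^+ m) (expR Av)%:C) ->
  forall m, (0 < m)%N -> lcoef m <= cmod (b m).
Proof.
move=> r0 hb hG m m0.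
(* [Q] is the exponent cut at degree [m], without its constant term, and [p] is built from the
   truncated exponential of [Q]. For small [t] the polynomial [p] is within [O(t^(m+1))] of
   [expR Av], so [ps_coef_zero] identifies [b m] with its coefficient. *)
pose Q : {poly R} := \poly_(j < m.+1) (if j == 0%N then 0 else lcoef j).
pose p : {poly R} := expR (lcoef 0) *: \sum_(i < m.+1) (i`!%:R^-1 *: Q ^+ i).
pose D := \sum_(0 <= j < m.+1) lcoef j.
have D0 : 0 <= D by apply: sumr_ge0 => j _; exact: lcoef_ge0.
have [B B0 hB] := dirichlet_expansion m.+1.
have pE t : p.[t] = expR (lcoef 0) * expS Q.[t] m.+1.
  rewrite hornerZ horner_sum /expS big_mkord; congr (_ * _).
  by apply: eq_bigr => i _; rewrite hornerZ horner_exp mulrC.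
have QE t : lcoef 0 + Q.[t] = \sum_(0 <= j < m.+1) lcoef j * t ^+ j.
  rewrite (horner_coef_wide _ (size_poly _ _)).
  rewrite big_ord_recl big_nat_recl // expr0 mulr1 coef_poly /= mul0r add0r; congr (_ + _).
  by rewrite big_mkord; apply: eq_bigr => i _; rewrite coef_poly /= ltnS ltn_ord.
have Q0 t : 0 <= t -> 0 <= Q.[t].
  move=> t0; rewrite (horner_coef_wide _ (size_poly _ _)); apply: sumr_ge0 => j _.
  by rewrite mulr_ge0 ?exprn_ge0 // coef_poly; case: ifP => // _; case: ifP => // _;
    exact: lcoef_ge0.
have QD t : 0 <= t -> t <= 1 -> Q.[t] <= D * t.
  move=> t0 t1; rewrite (horner_coef_wide _ (size_poly _ _)) /D big_mkord mulr_suml.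
  apply: ler_sum => j _; rewrite coef_poly ltn_ord; case: (nat_of_ord j) => [|i] /=.
    by rewrite mul0r mulr_ge0 // lcoef_ge0.
  by rewrite ler_wpM2l ?lcoef_ge0 // exprS ler_piMr // exprn_ile1.
pose Cst := expR (lcoef 0) * (expR D * (B * expR B) + D ^+ m.+1 * expR D).
have key t Av : 0 < t -> t < 4^-1 ->
    (forall e : R, 0 < e -> exists N, forall n, (N <= n)%N ->
       `|\sum_(0 <= i < n) a i * expR (t * L i) - Av| <= e) ->
    `|expR Av - p.[t]| <= Cst * t ^+ m.+1.
  move=> t0 t1 hAv; have tt : t <= 1 by lra.
  have /andP[r1 r2] := hB t Av (ltW t0) (ltW t1) hAv.
  rewrite -QE in r1 r2; set rr := Av - _ in r1 r2.
  have tm : t ^+ m.+1 <= 1 by rewrite exprn_ile1 // ltW.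
  have tm0 : 0 <= t ^+ m.+1 by rewrite exprn_ge0 // ltW.
  have q0 := Q0 t (ltW t0); have qD := QD t (ltW t0) tt.
  have qD1 : Q.[t] <= D by apply: le_trans qD _; rewrite ler_piMr.
  have rB : rr <= B by apply: le_trans r2 _; rewrite ler_piMr.
  have AvE : Av = lcoef 0 + Q.[t] + rr by rewrite /rr; ring.
  have -> : expR Av - p.[t] = expR (lcoef 0) *
      (expR Q.[t] * (expR rr - 1) + (expR Q.[t] - expS Q.[t] m.+1)).
    by rewrite AvE !expRD pE; ring.
  rewrite /Cst normrM (ger0_norm (expR_ge0 _)) -mulrA ler_wpM2l ?expR_ge0 // mulrDl.
  apply: le_trans (ler_normD _ _) _; apply: lerD.
    rewrite normrM (ger0_norm (expR_ge0 _)) -mulrA.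
    apply: ler_pM; rewrite ?expR_ge0 ?ler_expR //.
    apply: le_trans (expR_B1_le rr) _; rewrite (ger0_norm r1) mulrAC.
    by apply: ler_pM; rewrite ?expR_ge0 ?ler_expR.
  rewrite ger0_norm ?subr_ge0 ?expS_le //.
  apply: le_trans (exp_taylor m.+1 q0) _.
  rewrite mulrAC -exprMn; apply: ler_pM; rewrite ?expR_ge0 ?exprn_ge0 ?ler_expR //.
  by rewrite lerXn2r // nnegrE // mulr_ge0 // ltW.
have bm : b m - (p`_m)%:C = 0.
  apply: (@ps_coef_zero _ (fun j => b j - (p`_j)%:C) r (A + \sum_(0 <= j < size p) `|p`_j| * r
    ^+ j) Cst (4^-1) m.+1) => //.
    move=> j; apply: le_trans (cmodB _ _) _; rewrite mulrDl cmodR; apply: lerD => //.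
    rewrite ler_pdivlMr ?exprn_gt0 //; have [jp|pj] := ltnP j (size p).
      rewrite (@big_cat_nat _ _ _ j) //= ?(ltnW jp) // [X in _ <= _ + X]big_ltn //.
      rewrite addrCA lerDl addr_ge0 // sumr_ge0 // => i _;
        rewrite mulr_ge0 // exprn_ge0 // ltW //.
    rewrite nth_default // normr0 mul0r sumr_ge0 // => i _;
      rewrite mulr_ge0 // exprn_ge0 // ltW //.
  move=> t l t0 t1 hl.
  have [Av hAv] : exists Av : R, forall e : R, 0 < e -> exists N, forall n, (N <= n)%N ->
     `|\sum_(0 <= i < n) a i * expR (t * L i) - Av| <= e by apply: dirichlet_cvg; lra.
  have hp : csums (fun j => (p`_j)%:C * t%:C ^+ j) (p.[t])%:C.
    apply: (@clim_tail _ (fun=> (p.[t])%:C) _ _ (size p)); last exact: clim_cst.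
    move=> n hn; rewrite (horner_coef_wide _ hn) big_mkord rmorph_sum /=.
    by apply: eq_bigr => i _; rewrite rmorphM rmorphXn.
  have -> : l = (expR Av - p.[t])%:C.
    rewrite rmorphB /=; apply: clim_uniq hl _.
    by apply: csums_eq (csumsB (hG t Av t0 t1 hAv) hp) => j; rewrite mulrBl.
  by rewrite cmodR; exact: key.
move/eqP: bm; rewrite subr_eq0 => /eqP ->.
rewrite cmodR; apply: le_trans (ler_norm _).
have qc j : 0 <= Q`_j.
  by rewrite coef_poly; case: ifP => // _; case: ifP => // _; exact: lcoef_ge0.
rewrite coefZ coef_sum; apply: le_trans (_ : 1 * lcoef m <= _); first by rewrite mul1r.
apply: ler_pM; rewrite ?lcoef_ge0 //.
  by rewrite -expR0 ler_expR lcoef_ge0.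
(* The summand [i = 1], which is [Q] itself, contributes [lcoef m]; the other powers of [Q] have
   nonnegative coefficients. *)
have m1 : (1 < m.+1)%N by rewrite ltnS.
rewrite (bigD1 (Ordinal m1)) //= coefZ (_ : 1`! = 1%N) // invr1 mul1r expr1 coef_poly ltnS leqnn.
rewrite (negbTE (lt0n_neq0 m0)) lerDl; apply: sumr_ge0 => i _;
  rewrite coefZ mulr_ge0 ?invr_ge0 //.
exact: coef_exp_ge0.
Qed.

(** The Taylor series of [G] at 3 reaches every real point right of [sg], and its coefficients
    dominate those of the exponent. Nonnegativity then lets the double series over [n] and the
    Taylor index be reordered into the Dirichlet series at [rho]. *)
Theorem landau (G : C -> C) (sg : R) : sg < 2 -> (forall z, sg < Re z -> hol G z) ->
  (forall z, 2 <= Re z -> G z = cexp (csum (fun n => (c n)%:C * npow n z))) ->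
  forall rho, sg < rho -> exists B, forall n, \sum_(0 <= m < n) c m * m%:R `^ (- rho) <= B.
Proof.
move=> sg2 hG GE rho hr; pose rh := Num.min rho 2.
have rh1 : sg < rh by rewrite lt_min hr.
have rh2 : rh <= 2 by rewrite ge_min lexx orbT.
have rh3 : rh <= rho by rewrite ge_min lexx.
(* Interpolated radii [t0 < ra < ra' < 3 - sg]: [ra'] for holomorphy, [ra] for the Cauchy estimates,
   [t0] for evaluation. Capping [rho] at 2 keeps [t0 >= 1]. *)
pose t0 := 3 - rh; pose ra := 3 - (sg + rh) / 2; pose ra' := 3 - (3 * sg + rh) / 4.
have l1 : 1 <= t0 by rewrite /t0; lra.
have l2 : t0 < ra by rewrite /t0 /ra; lra.
have l3 : ra < ra' by rewrite /ra /ra'; lra.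
have l4 : ra' < 3 - sg by rewrite /ra'; lra.
have ra0 : 0 < ra by lra.
have [k _ H] := square_power_series ra0.
have [z [hz _]|b [[A hA] _ hs]] := H (fun h => G (3%:C - h)) ra' l3.
  apply: (@hol_comp _ G (fun h => 3%:C - h)); first by apply: holB;
    [exact: hol_cst|exact: hol_id].
  by apply: hG; rewrite ReB /=; have := ler_norm (Re z); lra.
have A0 : 0 <= A by have := hA 0%N; rewrite expr0 divr1; apply: le_trans; exact: cmod_ge0.
have cge : forall m, (0 < m)%N -> lcoef m <= cmod (b m).
  apply: (exp_coef_ge ra0 hA) => t Av tp t1 hAv.
  have := hs t%:C; rewrite cmodR gtr0_norm // => /(_ _) hst.
  have {hst} := hst ltac:(lra); rewrite -rmorphB GE; last by rewrite /=; lra.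
  rewrite (_ : csum _ = Av%:C) ?cexp_real //; apply: csumP.
  move=> e /hAv [N hN]; exists N => n /hN.
  have -> : \sum_(0 <= i < n) (c i)%:C * npow i (3 - t)%:C =
      (\sum_(0 <= i < n) a i * expR (t * L i))%:C.
    rewrite rmorph_sum; apply: eq_bigr => i _; rewrite a_exp.
    by case: i => [|i]; [rewrite c00 !mul0r|rewrite npow_real // rmorphM].
  by rewrite -rmorphB cmodR.
pose q := t0 / ra.
have q0 : 0 <= q by rewrite divr_ge0 ?ltW //; lra.
have q1 : q < 1 by rewrite ltr_pdivrMr // mul1r.
pose Bd := lcoef 0 + A / (1 - q).
have sumB M : \sum_(0 <= m < M) lcoef m * t0 ^+ m <= Bd.
  case: M => [|M]; first by rewrite big_geq // addr_ge0 ?lcoef_ge0 // divr_ge0 // subr_ge0 ltW.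
  rewrite big_nat_recl // expr0 mulr1 lerD2l.
  apply: le_trans (_ : \sum_(0 <= i < M) A * q ^+ i.+1 <= _).
    apply: ler_sum => i _; apply: le_trans (_ : cmod (b i.+1) * t0 ^+ i.+1 <= _).
      by rewrite ler_wpM2r ?cge // exprn_ge0; lra.
    rewrite /q expr_div_n mulrA mulrAC ler_wpM2r ?exprn_ge0 //; lra.
  rewrite -mulr_sumr ler_wpM2l //.
  have -> : (1 - q)^-1 = 1 + q / (1 - q) by field; rewrite subr_eq0 gt_eqF.
  apply: le_trans (_ : (q - q ^+ M.+1) / (1 - q) <= _).
    rewrite ler_pdivlMr ?subr_gt0 // le_eqVlt; apply/orP; left; apply/eqP.
    elim: M => [|M IH]; first by rewrite big_geq // mul0r expr1 subrr.
    by rewrite big_nat_recr //= mulrDl IH !exprS; ring.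
  have qM : 0 <= q ^+ M.+1 by rewrite exprn_ge0.
  have d0 : 0 < 1 - q by rewrite subr_gt0.
  rewrite mulrBl; have : 0 <= q ^+ M.+1 / (1 - q) by rewrite divr_ge0 // ltW.
  lra.
exists Bd => N; apply: le_trans (_ : \sum_(0 <= i < N) a i * expR (t0 * L i) <= _).
  apply: ler_sum => -[|i] _; first by rewrite c00 mul0r mulr_ge0 ?expR_ge0.
  rewrite a_exp ler_wpM2l // powR_le_exp // /t0; lra.
(* For fixed [N] only finitely many exponentials occur; each is the limit of its Taylor polynomials,
   and for every number [M] of Taylor terms the finite double sum is at most [Bd]. *)
have cv i (e : R) : 0 < e -> exists N', forall M, (N' <= M)%N ->
    `|a i * expS (t0 * L i) M - a i * expR (t0 * L i)| <= e.
  move=> e0; have a1 : 0 < a i + 1 by rewrite ltr_wpDl.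
  have := @expS_cvg (t0 * L i) => /cvgrPdist_le /(_ _ (divr_gt0 e0 a1)) [N' _ hN'].
  exists N' => M /hN' /=; rewrite distrC ler_pdivlMr // => h.
  rewrite -mulrBr normrM (ger0_norm (a_ge0 i)) mulrC; apply: le_trans h.
  by rewrite ler_wpM2l // lerDl.
apply: real_limit_le (limit_sum (index_iota 0 N) cv) _ => M; apply: le_trans (sumB M).
have -> : \sum_(0 <= i < N) a i * expS (t0 * L i) M =
    \sum_(0 <= m < M) (\sum_(0 <= i < N) a i * (L i ^+ m / m`!%:R)) * t0 ^+ m.
  under [RHS]eq_bigr do rewrite mulr_suml.
  rewrite exchange_big /=; apply: eq_bigr => i _; rewrite /expS mulr_sumr.
  by apply: eq_bigr => j _; rewrite exprMn; ring.
apply: ler_sum => m _; rewrite ler_wpM2r ?lcoef_ge // exprn_ge0 //; lra.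
Qed.
End landau.

(** * Comparing F with zeta *)

Section zero_pole_comparison.
Variable R : realType.
Local Notation C := R[i].
Local Notation Re := complex.Re.
Local Notation Im := complex.Im.
Implicit Types (z w h : C).

Lemma lt_segment (x y t c : R) : c < x -> c < y -> 0 <= t <= 1 -> c < x + t * (y - x).
Proof.
move=> hx hy /andP[t0 t1]; rewrite -subr_gt0.
have -> : x + t * (y - x) - c = (1 - t) * (x - c) + t * (y - c) by ring.
have [->|tn0] := eqVneq t 0; first by rewrite subr0 mul1r mul0r addr0 subr_gt0.
by rewrite ltr_wpDl ?mulr_ge0 ?subr_ge0 ?(ltW hx) // mulr_gt0 ?subr_gt0 // lt_def tn0.
Qed.

Lemma half_plane_identity (u v : C -> C) (sg : R) z0 r : sg < Re z0 -> 0 < r ->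
  (forall z, sg < Re z -> hol u z) -> (forall z, sg < Re z -> hol v z) ->
  (forall h, cmod h < r -> u (z0 + h) = v (z0 + h)) ->
  forall z, sg < Re z -> u z = v z.
Proof.
move=> hz0 r0 hu hv E z hz; apply/eqP; rewrite -subr_eq0; apply/eqP.
apply: (@identity_convex _ (fun z => sg < Re z) (fun z => u z - v z) z0 r) => //.
- by move=> p q t hp hq ht; rewrite ReD ReM ReB /= mul0r subr0; exact: lt_segment.
- move=> p hp; exists ((Re p - sg) / 2); first by rewrite divr_gt0 // subr_gt0.
  by move=> h [k _]; rewrite ReD; have := ler_norm (- Re h); rewrite normrN; lra.
- by move=> p hp; apply: holB; [exact: hu|exact: hv].
- by move=> h /E ->; rewrite subrr.
Qed.

Lemma climX (s : nat -> C) l n : clim s l -> clim (fun N => s N ^+ n) (l ^+ n).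
Proof.
move=> hs; elim: n => [|n IH]; first by apply: clim_eq (clim_cst 1) => N; rewrite expr0.
by rewrite exprS; apply: clim_eq (climM hs IH) => N; rewrite exprS.
Qed.

Lemma clim_S (s : nat -> C) l : clim s l -> clim (fun n => s n.+1) l.
Proof. by apply: (@clim_subseq _ _ _ succn) => N; exists N => n; apply: leqW. Qed.

Variables (al : R) (k : nat) (sg : R) (g e : nat -> R) (H : C -> C).
Hypotheses (al0 : 0 < al) (k0 : (0 < k)%N) (sg1 : 2^-1 < sg) (sg2 : sg < 1 - al).
Hypothesis g1 : g 1%N = 1.
Hypothesis gb : forall n, (0 < n)%N -> `|g n| <= 1.
Hypothesis gm : forall p m, prime p -> (0 < m)%N ->
  g (p * m)%N = if (p %| m)%N then 0 else g p * g m.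
Hypothesis e0 : forall p, prime p -> `|e p| <= 1.
Hypothesis eN : forall p, prime p -> e p <= 0.
Hypothesis ek : forall p, prime p -> 0 <= k%:R * p%:R `^ (- al) + e p.

(* With [e p] the mean of [f p], this is (k - delta_p) / p^alpha. *)
Definition excess_coef n : R := if prime n then k%:R * n%:R `^ (- al) + e n else 0.
Definition centered_coef n : R := if prime n then g n - e n else 0.
Definition coef_sum n : R := \sum_(1 <= j < n.+1) g j.
Definition centered_sum n : R := \sum_(1 <= j < n.+1) centered_coef j.
Definition series_fun z : C := abel_sum coef_sum z.

Hypothesis hM : exists Kg, forall n, `|coef_sum n.+1| <= Kg * n.+1%:R `^ sg.
Hypothesis hS : forall rho, sg < rho -> exists B, forall n,
  \sum_(0 <= m < n) `|centered_sum m.+1| * m.+1%:R `^ (- (1 + rho)) <= B.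
Hypothesis hH : near0 (fun h => hol H ((1 - al)%:C + h) /\
  series_fun ((1 - al)%:C + h) = h ^+ k * H ((1 - al)%:C + h)).

Let sg0 : 0 <= sg. Proof. by have := sg1; lra. Qed.

Lemma series_fun_hol z : sg < Re z ->
  csums (abel_term coef_sum ^~ z) (series_fun z) /\ hol series_fun z.
Proof.
apply: abel_sum_hol sg0 _ _ => rho hr; have [Kg hK] := hM.
have K0 : 0 <= Kg.
  by have := hK 0%N; rewrite powR1 mulr1; apply: le_trans.
exists (Kg * (1 + (rho - sg)^-1)) => n.
apply: le_trans (_ : \sum_(0 <= m < n) Kg * m.+1%:R `^ (- (1 + (rho - sg))) <= _).
  apply: ler_sum => m _; have p : (m.+1%:R == 0 :> R) = false by rewrite pnatr_eq0.
  have -> : m.+1%:R `^ (- (1 + (rho - sg))) = m.+1%:R `^ sg * m.+1%:R `^ (- (1 + rho)) :> R.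
    by rewrite -powRD ?p ?implybT //; congr (_ `^ _); ring.
  by rewrite mulrA ler_wpM2r ?powR_ge0.
by rewrite -mulr_sumr ler_wpM2l // zeta_bound // subr_gt0.
Qed.

Lemma centered_sum_hol z : sg < Re z ->
  csums (abel_term centered_sum ^~ z) (abel_sum centered_sum z) /\ hol (abel_sum centered_sum) z.
Proof. exact: abel_sum_hol. Qed.

Lemma excess_coef_ge0 n : 0 <= excess_coef n.
Proof. by rewrite /excess_coef; case: ifP => // /ek. Qed.

Lemma excess_coef_le n : excess_coef n <= k%:R.
Proof.
rewrite /excess_coef; case: ifPn => // pn.
have : k%:R * n%:R `^ (- al) <= k%:R * 1 :> R.
  rewrite ler_wpM2l // -[leRHS](powRr0 n%:R) ler_powR ?ler1n ?prime_gt0 //; have := al0; lra.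
have := eN pn; lra.
Qed.

(** The value at [1 - al] makes the quotient agree with the cofactor [H] nearby, so the singularity
    is removed by the hypothesis [hH] itself. *)
Definition deflated_fun z : C :=
  if z == (1 - al)%:C then H (1 - al)%:C else series_fun z / (z - (1 - al)%:C) ^+ k.

(* The zero of F cancels the pole of zeta(z + al)^k at 1 - al; the remaining
   factors strip the random part and the higher prime powers off the Euler
   products, leaving the exponential of the series of [excess_coef]. *)
Definition comparison_fun z : C :=
  zeta1 (z + al%:C) ^+ k * deflated_fun z *
  (cexp (- abel_sum centered_sum z) * infprod (euler_f g) z * infprod (@euler_zeta R) (z +
    al%:C) ^+ k).

Lemma hol_shift u z : hol u (z + al%:C) -> hol (fun w => u (w + al%:C)) z.
Proof.
move=> hu; apply: (@hol_comp _ u (fun w => w + al%:C)) => //.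
by apply: holD; [exact: hol_id|exact: hol_cst].
Qed.

Lemma deflated_fun_hol z : sg < Re z -> hol deflated_fun z.
Proof.
move=> hz; have [->|nz] := eqVneq z (1 - al)%:C.
  have [r r0 hr] := hH; have [h0 _] := hr 0 ltac:(by rewrite cmod0).
  rewrite addr0 in h0; apply: hol_ext h0; exists r => // h /hr [_ E].
  rewrite /deflated_fun; case: eqP => [/eqP|/eqP nh].
    by rewrite -subr_eq0 addrAC subrr add0r => /eqP ->; rewrite addr0.
  have h0 : h != 0 by apply: contraNN nh => /eqP ->; rewrite addr0.
  by rewrite E addrAC subrr add0r mulrC mulKf // expf_neq0.
apply: (@hol_ext _ (fun z => series_fun z / (z - (1 - al)%:C) ^+ k)).
  exists (cmod (z - (1 - al)%:C)); first by rewrite cmod_gt0 subr_eq0.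
  move=> h hh; rewrite /deflated_fun; case: eqP => // E; exfalso.
  by move: hh; rewrite -E opprD addrA subrr sub0r cmodN ltxx.
apply: holM; first by have [] := series_fun_hol hz.
apply: holV; last by rewrite expf_neq0 // subr_eq0.
by apply: holX; apply: holB; [exact: hol_id|exact: hol_cst].
Qed.

Lemma comparison_fun_hol z : sg < Re z -> hol comparison_fun z.
Proof.
have hs1 := sg1; have hs2 := sg2; have ha := al0.
move=> hz; have hz1 : 2^-1 < Re z by lra.
have hz2 : 2^-1 < Re (z + al%:C) by rewrite ReD /=; lra.
have gp n : prime n -> `|g n| <= 1 by move=> pn; apply: gb; exact: prime_gt0.
apply: holM.
  apply: holM; last exact: deflated_fun_hol.
  apply: (@holX _ (fun z => zeta1 (z + al%:C))); apply: hol_shift.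
  by have [|//] := @zeta1_hol _ (z + al%:C); lra.
apply: holM.
  apply: holM; last by have [] := infprod_f gp hz1.
  by apply: hol_cexp; apply: holN; have [] := centered_sum_hol hz.
apply: (@holX _ (fun z => infprod (@euler_zeta R) (z + al%:C))); apply: hol_shift.
by have [] := infprod_zeta hz2.
Qed.

Lemma excess_coef_csums z : 2 <= Re z ->
  csums (fun n => (excess_coef n)%:C * npow n z) (csum (fun n => (excess_coef n)%:C * npow n z)).
Proof.
move=> hz; have [|||| h _] := @abs_dirichlet_hol R excess_coef 1 _ _ _ z _ => //.
- exact: excess_coef_ge0.
- move=> rho hr; exists (k%:R * (1 + (rho - 1)^-1)) => -[|n].
    by rewrite big_geq // mulr_ge0 // addr_ge0 // invr_ge0; lra.
  rewrite big_nat_recl // [excess_coef 0]/(0 : R) mul0r add0r.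
  apply: le_trans (_ : \sum_(0 <= m < n) k%:R * m.+1%:R `^ (- (1 + (rho - 1))) <= _).
    apply: ler_sum => m _; rewrite [1 + (_ - 1)]addrC subrK.
    by rewrite ler_wpM2r ?powR_ge0 ?excess_coef_le.
  by rewrite -mulr_sumr ler_wpM2l // zeta_bound //; lra.
- by lra.
Qed.

(** Both sides are limits of finite identities supplied by the sieve, whose remainders tend to 1. At
    each prime the exponents add up to [k p^-(z + al) + g p p^-z - (g p - e p) p^-z]: the random
    [g p] cancels and [excess_coef p] times [p^-z] is left. *)
Lemma comparison_fun_eq z : 2 <= Re z ->
  comparison_fun z = cexp (csum (fun n => (excess_coef n)%:C * npow n z)).
Proof.
have hs1 := sg1; have hs2 := sg2; have ha := al0.
move=> hz; have hza : 2 <= Re (z + al%:C) by rewrite ReD /=; lra.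
have gp n : prime n -> `|g n| <= 1 by move=> pn; apply: gb; exact: prime_gt0.
have b1 n : (0 < n)%N -> `|(fun=> 1 : R) n| <= 1 by rewrite normr1.
set Zs := zeta1 (z + al%:C) / (z + al%:C - 1).
have nz : z - (1 - al)%:C != 0.
  apply/eqP => E; have : Re (z - (1 - al)%:C) = 0 by rewrite E.
  by rewrite ReB /=; lra.
have zz : z + al%:C - 1 = z - (1 - al)%:C by rewrite rmorphB /= rmorph1; ring.
have FE : @sieve_lim R g z 0 = series_fun z.
  apply: sieve_lim0 => //; apply: (@abel_sum_dirichlet _ g 1) => //; first by move=> n; exact: gb.
    by lra.
  by have [|//] := @series_fun_hol z; lra.
have ZE : @sieve_lim R (fun=> 1) (z + al%:C) 0 = Zs.
  apply: sieve_lim0 => //; apply: clim_eq (zeta1_dirichlet _) => [N|]; last by lra.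
  by apply: eq_bigr => n _; rewrite rmorph1 mul1r.
have SE : clim (fun N => \sum_(1 <= n < N.+1) (centered_coef n)%:C * npow n z) (abel_sum
  centered_sum z).
  apply: (@abel_sum_dirichlet _ centered_coef 2) => //; last first.
  - by have [|//] := @centered_sum_hol z; lra.
  - by lra.
  - move=> n; rewrite /centered_coef; case: ifP => pn; last by rewrite normr0.
    by apply: le_trans (ler_normB _ _) _; have := gp _ pn; have := e0 pn; lra.
have P1E : clim (fun N => \prod_(0 <= i < N.+1) euler_f g i z) (infprod (euler_f g) z).
  have hz' : 2^-1 < Re z by lra.
  by have [h _] := infprod_f gp hz'; exact: clim_S h.
have P2E : clim (fun N => \prod_(0 <= i < N.+1) euler_zeta i (z + al%:C)) (infprod (@euler_zeta
  R) (z + al%:C)).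
  have hz' : 2^-1 < Re (z + al%:C) by lra.
  by have [h _] := infprod_zeta hz'; exact: clim_S h.
have lhs := climM (climM (climX k (climZ Zs P2E)) (climZ (series_fun z) P1E)) (clim_cexp (climN
  SE)).
have rhs := climM (clim_cexp (clim_S (excess_coef_csums hz)))
  (climM (sieve_to1 hz g1 gb) (climX k (sieve_to1 hza erefl b1))).
have -> : comparison_fun z = (Zs * infprod (@euler_zeta R) (z + al%:C)) ^+ k *
    (series_fun z * infprod (euler_f g) z) * cexp (- abel_sum centered_sum z).
  rewrite /comparison_fun /deflated_fun -subr_eq0 (negbTE nz) !exprMn /Zs zz exprVn.
  by field; rewrite expf_neq0.
rewrite -[RHS]mulr1 -[X in _ = _ * X](mulr1 1) -[X in _ = _ * (_ * X)](expr1n _ k).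
apply: clim_uniq lhs _; apply: clim_eq rhs => N.
rewrite -FE -ZE euler_product_zeta // euler_product_f // exprMn -cexpMn.
set A := sieve_lim _ _ _; set B := sieve_lim _ _ _ ^+ k.
rewrite (_ : \sum_(0 <= m < N.+1) _ = k%:R * (\sum_(0 <= i < N.+1 | prime i) npow i (z + al%:C)) +
   \sum_(0 <= i < N.+1 | prime i) (g i)%:C * npow i z -
   \sum_(1 <= n < N.+1) (centered_coef n)%:C * npow n z); first by rewrite !cexpD; ring.
have -> : \sum_(1 <= n < N.+1) (centered_coef n)%:C * npow n z = \sum_(0 <= n < N.+1)
  (centered_coef n)%:C * npow n z.
  by rewrite [RHS]big_ltn // [centered_coef 0]/(0 : R) mul0r add0r.
rewrite mulr_sumr [X in X + _ - _]big_mkcond [X in _ + X - _]big_mkcond -big_split -sumrB /=.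
apply: eq_bigr => i _; rewrite /excess_coef /centered_coef; case: ifP => pi;
  last by rewrite !mul0r addr0 subr0.
rewrite npow_add (npow_real _ (prime_gt0 pi)) !rmorphD !rmorphM rmorphN /=.
by rewrite -(rmorph_nat (real_complex R)); ring.
Qed.

Theorem excess_summable rho : sg < rho -> exists B, forall n,
  \sum_(0 <= m < n) excess_coef m * m%:R `^ (- rho) <= B.
Proof.
have hs1 := sg1; have hs2 := sg2; have ha := al0.
apply: (landau excess_coef_ge0 excess_coef_le erefl (G := comparison_fun)); first by lra.
  exact: comparison_fun_hol.
exact: comparison_fun_eq.
Qed.

Theorem shifted_zeta_neq0 w : sg + al < Re w -> zeta1 w != 0.
Proof.
have hs1 := sg1; have hs2 := sg2; have ha := al0.
move=> hw; pose A z := csum (fun n => (excess_coef n)%:C * npow n z).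
have GE z : sg < Re z -> comparison_fun z = cexp (A z).
  apply: (@half_plane_identity comparison_fun (fun z => cexp (A z)) sg 3%:C 1) => //;
    first by rewrite /=; lra.
  - exact: comparison_fun_hol.
  - move=> p hp; apply: hol_cexp.
    by have [||//] := @abs_dirichlet_hol R excess_coef sg erefl _ _ p hp;
      [exact: excess_coef_ge0|exact: excess_summable].
  - move=> h hh; apply: comparison_fun_eq; rewrite ReD /=.
    by have := cmod_Re h; have := ler_norm (- Re h); rewrite normrN; lra.
have := GE (w - al%:C); rewrite ReB /= => /(_ _) E.
have {E}E := E ltac:(lra); apply/eqP => Z0; have := cexp_neq0 (A (w - al%:C)).
(* Here [0 < k] enters: a zero of [zeta1] at [w] annihilates the factor [zeta1 w ^+ k]. *)
by rewrite -E /comparison_fun subrK Z0 expr0n (gtn_eqF k0) !mul0r eqxx.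
Qed.
End zero_pole_comparison.

(** * The Riemann zeta function and the continuation of F *)

Section riemann_zeta_function.
Variable R : realType.
Local Notation C := R[i].
Local Notation Re := complex.Re.
Local Notation Im := complex.Im.
Implicit Types (z w h : C).

Lemma near_near0 (z0 : C^o) (Q : C -> Prop) : (\forall z \near z0, Q z) -> near0 (fun h => Q
  (z0 + h)).
Proof.
move=> /nbhs_ballP [e /= e0 he].
have eE : e = (Re e)%:C by move: e0; rewrite ltcE => /andP[/eqP E _]; case: e E {he} => a b /= ->.
exists (Re e); first by move: e0; rewrite ltcE => /andP[].
move=> h hh; apply: he; rewrite -ball_normE /= eE.
by rewrite opprD addrA subrr sub0r normrN normCE ltcR.
Qed.

Lemma near0_near (z0 : C^o) (Q : C -> Prop) : near0 (fun h => Q (z0 + h)) -> \forall z \near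
  z0, Q z.
Proof.
move=> [r r0 hr]; apply/nbhs_ballP; exists r%:C; first by rewrite /= ltcR.
move=> w; rewrite -ball_normE /= distrC normCE ltcR => /hr.
by rewrite [z0 + _]addrC subrK.
Qed.

Lemma clim_cvg (s : nat -> C^o) (l : C^o) : clim s l -> s @ \oo --> l.
Proof.
move=> hs; apply/cvgrPdist_le => e e0.
have eE : e = (Re e)%:C by move: e0; rewrite ltcE => /andP[/eqP E _]; case: e E => a b /= ->.
have /hs [N hN] : 0 < Re e by move: e0; rewrite ltcE => /andP[].
by exists N => // n /hN h; rewrite distrC normCE eE lecR.
Qed.

Lemma dirichlet_seriesE (a : nat -> R) z l :
  clim (fun N => \sum_(1 <= n < N.+1) (a n)%:C * npow n z) l -> dirichlet_series a z = l.
Proof.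
move=> hl; rewrite /dirichlet_series; apply: cvg_lim => //; apply: clim_cvg.
apply: clim_eq hl => N; rewrite !big_nat; apply: eq_bigr => n /andP[n0 _].
by rewrite npow_oppE.
Qed.

Definition zeta z : C := zeta1 z / (z - 1).

Lemma zeta_hol z : 0 < Re z -> z <> 1 -> hol zeta z.
Proof.
move=> hz /eqP z1; apply: holM; first by have [] := zeta1_hol hz.
by apply: holV; [apply: holB; [exact: hol_id|exact: hol_cst]|rewrite subr_eq0].
Qed.

Lemma zeta_dirichlet z : 1 < Re z -> dirichlet_series (fun=> 1 : R) z = zeta z.
Proof.
move=> hz; apply: dirichlet_seriesE; apply: clim_eq (zeta1_dirichlet hz) => N.
by apply: eq_bigr => n _; rewrite rmorph1 mul1r.
Qed.

Lemma zeta_continuation : analytic_continuation (fun=> 1 : R)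
  [set z : C^o | 0 < Re z /\ z <> 1] (zeta : C^o -> C^o).
Proof.
split.
- rewrite openE => z /= [z0 z1]; apply: near0_near.
  exists (Num.min (Re z) (cmod (z - 1))).
    by rewrite lt_min z0 cmod_gt0 subr_eq0; exact/eqP.
  move=> h; rewrite lt_min => /andP[h1 h2] /=; split.
    by rewrite ReD; have := cmod_Re h; have := ler_norm (- Re h); rewrite normrN; lra.
  move=> E; move: h2; rewrite -E opprD addrA subrr sub0r cmodN ltxx //.
- move=> z /= hz; split; first by lra.
  by move=> E; move: hz; rewrite E /= ltxx.
- by move=> z /= [z0 z1]; have [d hd] := zeta_hol z0 z1; exact: cderiv_derivable hd.
- by move=> z hz; rewrite zeta_dirichlet.
Qed.

(** The half-plane without 1 is not convex, so vanishing passes from [Re z > 1] to the two open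
    quadrants [Im z > 0] and [Im z < 0], and from the upper one to the strip [0 < Re z < 1];
    together these regions cover it. *)
Lemma punctured_identity (u : C -> C) : (forall z, 0 < Re z -> z <> 1 -> hol u z) ->
  (forall z, 1 < Re z -> u z = 0) -> forall z, 0 < Re z -> z <> 1 -> u z = 0.
Proof.
move=> hu u0.
have upper (s : R) z : s ^+ 2 = 1 -> 0 < Re z -> 0 < s * Im z -> u z = 0.
  move=> s1 z0 z1.
  apply: (@identity_convex _ (fun z => 0 < Re z /\ 0 < s * Im z) u (2 +i* s) 1) => //.
  - move=> p q t [p0 p1] [q0 q1] ht; split.
      by rewrite ReD ReM ReB /= mul0r subr0; exact: lt_segment.
    rewrite ImD ImM ImB /= mul0r addr0 mulrDr mulrCA mulrBr; exact: lt_segment.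
  - move=> p [p0 p1]; exists (Num.min (Re p / 2) (s * Im p / 2)).
      by rewrite lt_min !divr_gt0.
    move=> h [h1 h2]; rewrite !le_min in h1 h2.
    case/andP: h1 => h1 _; case/andP: h2 => _ h2.
    have sn : `|s * Im h| = `|Im h|.
      rewrite normrM (_ : `|s| = 1) ?mul1r //; apply/eqP.
      by rewrite -(@eqrXn2 _ 2) // real_normK ?num_real // s1 expr1n.
    rewrite ReD ImD mulrDr; have := ler_norm (- Re h); have := ler_norm (- (s * Im h)).
    by rewrite !normrN sn; split; lra.
  - move=> p [p0 p1]; apply: hu => // E; move: p1; rewrite E /= mulr0 ltxx //.
  - by split => /=; [lra|rewrite -expr2 s1].
  - move=> h hh; apply: u0; rewrite ReD /=.
    by have := cmod_Re h; have := ler_norm (- Re h); rewrite normrN; lra.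
move=> z z0 z1; have [im|im|im] := ltgtP (Im z) 0.
- by apply: (upper (-1)); rewrite ?sqrrN ?expr1n // mulN1r oppr_gt0.
- by apply: (upper 1); rewrite ?expr1n // mul1r.
have [re|re|re] := ltgtP (Re z) 1; last 2 first.
- exact: u0.
- by exfalso; apply: z1; apply: eqC.
apply: (@identity_convex _ (fun z => 0 < Re z /\ Re z < 1) u (2^-1 +i* 1) (2^-1)) => //.
- move=> p q t [p0 p1] [q0 q1] ht; rewrite ReD ReM ReB /= mul0r subr0; split;
  first exact: lt_segment.
  rewrite -ltrN2 opprD -mulrN opprB; have -> : Re p - Re q = - Re q - - Re p by ring.
  by apply: lt_segment => //; rewrite ltrN2.
- move=> p [p0 p1]; exists (Num.min (Re p / 2) ((1 - Re p) / 2)).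
    by rewrite lt_min !divr_gt0 // subr_gt0.
  move=> h [h1 _]; rewrite le_min in h1; case/andP: h1 => h1 h2.
  by rewrite ReD; have := ler_norm (- Re h); have := ler_norm (Re h); rewrite normrN; split; lra.
- by move=> p [p0 p1]; apply: hu => // E; move: p1; rewrite E /= ltxx.
- by rewrite /=; split; lra.
- move=> h hh; apply: (upper 1); rewrite ?expr1n //.
    by rewrite ReD /=; have := cmod_Re h; have := ler_norm (- Re h); rewrite normrN; lra.
  by rewrite mul1r ImD /=; have := cmod_Im h; have := ler_norm (- Im h); rewrite normrN; lra.
Qed.

(** [riemann_zeta] is chosen among all continuations; [zeta_continuation] gives existence and
    [punctured_identity] uniqueness. *)
Lemma riemann_zetaE z : 0 < Re z -> z <> 1 -> riemann_zeta z = zeta z.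
Proof.
move=> z0 z1.
have [_ _ hZ EZ] : analytic_continuation (fun=> 1 : R) [set z : C^o | 0 < Re z /\ z <> 1]
  (@riemann_zeta R).
  rewrite /riemann_zeta;
    apply: (@xgetPex _ (fun=> 0) [set Z : C^o -> C^o | analytic_continuation (fun=> 1)
    [set z : C^o | 0 < Re z /\ z <> 1] Z]).
  by exists zeta; exact: zeta_continuation.
apply/eqP; rewrite -subr_eq0; apply/eqP.
apply: (@punctured_identity (fun z => riemann_zeta z - zeta z)) => //.
- move=> w w0 w1; apply: holB; last exact: zeta_hol.
  by apply: derivable_cderiv; apply: hZ; split.
- by move=> w w1; rewrite EZ // zeta_dirichlet // subrr.
Qed.

(** The continuation that carries the zero may live on another half-plane than the Abel sum. Both
    are defined for [Re z > max s0 sg], a half-plane containing [1 - al], and agree there, so the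
    zero is transferred. *)
Lemma continuation_zero (a : nat -> R) (al sg s0 : R) (k : nat) (F : C^o -> C^o) :
  let M n := \sum_(1 <= j < n.+1) a j in
  (forall n, `|a n.+1| <= 1) -> sg < 1 - al -> 0 < al ->
  (forall z, sg < Re z -> csums (abel_term M ^~ z) (abel_sum M z) /\ hol (abel_sum M) z) ->
  s0 < 1 - al -> analytic_continuation a [set z : C^o | s0 < Re z] F ->
  zero_of_multiplicity F (1 - al)%:C k ->
  exists H : C -> C, near0 (fun h => hol H ((1 - al)%:C + h) /\
    abel_sum M ((1 - al)%:C + h) = h ^+ k * H ((1 - al)%:C + h)).
Proof.
move=> M a1 sg1 al0 hA hs0 [_ _ hF EF] [H [/near_near0 h1 _ /near_near0 h2]].
exists H; pose m := Num.max s0 sg.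
have m1 : m < 1 - al by rewrite gt_max hs0.
have E z : m < Re z -> F z = abel_sum M z.
  apply: (@half_plane_identity _ F (abel_sum M) m 3%:C 1) => //; first by rewrite /=; lra.
  - move=> w; rewrite gt_max => /andP[w1 _]; apply: derivable_cderiv; exact: hF.
  - by move=> w; rewrite gt_max => /andP[_ w1]; have [] := hA w w1.
  - move=> h hh; have h3 : 1 < Re (3%:C + h).
      by rewrite ReD /=; have := cmod_Re h; have := ler_norm (- Re h); rewrite normrN; lra.
    rewrite EF //; apply: dirichlet_seriesE; apply: (@abel_sum_dirichlet _ a 1) => //.
    by have [|//] := hA (3%:C + h); lra.
have h3 : near0 (fun h : C => m < Re ((1 - al)%:C + h)).
  exists (1 - al - m); first by rewrite subr_gt0.
  by move=> h hh; rewrite ReD /=; have := cmod_Re h; have := ler_norm (- Re h); rewrite normrN;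
    lra.
apply: near0_imp (near0_and (near0_and h1 h2) h3) => h [[k1 k2] k3].
split; first exact: derivable_cderiv.
by rewrite -E // k2 addrAC subrr add0r.
Qed.
End riemann_zeta_function.

(** * Expectations of bounded variables *)

Section bounded_expectation.
Context {d : measure_display} {T : measurableType d} {R : realType}.
Variable P : probability T R.
Implicit Types (h : T -> R).

(** Bounded measurable functions are closed under sums and products and integrable under a
    probability, so no integrability conditions are carried along. *)
Definition bm h := measurable_fun [set: T] h /\ exists M : R, forall w, `|h w| <= M.

Definition Ex h : R := \int[P]_(w in [set: T]) h w.

Lemma bmD h h' : bm h -> bm h' -> bm (fun w => h w + h' w).
Proof.
move=> [m [M hM]] [m' [M' hM']]; split; first exact: measurable_funD.
by exists (M + M') => w; apply: le_trans (ler_normD _ _) _; rewrite lerD.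
Qed.

Lemma bmM h h' : bm h -> bm h' -> bm (fun w => h w * h' w).
Proof.
move=> [m [M hM]] [m' [M' hM']]; split; first exact: measurable_funM.
by exists (M * M') => w; rewrite normrM ler_pM.
Qed.

Lemma bm_cst (c : R) : bm (fun=> c).
Proof. by split; [exact: measurable_cst|exists `|c|]. Qed.

Lemma bmB h h' : bm h -> bm h' -> bm (fun w => h w - h' w).
Proof.
move=> hh hh'; have := bmD hh (bmM (bm_cst (-1)) hh').
by congr bm; apply/funext => w; rewrite mulN1r.
Qed.

Lemma bm_sum (I : Type) (r : seq I) (h : I -> T -> R) : (forall i, bm (h i)) ->
  bm (fun w => \sum_(i <- r) h i w).
Proof.
move=> hh; elim: r => [|i r IH].
  by under eq_fun do rewrite big_nil; exact: bm_cst.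
by under eq_fun do rewrite big_cons; apply: bmD.
Qed.

Lemma bm_indic (A : set T) : measurable A -> bm (fun w => \1_A w).
Proof.
move=> mA; split; first exact: measurable_indic.
by exists 1 => w; rewrite indicE; case: (w \in A); rewrite ?normr1 ?normr0.
Qed.

Lemma bm_integrable h : bm h -> P.-integrable [set: T] (EFin \o h).
Proof.
move=> [m [M hM]]; apply: measurable_bounded_integrable => //.
  by have := probability_le1 P (@measurableT _ T) => h1; apply: (le_lt_trans h1); exact: ltry.
by exists M; split; [exact: num_real|move=> x Mx w _; exact: le_trans (hM w) (ltW Mx)].
Qed.

Lemma Ex_EFin h : bm h -> (\int[P]_(w in [set: T]) (h w)%:E)%E = (Ex h)%:E.
Proof.
by move=> hh; rewrite /Ex /Rintegral fineK // integrable_fin_num // bm_integrable.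
Qed.

Lemma expectation_Ex h : bm h -> 'E_P[h]%E = (Ex h)%:E.
Proof. by move=> hh; rewrite unlock Ex_EFin. Qed.

Lemma ExD h h' : bm h -> bm h' -> Ex (fun w => h w + h' w) = Ex h + Ex h'.
Proof. by move=> hh hh'; rewrite /Ex RintegralD //; exact: bm_integrable. Qed.

Lemma ExB h h' : bm h -> bm h' -> Ex (fun w => h w - h' w) = Ex h - Ex h'.
Proof. by move=> hh hh'; rewrite /Ex RintegralB //; exact: bm_integrable. Qed.

Lemma ExZ (c : R) h : bm h -> Ex (fun w => c * h w) = c * Ex h.
Proof. by move=> hh; rewrite /Ex RintegralZl //; exact: bm_integrable. Qed.

Lemma Ex_cst (c : R) : Ex (fun=> c) = c.
Proof.
rewrite /Ex Rintegral_cst // -[RHS]mulr1; congr (_ * _).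
exact: (congr1 fine (probability_setT P)).
Qed.

Lemma Ex_sum (I : Type) (r : seq I) (h : I -> T -> R) : (forall i, bm (h i)) ->
  Ex (fun w => \sum_(i <- r) h i w) = \sum_(i <- r) Ex (h i).
Proof.
move=> hh; elim: r => [|i r IH].
  by rewrite big_nil; under eq_fun do rewrite big_nil; rewrite Ex_cst.
rewrite big_cons -IH -ExD //; last exact: bm_sum.
by congr Ex; apply/funext => w; rewrite big_cons.
Qed.

Lemma Ex_indic (A : set T) : measurable A -> Ex (fun w => \1_A w) = fine (P A).
Proof. by move=> mA; rewrite /Ex /Rintegral integral_indic // setIT. Qed.

Lemma bounded_nneseries (u : nat -> R) (B : R) : (forall n, 0 <= u n) ->
  (forall N, \sum_(0 <= n < N) u n <= B) -> (\sum_(0 <= n <oo) (u n)%:E <= B%:E)%E.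
Proof.
move=> u0 hB; apply: lime_le; first by apply: is_cvg_nneseries => n _ _; rewrite lee_fin.
by apply: nearW => N; rewrite sumEFin lee_fin.
Qed.

Lemma nneseries_bounded (u : nat -> R) : (forall n, 0 <= u n) ->
  (\sum_(0 <= n <oo) (u n)%:E \is a fin_num)%E ->
  exists B, forall N, \sum_(0 <= n < N) u n <= B.
Proof.
move=> u0 hf; exists (fine (\sum_(0 <= n <oo) (u n)%:E)%E) => N.
rewrite -lee_fin fineK // -sumEFin; apply: nneseries_lim_ge => n _ _.
by rewrite lee_fin.
Qed.

(** Monotone convergence: the sum of the series has expectation at most [B], so it is finite almost
    surely. *)
Lemma summable_ae (h : nat -> T -> R) (B : R) : (forall n, bm (h n)) ->
  (forall n w, 0 <= h n w) -> (forall N, \sum_(0 <= n < N) Ex (h n) <= B) ->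
  {ae P, forall w, exists B', forall N, \sum_(0 <= n < N) h n w <= B'}.
Proof.
move=> hb h0 hB; pose F (w : T) : \bar R := (\sum_(0 <= n <oo) (h n w)%:E)%E.
have mh n : measurable_fun [set: T] ((fun w => (h n w)%:E) : T -> \bar R).
  by apply/measurable_EFinP; have [] := hb n.
have F0 w : (0 <= F w)%E by apply: nneseries_ge0 => n _ _; rewrite lee_fin.
have mF : measurable_fun [set: T] F.
  by apply: ge0_emeasurable_sum => [n w _ _|n _]; [rewrite lee_fin|exact: mh].
have iF : P.-integrable [set: T] F.
  apply/integrableP; split => //.
  under eq_integral do rewrite gee0_abs //.
  rewrite /F integral_nneseries //; last by move=> n w _; rewrite lee_fin.
  under eq_eseriesr do rewrite Ex_EFin //.
  apply: le_lt_trans (_ : B%:E < +oo)%E; last exact: ltry.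
  apply: bounded_nneseries => // n; rewrite /Ex; apply: Rintegral_ge0 => // w _; exact: h0.
have := integrable_ae measurableT iF; apply: filterS => w /(_ I) hw.
by apply: nneseries_bounded.
Qed.
End bounded_expectation.

(** * Random multiplicative functions *)

Section multiplicative.
Context {d : measure_display} {T : measurableType d} {R : realType}.
Variable P : probability T R.
Variable f : nat -> {RV P >-> R}.
Hypothesis hf : random_multiplicative f.

Let sqf n := all (fun q => logn q n == 1%N) (primes n).

Lemma norm_moebius n : (0 < n)%N -> `|moebius n|%:~R = (sqf n)%:R :> R.
Proof.
move=> n0; rewrite /moebius n0 /= -/(sqf n); case: (sqf n); last by rewrite normr0.
by rewrite normrX normrN1 expr1n.
Qed.

Lemma rm_prime_norm p w : prime p -> `|f p w| = 1.
Proof.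
by case: hf => _ _ h _ /(h p w)[->|->]; rewrite ?normrN normr1.
Qed.

Lemma rm_expand n w : (0 < n)%N -> f n w = (sqf n)%:R * \prod_(p <- primes n) f p w.
Proof.
case: n => // -[|n] _.
  by case: hf => -> _ _ _; rewrite /sqf /= big_nil mulr1.
by case: hf => _ -> // _ _; rewrite norm_moebius.
Qed.

Lemma rm_bound n w : (0 < n)%N -> `|f n w| <= 1.
Proof.
move=> n0; rewrite rm_expand // normrM normr_prod big_seq big1 ?mulr1.
  by case: (sqf n); rewrite ?normr1 ?normr0.
by move=> p; rewrite mem_primes => /andP[pp _]; exact: rm_prime_norm.
Qed.

Lemma rm_mul p m w : prime p -> (0 < m)%N ->
  f (p * m)%N w = if (p %| m)%N then 0 else f p w * f m w.
Proof.
move=> pp m0; have p0 := prime_gt0 pp.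
have pm0 : (0 < p * m)%N by rewrite muln_gt0 p0.
rewrite (rm_expand w pm0); case: ifPn => dp.
  rewrite (_ : sqf (p * m) = false) ?mul0r //; apply/negP => /allP /(_ p).
  rewrite mem_primes pp pm0 dvdn_mulr // => /(_ isT).
  rewrite lognM // logn_prime // eqxx add1n eqSS => /eqP.
  by apply/eqP; rewrite -lt0n logn_gt0 mem_primes pp m0.
have pr : perm_eq (primes (p * m)) (p :: primes m).
  apply: uniq_perm; rewrite ?primes_uniq //= ?primes_uniq ?andbT.
    by rewrite mem_primes pp m0.
  by move=> q; rewrite primesM // primes_prime // !inE.
rewrite (perm_big _ pr) big_cons mulrCA (rm_expand w m0); congr (_ * (_ * _)).
congr (nat_of_bool _)%:R; rewrite /sqf (perm_all _ pr) /=.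
have lp : logn p m = 0%N.
  by apply/eqP; rewrite -leqn0 leqNgt logn_gt0 mem_primes pp m0.
rewrite lognM // logn_prime // eqxx lp addn0 eqxx /=.
apply: eq_in_all => q qm; rewrite lognM // logn_prime //.
case: (eqVneq p q) => [E|]; last by rewrite add0n.
by move: qm; rewrite -E mem_primes pp m0 (negbTE dp).
Qed.

Lemma rm_bm p : prime p -> bm (f p).
Proof.
move=> pp; split; first exact: measurable_funPT.
by exists 1 => w; rewrite rm_prime_norm.
Qed.

Let A p : set T := f p @^-1` [set 1].
Let mA p : measurable (A p).
Proof. by rewrite -[A p]setTI; apply: (measurable_funPT (f p)). Qed.

Let fA p w : prime p -> f p w = 2 * \1_(A p) w - 1.
Proof.
case: hf => _ _ h _ /(h p w) hw; rewrite indicE.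
case: hw => E; rewrite E.
  by rewrite mem_set //=; ring.
rewrite memNset /=; first by ring.
by rewrite /A /= E => h1; lra.
Qed.

Lemma rm_Ex p : prime p -> Ex P (f p) = 2 * fine (P (A p)) - 1.
Proof.
move=> pp; have b1 := @bm_indic _ _ R _ (mA p); have b2 := bmM (@bm_cst _ T R 2) b1.
rewrite -Ex_indic // -ExZ // -[X in _ - X](Ex_cst P 1) -ExB //; last exact: bm_cst.
by congr Ex; apply/funext => w; exact: fA.
Qed.

(** Independence speaks of events; a variable with values 1 and -1 is affine in the indicator of
    [A p], which reduces the claim to the probability of an intersection. *)
Lemma rm_indep p q : prime p -> prime q -> p <> q ->
  Ex P (fun w => f p w * f q w) = Ex P (f p) * Ex P (f q).
Proof.
move=> pp pq npq.
have PA : fine (P (A p `&` A q)) = fine (P (A p)) * fine (P (A q)).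
  case: hf => _ _ _ ind; pose s : seq primeT := [:: exist _ p pp; exist _ q pq].
  have us : uniq s by rewrite /s /= inE andbT -val_eqE /=; apply/eqP.
  have := ind s us (fun=> [set 1]) (fun=> measurable_set1 1).
  rewrite /s !big_cons !big_nil /= setIT mule1 => ->.
  by rewrite fineM // fin_num_measure.
have bp := @bm_indic _ _ R _ (mA p); have bq := @bm_indic _ _ R _ (mA q).
have bpq := @bm_indic _ _ R _ (measurableI _ _ (mA p) (mA q)).
have c2 := @bm_cst _ T R 2; have c4 := @bm_cst _ T R 4; have c1 := @bm_cst _ T R 1.
have -> : Ex P (fun w => f p w * f q w) =
    Ex P (fun w => 4 * \1_(A p `&` A q) w - 2 * \1_(A p) w - 2 * \1_(A q) w + 1).
  congr Ex; apply/funext => w; rewrite (fA w pp) (fA w pq) indicI /=; ring.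
rewrite ExD ?ExB ?ExZ ?Ex_cst ?Ex_indic //;
  try by [exact: measurableI|do ?[apply: bmB => //|apply: bmM => //|apply: bmD => //]].
by rewrite !rm_Ex // PA; ring.
Qed.

Variable e : nat -> R.
Hypothesis he : forall p, prime p -> 'E_P[f p]%E = (e p)%:E.

Lemma rm_Ex_e p : prime p -> Ex P (f p) = e p.
Proof. by move=> pp; have := he pp; rewrite (expectation_Ex P (rm_bm pp)) => -[]. Qed.

Let X n w : R := centered_coef (f ^~ w) e n.

Let X_bm n : bm (X n).
Proof.
rewrite /X /centered_coef; case: (boolP (prime n)) => pn; last exact: bm_cst.
by apply: bmB; [exact: rm_bm|exact: bm_cst].
Qed.

Lemma centered_coef_orth i j : Ex P (fun w => X i w * X j w) <= (i == j)%:R.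
Proof.
have zero : Ex P (fun=> 0) <= (i == j)%:R by rewrite Ex_cst.
rewrite /X /centered_coef; case: (boolP (prime i)) => pi; last by under eq_fun do rewrite mul0r.
case: (boolP (prime j)) => pj; last by under eq_fun do rewrite mulr0.
have bi := rm_bm pi; have bj := rm_bm pj.
have ci := @bm_cst _ T R (e i); have cj := @bm_cst _ T R (e j).
have -> : Ex P (fun w => (f i w - e i) * (f j w - e j)) =
    Ex P (fun w => f i w * f j w - e j * f i w - e i * f j w + e i * e j).
  by congr Ex; apply/funext => w; ring.
have bij := bmM bi bj; have cij := @bm_cst _ T R (e i * e j).
have b1 := bmM cj bi; have b2 := bmM ci bj; have b3 := bmB bij b1; have b4 := bmB b3 b2.
rewrite (ExD P b4 cij) (ExB P b3 b2) (ExB P bij b1) !ExZ // Ex_cst !rm_Ex_e //.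
case: eqP => [E|ne] /=; last by rewrite rm_indep // !rm_Ex_e //; lra.
subst j; rewrite (_ : Ex P _ = 1).
  by have := sqr_ge0 (e i); rewrite expr2; lra.
rewrite -[RHS](Ex_cst P); congr Ex; apply/funext => w.
by rewrite -expr2 -real_normK ?num_real // rm_prime_norm // expr1n.
Qed.

Let S n w : R := centered_sum (f ^~ w) e n.

Lemma centered_sum_bm n : bm (S n).
Proof. by rewrite /S /centered_sum; apply: bm_sum => j; exact: X_bm. Qed.

Lemma centered_sum_var n : Ex P (fun w => S n w * S n w) <= n%:R.
Proof.
have -> : Ex P (fun w => S n w * S n w) =
   Ex P (fun w => \sum_(1 <= i < n.+1) \sum_(1 <= j < n.+1) X i w * X j w).
  congr Ex; apply/funext => w; rewrite /S /centered_sum mulr_suml.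
  by apply: eq_bigr => i _; rewrite mulr_sumr.
rewrite Ex_sum; last by move=> i; apply: bm_sum => j; apply: bmM; exact: X_bm.
apply: le_trans (_ : \sum_(1 <= i < n.+1) 1 <= _); last first.
  by rewrite big_const_nat iter_addr_0 subSS subn0.
rewrite !big_nat; apply: ler_sum => i hi.
rewrite Ex_sum; last by move=> j; apply: bmM; exact: X_bm.
apply: le_trans (_ : \sum_(1 <= j < n.+1) (i == j)%:R <= _).
  by apply: ler_sum => j _; exact: centered_coef_orth.
rewrite (@bigD1_seq _ _ _ _ _ i) ?mem_index_iota ?iota_uniq //= eqxx big1 ?addr0 //.
by move=> j; rewrite eq_sym => /negbTE ->.
Qed.

(** Since the second moment of [S m] is at most [m] and [sg > 1/2], the series of
    [m^-(sg + 3/2) (S m)^2] has finite expectation. This one series, free of [rho], controls all the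
    sums in the conclusion, so a single null set serves every [rho]. *)
Lemma centered_sum_ae (sg : R) : 2^-1 < sg ->
  {ae P, forall w, forall rho, sg < rho -> exists B, forall n,
    \sum_(0 <= m < n) `|S m.+1 w| * m.+1%:R `^ (- (1 + rho)) <= B}.
Proof.
move=> hsg; pose u (m : nat) : R := m.+1%:R `^ (- (sg + 3 / 2)).
have u0 m : 0 <= u m by exact: powR_ge0.
have uE m : m.+1%:R * u m = m.+1%:R `^ (- (1 + (sg - 2^-1))).
  have p : m.+1%:R != 0 :> R by rewrite pnatr_eq0.
  rewrite /u -{1}[m.+1%:R]powRr1 // -powRD ?p ?implybT //; congr (_ `^ _); lra.
have b m : bm (fun w => S m.+1 w * S m.+1 w) by apply: bmM; exact: centered_sum_bm.
have ub m : bm (fun w => u m * (S m.+1 w * S m.+1 w)) by apply: bmM => //; exact: bm_cst.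
have := @summable_ae _ _ _ P (fun m w => u m * (S m.+1 w * S m.+1 w)) (1 + (sg - 2^-1)^-1) ub.
move=> H; apply: filterS (H _ _) => [w [B hB] rho hr|m w|N].
- exists ((B + (1 + (rho - 2^-1)^-1)) / 2) => n.
  have zb : \sum_(0 <= m < n) m.+1%:R `^ (- (1 + (rho - 2^-1))) <= 1 + (rho - 2^-1)^-1.
    by apply: zeta_bound; lra.
  apply: le_trans (_ : (\sum_(0 <= m < n) u m * (S m.+1 w * S m.+1 w) +
     \sum_(0 <= m < n) m.+1%:R `^ (- (1 + (rho - 2^-1)))) / 2 <= _); last by have := hB n; lra.
  rewrite -big_split mulr_suml; apply: ler_sum => m _ /=.
  have p : m.+1%:R != 0 :> R by rewrite pnatr_eq0.
  set x := S m.+1 w; set y := m.+1%:R : R.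
  set a := y `^ (- (1 + (rho - 2^-1))); set s := y `^ (- 2^-1).
  have -> : y `^ (- (1 + rho)) = a * s.
    by rewrite /a /s -powRD ?p ?implybT //; congr (_ `^ _); lra.
  have us : a * (s * s) <= u m.
    rewrite /a /s /u -!powRD ?p ?implybT //; apply: ler_powR; last by lra.
    by rewrite /y ler1n.
  have a0 : 0 <= a by exact: powR_ge0.
  (* AM-GM: [2 |x| s <= x^2 s^2 + 1] *)
  have k1 : 2 * (`|x| * (a * s)) <= a * (x * x * (s * s) + 1).
    have -> : x * x = `|x| * `|x| by rewrite -!expr2 real_normK // num_real.
    have := mulr_ge0 a0 (sqr_ge0 (`|x| * s - 1)); rewrite expr2 => k.
    have E : a * (`|x| * `|x| * (s * s) + 1) - 2 * (`|x| * (a * s)) =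
       a * ((`|x| * s - 1) * (`|x| * s - 1)) by ring.
    by rewrite -subr_ge0 E.
  have k2 : a * (s * s) * (x * x) <= u m * (x * x).
    by rewrite ler_wpM2r // -expr2 sqr_ge0.
  have E2 : a * (x * x * (s * s) + 1) = a * (s * s) * (x * x) + a by ring.
  by rewrite E2 in k1; lra.
- by rewrite mulr_ge0 // -expr2 sqr_ge0.
- apply: le_trans (_ : \sum_(0 <= m < N) m.+1%:R `^ (- (1 + (sg - 2^-1))) <= _).
    apply: ler_sum => m _; rewrite ExZ // -uE mulrC ler_wpM2r //.
    exact: centered_sum_var.
  by apply: zeta_bound; lra.
Qed.
End multiplicative.

(** * The uniform coupling *)

Section coupling.
Variable R : realType.
Variable P : probability (Omega R) R.
Implicit Types f g : nat -> {RV P >-> R}.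

Definition threshold f (p : primeT) : R := fine (P [set v | f (val p) v = -1]).

Lemma uniform_value f (p : primeT) (w : Omega R) : uniform_representation f ->
  f (val p) w = if val (w p) <= threshold f p then -1 else 1.
Proof.
move=> hu; rewrite hu -/(threshold f p) !indicE.
have /andP[x0 x1] := valP (w p); set x := val (w p) in x0 x1 *.
have [xa|ax] := leP x (threshold f p).
  rewrite memNset /=; last by rewrite in_itv /= x1 andbT; apply/negP; rewrite -leNgt.
  by rewrite mem_set /= ?in_itv /= ?x0 ?xa //; ring.
rewrite mem_set /= ?in_itv /= ?ax ?x1 // memNset /=; first by ring.
by rewrite in_itv /= x0 /=; apply/negP; rewrite -ltNge.
Qed.

Lemma threshold_Ex f (p : primeT) : random_multiplicative f ->
  Ex P (f (val p)) = 1 - 2 * threshold f p.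
Proof.
move=> hf; pose A : set (Omega R) := f (val p) @^-1` [set -1].
have mA : measurable A.
  by rewrite -[A]setTI; apply: (measurable_funPT (f (val p))).
have bA := @bm_indic _ _ R _ mA.
rewrite /threshold -[[set v | _]]/A -(Ex_indic P mA) -ExZ // -[X in X - _](Ex_cst P 1) -ExB //;
  last 2 first.
- exact: bm_cst.
- by apply: bmM => //; exact: bm_cst.
congr Ex; apply/funext => w; rewrite indicE.
case: hf => _ _ h _; case: (h _ w (valP p)) => E; rewrite E.
  rewrite memNset /=; first by ring.
  by rewrite /A /= E => h1; lra.
by rewrite mem_set //=; ring.
Qed.

(** A smaller mean is a larger threshold, so the two functions differ exactly when the coordinate
    lies in []a, b]]; there [1 - f p w * g p w] is 2, and [2 * (b - a)] is the difference of the
    means. *)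
Lemma coupling_le f g (p : nat) : random_multiplicative f -> random_multiplicative g ->
  uniformly_coupled f g -> prime p -> Ex P (g p) <= Ex P (f p) ->
  Ex P (fun w => 1 - f p w * g p w) <= Ex P (f p) - Ex P (g p).
Proof.
move=> hf hg [hP uf ug] pp; pose q : primeT := exist _ p pp.
have := threshold_Ex q hf; have := threshold_Ex q hg; rewrite /= => -> ->.
set a := threshold f q; set b := threshold g q => ab0; have ab : a <= b by lra.
pose E : set (Omega R) := [set w | (`]a, b]%classic : set R) (val (w q))].
have mE : measurable E.
  by apply: sub_sigma_algebra; exists q, (`]a, b]%classic : set R); [exact: measurable_itv|].
have -> : Ex P (fun w => 1 - f p w * g p w) = Ex P (fun w => 2 * \1_E w).
  congr Ex; apply/funext => w; rewrite indicE.
  have := uniform_value q w uf; have := uniform_value q w ug; rewrite /= -/a -/b => -> ->.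
  have [xa|ax] := leP (val (w q)) a.
    rewrite (le_trans xa ab) memNset /=; first by ring.
    by rewrite /E /= in_itv /= ltNge xa.
  have [xb|bx] := leP (val (w q)) b.
    by rewrite mem_set /=; [ring|rewrite /E /= in_itv /= ax xb].
  rewrite memNset /=; first by ring.
  by rewrite /E /= in_itv /= ax leNgt bx.
rewrite ExZ; last exact: bm_indic.
rewrite Ex_indic //.
suff : (P E <= (b - a)%:E)%E.
  move=> h; have : fine (P E) <= b - a.
    by rewrite -lee_fin fineK // fin_num_measure.
  lra.
(* Rewritten as a cylinder over one prime, the form in which the product rule is stated. *)
have -> : P E = P [set w : Omega R | forall p, p \in [:: q] -> (`]a, b]%classic : set R) (val
  (w p))].
  congr (P _); apply/seteqP; split => w /=.
    by move=> h p'; rewrite inE => /eqP ->.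
  by move=> h; apply: h; rewrite inE.
rewrite (hP [:: q] isT (fun=> `]a, b]%classic) (fun=> measurable_itv _)) big_seq1.
apply: le_trans (_ : lebesgue_measure (`]a, b]%classic : set R) <= _)%E.
  by apply: le_measure; rewrite ?inE; [apply: measurableI;
    exact: measurable_itv|exact: measurable_itv|exact: subIsetl].
rewrite lebesgue_measure_itv /= lte_fin; case: ifP => // _.
by rewrite lee_fin subr_ge0.
Qed.
End coupling.

(** * Passage to one outcome and conclusion *)

Lemma ae_exists (d : measure_display) (T : measurableType d) (R : realType)
  (P : probability T R) (Q : T -> Prop) : {ae P, forall w, Q w} -> exists w, Q w.
Proof.
move=> [A [mA A0 sA]]; apply: contrapT => nQ.
have AT : A = [set: T].
  by apply/seteqP; split => // w _; apply: sA => /= Qw; apply: nQ; exists w.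
have := probability_setT P; rewrite -AT A0 => /eqP.
by rewrite eq_sym onee_eq0.
Qed.

Lemma sqrte_lty (R : realType) (x : \bar R) : (x < +oo -> sqrte x < +oo)%E.
Proof. by case: x => [r| |] //= _; rewrite ltry. Qed.

(** Taking [e = 1] gives the bound from some point on; the finitely many earlier values are absorbed
    by their sum, as [(n + 1)^sg >= 1]. *)
Lemma littleo_bound (R : realType) (M : nat -> R) (F : R -> R) (sg : R) : 0 <= sg ->
  (forall n, F n%:R = M n) -> littleo_pinfty F (fun x => x `^ sg) ->
  exists K, forall n, `|M n.+1| <= K * n.+1%:R `^ sg.
Proof.
move=> sg0 FM /(_ 1 ltr01) [A [_ hA]].
pose N := (Num.truncn `|A|).+1.
have K0 : 0 <= \sum_(0 <= n < N) `|M n.+1| by apply: sumr_ge0.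
exists (1 + \sum_(0 <= n < N) `|M n.+1|) => n.
have p1 : 1 <= n.+1%:R `^ sg :> R.
  by rewrite -[leLHS](powRr0 n.+1%:R) ler_powR // ler1n.
have [nN|Nn] := ltnP n N.
  apply: le_trans (_ : (1 + \sum_(0 <= n < N) `|M n.+1|) * 1 <= _); last first.
    by rewrite ler_wpM2l // addr_ge0.
  rewrite mulr1 (@big_cat_nat _ _ _ n) //= ?(ltnW nN) // [X in _ <= _ + (_ + X)]big_ltn //.
  have s1 : 0 <= \sum_(0 <= i < n) `|M i.+1| by apply: sumr_ge0.
  have s2 : 0 <= \sum_(n.+1 <= i < N) `|M i.+1| by apply: sumr_ge0.
  lra.
have := hA n.+1%:R; rewrite FM mul1r (ger0_norm (powR_ge0 _ _)) => h.
apply: le_trans (h _) _; last by rewrite mulrDl mul1r lerDl mulr_ge0 // powR_ge0.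
apply: le_lt_trans (ler_norm _) _; apply: lt_le_trans (truncnS_gt _) _.
by rewrite ler_nat leqW.
Qed.

Theorem theorem5p2 (R : realType) (alpha : R) (k : nat)
    (halpha : 0 < alpha < 2^-1) (hk : (0 < k)%N)
    (P : probability (Omega R) R)
    (f fak : nat -> {RV P >-> R}) (delta : nat -> R)
    (hf : random_multiplicative f) (hfw : weakly_biased f)
    (hfE : forall p, prime p ->
       'E_P[f p]%E = (- (delta p / p%:R `^ alpha))%:E)
    (hdelta : forall p, prime p -> delta p <= k%:R)
    (hfak : random_multiplicative fak)
    (hcoupled : uniformly_coupled f fak)
    (hfakE : forall p, prime p ->
       'E_P[fak p]%E = (if 1 <= k%:R / p%:R `^ alpha then -1
                      else - (k%:R / p%:R `^ alpha))%:E)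
    (hzero : {ae P, forall w, exists (s0 : R) (F : R[i]^o -> R[i]^o),
       [/\ s0 < 1 - alpha,
           analytic_continuation (f ^~ w)
             [set z : R[i]^o | s0 < complex.Re z] F &
           zero_of_multiplicity F (1 - alpha)%:C k]})
    (eps : R) (heps : 0 < eps < 2^-1 - alpha)
    (hM : {ae P, forall w,
       littleo_pinfty (summatory f w) (fun x => x `^ (1 - alpha - eps))}) :
  {ae P, forall w, forall s : R, 1 - alpha - eps < s ->
     (distD s f fak w < +oo)%E} /\
  (forall z : R[i]^o, 1 - eps < complex.Re z -> z <> 1 ->
     riemann_zeta z <> 0).
Proof.
case/andP: halpha => al0 al1; case/andP: heps => ep0 ep1.
set sg := 1 - alpha - eps.
have sg1 : 2^-1 < sg by rewrite /sg; lra.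
have sg2 : sg < 1 - alpha by rewrite /sg; lra.
pose e p : R := - (delta p / p%:R `^ alpha).
have he p : prime p -> 'E_P[f p]%E = (e p)%:E by exact: hfE.
have eE p : prime p -> Ex P (f p) = e p by move=> pp; exact: (rm_Ex_e hf he).
have e_le1 p : prime p -> `|e p| <= 1.
  move=> pp; rewrite -eE //; have := rm_Ex hf pp => ->.
  set A := f p @^-1` _; have mA : measurable A.
    by rewrite -[A]setTI; apply: (measurable_funPT (f p)).
  have A0 : 0 <= fine (P A) by rewrite fine_ge0 // measure_ge0.
  have A1 : fine (P A) <= 1.
    by rewrite -lee_fin fineK ?fin_num_measure //; exact: probability_le1.
  by rewrite ler_norml; apply/andP; split; lra.
have e_le0 p : prime p -> e p <= 0.
  by move=> pp; case: hfw => /(_ p pp) + _; rewrite he // lte_fin => /ltW.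
have e_k p : prime p -> 0 <= k%:R * p%:R `^ (- alpha) + e p.
  move=> pp; rewrite /e powRN subr_ge0 ler_wpM2r ?invr_ge0 ?powR_ge0 //.
  exact: hdelta.
(* The minimum of 1 and [k / p^alpha], which is the negated mean of [fak p]. Being at most
   [k / p^alpha], it lets [excess_coef] bound the difference of the means. *)
pose kap p : R := if 1 <= k%:R / p%:R `^ alpha then 1 else k%:R / p%:R `^ alpha.
have kapE p : prime p -> Ex P (fak p) = - kap p.
  move=> pp; have := hfakE p pp; rewrite (expectation_Ex P (rm_bm hfak pp)) => -[->].
  by rewrite /kap; case: ifP.
have kap_le p : kap p <= k%:R * p%:R `^ (- alpha).
  by rewrite /kap powRN; case: ifP.
(* The means are ordered as [coupling_le] requires: where [fak p] has mean -1 this is trivial,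
   elsewhere it is [delta p <= k]. *)
have kap_e p : prime p -> - kap p <= e p.
  move=> pp; rewrite /kap; case: ifP => _.
    by have := e_le1 p pp; rewrite ler_norml => /andP[].
  by have := e_k p pp; rewrite powRN; lra.
have hS := centered_sum_ae hf he sg1.
have [w0 [[hz hm] hs]] : exists w, ((exists (s0 : R) (F : R[i]^o -> R[i]^o),
       [/\ s0 < 1 - alpha,
           analytic_continuation (f ^~ w)
             [set z : R[i]^o | s0 < complex.Re z] F &
           zero_of_multiplicity F (1 - alpha)%:C k]) /\
       littleo_pinfty (summatory f w) (fun x => x `^ sg)) /\
    (forall rho, sg < rho -> exists B, forall n,
    \sum_(0 <= m < n) `|centered_sum (f ^~ w) e m.+1| * m.+1%:R `^ (- (1 + rho)) <= B).
  apply: (@ae_exists _ _ _ P); apply: filterI; last exact: hS.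
  by apply: filterI; [exact: hzero|exact: hM].
pose g n := f n w0.
have g1 : g 1%N = 1 by case: hf => h _ _ _; exact: h.
have gb n : (0 < n)%N -> `|g n| <= 1 by move=> n0; exact: (rm_bound hf w0 n0).
have gm p m : prime p -> (0 < m)%N -> g (p * m)%N = if (p %| m)%N then 0 else g p * g m.
  by move=> pp m0; exact: (rm_mul hf).
have hMK : exists K, forall n, `|coef_sum g n.+1| <= K * n.+1%:R `^ sg.
  apply: (littleo_bound _ _ hm); first by lra.
  by move=> n; rewrite /summatory natrK.
have hF := series_fun_hol sg1 hMK.
have [H hH] : exists H : R[i] -> R[i], near0 (fun h => hol H ((1 - alpha)%:C + h) /\
    series_fun g ((1 - alpha)%:C + h) = h ^+ k * H ((1 - alpha)%:C + h)).
  case: hz => s0 [F [h1 h2 h3]].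
  by apply: (continuation_zero _ sg2 al0 hF h1 h2 h3) => n; exact: gb.
(* The outcome [w0] has disappeared from this bound: [excess_coef] is built from means. *)
have csum rho : sg < rho -> exists B, forall n,
    \sum_(0 <= m < n) excess_coef alpha k e m * m%:R `^ (- rho) <= B.
  by apply: (excess_summable (g := g) (H := H)).
split; last first.
  move=> z hz1 z1; have z0 : 0 < complex.Re z by lra.
  rewrite riemann_zetaE // /zeta => /eqP; rewrite mulf_eq0 invr_eq0 subr_eq0.
  case/orP => [/eqP Z0|/eqP]; last by [].
  have := @shifted_zeta_neq0 R alpha k sg g e H; rewrite /sg => Hz.
  have : zeta1 z != 0 by apply: Hz => //; lra.
  by rewrite Z0 eqxx.
(* Countably many exponents [sg + 1 / (n + 1)] suffice, as the terms decrease in the exponent; this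
   leaves one null set for the uncountably many [s]. *)
have step n : {ae P, forall w, exists B, forall N, \sum_(0 <= m < N)
    (if prime m then (1 - f m w * fak m w) * m%:R `^ (- (sg + n.+1%:R^-1)) else 0) <= B}.
  have [|B hB] := csum (sg + n.+1%:R^-1); first by rewrite ltrDl invr_gt0.
  have b1 m : prime m -> bm (fun w => 1 - f m w * fak m w).
    move=> pm; apply: bmB; first exact: bm_cst.
    by apply: bmM; [exact: (rm_bm hf)|exact: (rm_bm hfak)].
  have b2 m : bm (fun w => if prime m then (1 - f m w * fak m w) * m%:R `^ (- (sg +
    n.+1%:R^-1)) else 0 : R).
    case: (boolP (prime m)) => pm; last exact: bm_cst.
    by apply: bmM; [exact: b1|exact: bm_cst].
  apply: (@summable_ae _ _ _ P _ B b2).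
    move=> m w; case: ifP => // pm; rewrite mulr_ge0 ?powR_ge0 // subr_ge0.
    apply: le_trans (ler_norm _) _.
    by rewrite normrM (rm_prime_norm hf) // (rm_prime_norm hfak) // mulr1.
  move=> N; apply: le_trans (hB N); apply: ler_sum => m _; rewrite /excess_coef.
  case: (boolP (prime m)) => pm; last by rewrite Ex_cst mul0r.
  under eq_fun do rewrite mulrC.
  rewrite ExZ; last exact: b1.
  rewrite mulrC ler_wpM2r ?powR_ge0 //.
  apply: le_trans (coupling_le hf hfak hcoupled pm _) _; rewrite eE // kapE //.
    exact: kap_e.
  by rewrite opprK addrC lerD2r.
have all_n : {ae P, forall w, forall n, exists B, forall N, \sum_(0 <= m < N)
    (if prime m then (1 - f m w * fak m w) * m%:R `^ (- (sg + n.+1%:R^-1)) else 0) <= B}.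
  exact/ae_foralln.
apply: filterS all_n => w hw s hs1.
pose n := Num.truncn (s - sg)^-1.
have ssg : 0 < s - sg by rewrite subr_gt0.
have nle : n.+1%:R^-1 <= s - sg.
  by rewrite -[leRHS]invrK lef_pV2 ?posrE ?invr_gt0 // ltW // truncnS_gt.
have [B hB] := hw n.
rewrite /distD; apply: sqrte_lty; apply: le_lt_trans (ltry B).
rewrite eseries_mkcond.
have pos m : prime m -> 0 <= 1 - f m w * fak m w.
  move=> pm; rewrite subr_ge0; apply: le_trans (ler_norm _) _.
  by rewrite normrM (rm_prime_norm hf) // (rm_prime_norm hfak) // mulr1.
rewrite (@eq_eseriesr _ _ (fun m => (if prime m then (1 - f m w * fak m w) / m%:R `^ s else
  0)%:E)); last first.
  by move=> m _; case: ifP.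
apply: bounded_nneseries => [m|N].
  by case: ifP => // pm; rewrite divr_ge0 ?pos ?powR_ge0.
apply: le_trans (hB N); apply: ler_sum => m _; case: ifP => // pm.
by rewrite -powRN ler_wpM2l ?pos // powR_le_exp ?prime_gt0 // -lerBrDl.
Qed.
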